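(* Let $W=\mathbb{R}^3(x,y,z)$ with contact form $\alpha=dz-y\,dx$, and let $\hat G=\mathrm{CSp}(2,\mathbb{R})=\mathrm{GL}(2,\mathbb{R})$ act on $W$ by $$\Phi_A(x,y,z)=\bigl(ax+by,\ cx+dy,\ (ad-bc)(z-\tfrac12xy)+\tfrac12(ax+by)(cx+dy)\bigr),\quad A=\begin{pmatrix}a&b\\c&d\end{pmatrix},$$ and trivially on the values $u$ of functions $u=u(x,y,z)$. Then the algebra of differential invariants of the $\hat G$-action on the space $J^\infty(W)$ of infinite jets of functions on $W$ is generated as follows: $$\mathcal{A}_{\hat G}=\langle I_0,I_{2f}\,;\,\nabla_1,\nabla_2,\nabla_3\ |\ \mathcal{R}_i=0,\ i=1,\dots,7\rangle,$$ where the invariants, the invariant derivations and the differential syzygies $\mathcal{R}_1,\dots,\mathcal{R}_7$ are those listed in the context.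
   Context: Jets and invariants. $J^k(W)$ is the space of $k$-jets of functions $u=u(x,y,z)$, with coordinates $x,y,z,u$, $u_1=u_x$, $u_2=u_y$, $u_3=u_z$, $u_{i,j}$ the second derivatives (indices $1,2,3$ refer to $x,y,z$), etc.; $\mathcal{D}_x,\mathcal{D}_y,\mathcal{D}_z$ are the total derivatives. $\hat G$ acts on $J^k(W)$ by prolongation. A differential invariant of order $k$ is a function on $J^k(W)$ constant on the orbits of the prolonged action; differential invariants are taken to be rational functions of the jet-variables (and may be chosen polynomial starting from some jet-order). $\mathcal{A}_{\hat G}$ is the algebra of all differential invariants. An invariant derivation is a combination of total derivatives, with coefficients functions on a finite jet space, commuting with the prolonged action. The notation $\langle I_i;\nabla_j\mid\mathcal{R}_l=0\rangle$ means that the algebra is generated by the functions $\nabla_JI_i$ ($\nabla_J$ iterated compositions of the $\nabla_j$), and that the $\mathcal{R}_l$ form a generating set of the differential syzygies (relations among the generators, including commutator relations of the derivations). Derivations: $\nabla_1=x\mathcal{D}_x+y\mathcal{D}_y+2z\mathcal{D}_z$, $\nabla_2=(xy-2z)\mathcal{D}_z$, $\nabla_3=(xu_3+u_2)(xy-2z)\mathcal{D}_x-u_1(xy-2z)\mathcal{D}_y-xu_1(xy-2z)\mathcal{D}_z$. Invariants of order at most 1: $I_0=u$, $\ I_{1a}=(xy-2z)u_3=\nabla_2(I_0)$, $\ I_{1b}=xu_1+y(u_2+xu_3)=(\nabla_1+\nabla_2)(I_0)$. Invariants of order 2: $I_{2a}=y^2u_{2,2}+y(4zu_{2,3}+2xu_{1,2}+u_2)+4z^2u_{3,3}+z(4xu_{1,3}+4u_3)+x(xu_{1,1}+u_1)$,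 $I_{2b}=(xy-2z)(yu_{2,3}+2zu_{3,3}+xu_{1,3}+2u_3)$, $I_{2c}=-(xy-2z)\bigl(x^2(u_1u_{1,3}-u_3u_{1,1})+x(u_1(yu_{2,3}+2zu_{3,3}+u_3+u_{1,2})-yu_3u_{1,2}-2zu_3u_{1,3}-u_2u_{1,1})+u_1(yu_{2,2}+2zu_{2,3})-u_2(yu_{1,2}+2zu_{1,3})\bigr)$, $I_{2d}=(xy-2z)(-2u_3+(xy-2z)u_{3,3})$, $I_{2e}=-(xy-2z)\bigl(x^2y(u_1u_{3,3}-u_3u_{1,3})+x(y(u_1u_{2,3}-u_3^2-u_2u_{1,3})+u_1(-2zu_{3,3}-u_3)+2zu_3u_{1,3})-yu_2u_3-2z(u_1u_{2,3}-u_2u_{1,3})\bigr)$, $$\begin{aligned}I_{2f}=(xy-2z)^2\bigl[&x^2(u_1^2u_{3,3}-2u_1u_3u_{1,3}+u_3^2u_{1,1})\\&+x(2u_1^2u_{2,3}-u_1u_3^2-2u_1u_3u_{1,2}-2u_1u_2u_{1,3}+2u_2u_3u_{1,1})\\&+u_1^2u_{2,2}-u_1u_2u_3-2u_1u_2u_{1,2}+u_2^2u_{1,1}\bigr].\end{aligned}$$ The invariants $I_{2a},\dots,I_{2e}$ can be expressed through $I_0,I_{1a},I_{1b}$ and the invariant derivations. Syzygies: $\mathcal{R}_1=\nabla_3(I_0)$, $\mathcal{R}_2=[\nabla_1,\nabla_2]$, $\mathcal{R}_3=(I_{1a}+I_{1b})[\nabla_1,\nabla_3]+I_{2c}(\nabla_1+\nabla_2)-(I_{2a}+I_{2b})\nabla_3$,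 $\mathcal{R}_4=(I_{1a}+I_{1b})[\nabla_2,\nabla_3]-(I_{1b}(I_{1a}+I_{1b})-I_{2e})\nabla_1+(I_{1a}(I_{1a}+I_{1b})+I_{2e})\nabla_2-(I_{2b}+I_{2d}-2(I_{1a}+I_{1b}))\nabla_3$, $\mathcal{R}_5=(I_{1a}+I_{1b})(\nabla_3(I_{2b})-\nabla_1(I_{2e}))-(I_{2c}-I_{2e})I_{2b}+I_{2a}I_{2e}-I_{2c}I_{2d}$, $\mathcal{R}_6=(I_{1a}+I_{1b})(\nabla_3(I_{2c})-\nabla_1(I_{2f}))-3I_{2c}^2-(I_{1a}^2+I_{1a}I_{1b}+3I_{2e})I_{2c}+3I_{2f}(I_{2a}+I_{2b})$, $\mathcal{R}_7=(I_{1a}+I_{1b})(-\nabla_3(I_{2e})+\nabla_2(I_{2f}))-I_{1b}^4-4I_{1a}I_{1b}^3-(5I_{1a}^2+2I_{2c})I_{1b}^2-(2I_{1a}^3+(2I_{2c}-3I_{2e})I_{1a}+4I_{2f})I_{1b}+3I_{2e}I_{1a}^2+4I_{2f}I_{1a}+3I_{2e}^2+3I_{2c}I_{2e}-3I_{2f}(I_{2b}+I_{2d})$.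
   Formalization: In R_3–R_7, I_1a and I_1b are read as ∇_1(I_0) and ∇_2(I_0), and in R_7 the term +4I_2f in the factor of I_1b is −4I_2f (as printed, these are not identities); generation allows quotients, and syzygies are generated up to multiplication by a non-relation. *)

(* Defs.v *)
From HB Require Import structures.
From mathcomp Require Import all_boot all_order all_algebra.
From mathcomp Require Import finmap boolp reals.
From mathcomp.multinomials Require Import monalg.
From mathcomp.multinomials Require mpoly.

Set Implicit Arguments.
Unset Strict Implicit.
Unset Printing Implicit Defensive.

Import Order.TTheory GRing.Theory Num.Theory.
Local Open Scope ring_scope.
Local Open Scope quotient_scope.

(* The polynomial ring over a domain in an arbitrary set V of variables is a
   domain: two polynomials only involve finitely many variables, and can be
   transported to a ring {mpoly R[n]}. *)
Section Restrict.
Import mpoly.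
Context (V : choiceType) (R : idomainType) (E : seq V).
Let n := size E.
Definition restr_mnm (m : cmonom V) : mpoly.multinom n :=
  mpoly.Multinom [tuple m (tnth (in_tuple E) i) | i < n].
Lemma restr_mnmE m i : mpoly.fun_of_multinom (restr_mnm m) i = m (tnth (in_tuple E) i).
Proof. by rewrite /restr_mnm mpoly.mnmE. Qed.
Definition restr_pol (m : cmonom V) : mpoly.mpoly n R := mpoly.mpolyX R (restr_mnm m).
Lemma restr_polM : mmorphism restr_pol.
Proof.
split=> [m1 m2|].
  rewrite /restr_pol -mpoly.mpolyXD; congr (mpoly.mpolyX _ _).
  by apply/mpoly.mnmP=> i; rewrite mpoly.mnmDE !restr_mnmE cmM.
rewrite /restr_pol -mpoly.mpolyX0; congr (mpoly.mpolyX _ _).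
by apply/mpoly.mnmP=> i; rewrite mpoly.mnm0E restr_mnmE cm1.
Qed.
HB.instance Definition _ := isMultiplicative.Build _ _ restr_pol restr_polM.
Definition restr (p : {malg R[cmonom V]}) : mpoly.mpoly n R :=
  monalg.mmap (@mpoly.mpolyC n R) restr_pol p.
Lemma restrM p q : restr (p * q) = restr p * restr q.
Proof. exact: (rmorphM (monalg.mmap (@mpoly.mpolyC n R) restr_pol)). Qed.
Lemma restr0 : restr 0 = 0.
Proof. exact: (raddf0 (monalg.mmap (@mpoly.mpolyC n R) restr_pol)). Qed.
Lemma restr_eq0 (p : {malg R[cmonom V]}) :
  (forall m : cmonom V, m \in monalg.msupp p -> {subset finsupp m <= E}) -> restr p = 0 -> p = 0.
Proof.
move=> sE p0; apply/eqP; apply: contraT => nz.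
have [m mp] : exists m, m \in monalg.msupp p.
  by apply/fset0Pn; rewrite monalg.msupp_eq0.
have: mpoly.mcoeff (restr_mnm m) (restr p) = monalg.mcoeff m p.
  rewrite /restr monalg.mmapE raddf_sum (big_fsetD1 m mp) /=.
  rewrite mpoly.mcoeffCM mpoly.mcoeffX eqxx mulr1 big_seq big1 ?addr0 // => k.
  rewrite in_fsetD1 => /andP[nkm kp]; rewrite mpoly.mcoeffCM mpoly.mcoeffX.
  case: eqP => [e|]; last by rewrite mulr0.
  case/negP: nkm; apply/cmP => v.
  have [vE|vE] := boolP (v \in E).
    have iv : (index v E < n)%N by rewrite index_mem.
    have := congr1 (fun x : mpoly.multinom n => mpoly.fun_of_multinom x (Ordinal iv)) e.
    by rewrite !restr_mnmE (tnth_nth v) /= nth_index.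
  have z0 m' : m' \in monalg.msupp p -> m' v = 0%N.
    move=> /sE s; apply/eqP; rewrite cmE_eq0; apply: contra vE; exact: s.
  by rewrite !z0.
by rewrite p0 raddf0 => /esym/eqP; rewrite monalg.mcoeff_eq0 mp.
Qed.
Lemma restrM_eq0 (p q : {malg R[cmonom V]}) :
  p * q = 0 -> restr p = 0 \/ restr q = 0.
Proof.
move=> pq0; have h : restr p * restr q == 0 by rewrite -restrM pq0 restr0.
by move: h; rewrite mulf_eq0 => /orP[/eqP|/eqP]; [left|right].
Qed.
End Restrict.

Section Idomain.
Context (V : choiceType) (R : idomainType).
Local Notation S := (malg (cmonom V) R).
Lemma malg_integral : GRing.integral_domain_axiom S.
Proof.
move=> p q pq0.
pose E (r : S) :=
  flatten [seq (finsupp m : seq V) | m : cmonom V <- enum_fset (msupp r)].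
have sE (r : S) (m : cmonom V) : m \in msupp r -> {subset finsupp m <= E r}.
  move=> mr v vm; apply/flattenP; exists (finsupp m : seq V) => //.
  by apply/mapP; exists m.
have sE1 (m : cmonom V) (mp : m \in msupp p) : {subset finsupp m <= E p ++ E q}.
  by move=> v vm; rewrite mem_cat (sE _ _ mp).
have sE2 (m : cmonom V) (mq : m \in msupp q) : {subset finsupp m <= E p ++ E q}.
  by move=> v vm; rewrite mem_cat (sE _ _ mq) ?orbT.
case: (restrM_eq0 (E p ++ E q) pq0) => h.
  by rewrite (restr_eq0 sE1 h) eqxx.
by rewrite (restr_eq0 sE2 h) eqxx orbT.
Qed.
Definition malg_unit : {pred S} := fun p => `[< exists q, q * p = 1 >].
Definition malg_inv (p : S) : S :=
  if pselect (exists q, q * p = 1) is left h then sval (cid h) else p.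
Lemma malg_mulVx : {in malg_unit, left_inverse 1 malg_inv *%R}.
Proof.
move=> p /asboolP h; rewrite /malg_inv; case: pselect => [h'|//].
exact: (svalP (cid h')).
Qed.
Lemma malg_unitP (p q : S) : q * p = 1 -> malg_unit p.
Proof. by move=> e; apply/asboolP; exists q. Qed.
Lemma malg_inv_out : {in [predC malg_unit], malg_inv =1 id}.
Proof. by move=> p /asboolPn h; rewrite /malg_inv; case: pselect. Qed.
HB.instance Definition _ := GRing.ComNzRing_hasMulInverse.Build S
  malg_mulVx malg_unitP malg_inv_out.
HB.instance Definition _ := GRing.ComUnitRing_isIntegral.Build S malg_integral.
End Idomain.

Notation "{ 'vpoly' R [ V ] }" := {malg R[{cmonom V}]}
  (at level 0, R, V at level 2, format "{ 'vpoly'  R [ V ] }") : type_scope.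

Definition pvar (R : nzRingType) (V : choiceType) (v : V) : {vpoly R[V]} :=
  mkmalgU (ucm v) 1.

Definition peval (R : nzRingType) (T : comNzRingType) (V : choiceType)
    (c : R -> T) (t : V -> T) (p : {vpoly R[V]}) : T :=
  mmap c (fun m : cmonom V => \prod_(v <- finsupp m) t v ^+ m v) p.

(* The R-linear derivation sending each variable v to d v, computed as the
   coefficient of 'X in p(v + d v * 'X). *)
Definition pder (R : comNzRingType) (V : choiceType)
    (d : V -> {vpoly R[V]}) (p : {vpoly R[V]}) : {vpoly R[V]} :=
  (peval (fun c => (malgC c : {vpoly R[V]})%:P)
         (fun v => (pvar R v)%:P + (d v)%:P * 'X) p)`_1.

Section Presentation.
Context (R : fieldType) (F : fieldType) (cst : R -> F).
Context (I : choiceType) (n : nat).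

(* The free differential ring with non-commuting derivations: the variable
   (i, [:: j1; ...; jk]) stands for D_j1 (... (D_jk (generator i))). *)
Definition formal : comNzRingType := {vpoly R[(I * seq 'I_n)%type]}.

Definition fgen (i : I) : formal := pvar R (i, [::]).

Definition fnabla (j : 'I_n) : formal -> formal :=
  pder (fun w : I * seq 'I_n => pvar R (w.1, j :: w.2)).

Context (gen : I -> F) (nabla : 'I_n -> F -> F).

Definition feval (P : formal) : F :=
  peval cst
    (fun w : I * seq 'I_n => foldr (fun j f => nabla j f) (gen w.1) w.2) P.

Inductive diff_ideal (Rel : formal -> Prop) : formal -> Prop :=
| DIzero : diff_ideal Rel 0
| DIgen P of Rel P : diff_ideal Rel P
| DIadd P Q of diff_ideal Rel P & diff_ideal Rel Q : diff_ideal Rel (P + Q)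
| DImul Q P of diff_ideal Rel P : diff_ideal Rel (Q * P)
| DIder j P of diff_ideal Rel P : diff_ideal Rel (fnabla j P).

(* The elements of A are rational functions, so A is the image of the ring L of
   fractions P / Q of formal polynomials with feval Q != 0; the last clause says
   that the kernel of L -> A is generated, as an ideal of L, by the differential
   consequences of Rel. *)
Definition presented_by (A : F -> Prop) (Rel : formal -> Prop) : Prop :=
  [/\ forall P, A (feval P),
      forall f, A f ->
        exists P Q, feval Q != 0 /\ f = feval P / feval Q,
      forall P, Rel P -> feval P = 0
    & forall P, feval P = 0 ->
        exists Q, feval Q != 0 /\ diff_ideal Rel (Q * P)].

End Presentation.

(* The relations R_1, ..., R_7, in any commutative ring T with three operators
   D d1, D d2, D d3 and two elements I0, I2f, so that they make sense both for
   functions on the jet space and for formal generators.  R_2, R_3, R_4 are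
   relations between operators, evaluated at an arbitrary f : T. *)

Definition d1 : 'I_3 := @Ordinal 3 0 isT.
Definition d2 : 'I_3 := @Ordinal 3 1 isT.
Definition d3 : 'I_3 := @Ordinal 3 2 isT.

Section Syzygies.
Context (T : comNzRingType) (D : 'I_3 -> T -> T) (I0 I2f : T).

Local Notation "'N1'" := (D d1).
Local Notation "'N2'" := (D d2).
Local Notation "'N3'" := (D d3).

Definition commutator (X Y : T -> T) (f : T) : T := X (Y f) - Y (X f).

(* K1 and K2 stand where the published formulas for R_3, ..., R_7 print I_1a
   and I_1b: these formulas hold for I_1a = N1 I0 and I_1b = N2 I0, and not for
   the invariants N2 I0 and (N1 + N2) I0 that the same source denotes so. *)
Let K1 := N1 I0.
Let K2 := N2 I0.
Let S := K1 + K2.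
Let I2a := N1 (N1 I0).
Let I2b := N1 (N2 I0).
Let I2c := N3 (N1 I0).
Let I2d := N2 (N2 I0).
Let I2e := N3 (N2 I0).

Definition R1 : T := N3 I0.
Definition R2 (f : T) : T := commutator N1 N2 f.
Definition R3 (f : T) : T :=
  S * commutator N1 N3 f + I2c * (N1 f + N2 f) - (I2a + I2b) * N3 f.
Definition R4 (f : T) : T :=
  S * commutator N2 N3 f - (K2 * S - I2e) * N1 f + (K1 * S + I2e) * N2 f
  - (I2b + I2d - 2 * S) * N3 f.
Definition R5 : T :=
  S * (N3 I2b - N1 I2e) - (I2c - I2e) * I2b + I2a * I2e - I2c * I2d.
Definition R6 : T :=
  S * (N3 I2c - N1 I2f) - 3 * I2c ^+ 2
  - (K1 ^+ 2 + K1 * K2 + 3 * I2e) * I2c + 3 * I2f * (I2a + I2b).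
(* The term - 4 * I2f below is printed as + 4 I_2f in the source; only the
   former makes R_7 vanish. *)
Definition R7 : T :=
  S * (- N3 I2e + N2 I2f) - K2 ^+ 4 - 4 * K1 * K2 ^+ 3
  - (5 * K1 ^+ 2 + 2 * I2c) * K2 ^+ 2
  - (2 * K1 ^+ 3 + (2 * I2c - 3 * I2e) * K1 - 4 * I2f) * K2
  + 3 * I2e * K1 ^+ 2 + 4 * I2f * K1 + 3 * I2e ^+ 2 + 3 * I2c * I2e
  - 3 * I2f * (I2b + I2d).

Inductive syzygy : T -> Prop :=
| Syz1 : syzygy R1
| Syz2 f : syzygy (R2 f)
| Syz3 f : syzygy (R3 f)
| Syz4 f : syzygy (R4 f)
| Syz5 : syzygy R5
| Syz6 : syzygy R6
| Syz7 : syzygy R7.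

End Syzygies.

(* Coordinates on J^oo(W): inl d1, inl d2, inl d3 are x, y, z, and
   inr (i, j, k) is the derivative of u, i times in x, j in y and k in z. *)
Definition jetvar : choiceType := ('I_3 + nat * nat * nat)%type.

Section Jets.
Context (R : realType).

Local Notation "p %:F" := (FracField.tofrac p).

Definition jetpoly : idomainType := {vpoly R[jetvar]}.
Definition jetfun : fieldType := {fraction jetpoly}.

Definition jconst (c : R) : jetfun := (malgC c : jetpoly)%:F.
Definition base (i : 'I_3) : jetfun := (pvar R (inl i : jetvar) : jetpoly)%:F.
Definition jet (i j k : nat) : jetfun :=
  (pvar R (inr (i, j, k) : jetvar) : jetpoly)%:F.

Definition numer (f : jetfun) : jetpoly := \n_(repr f).
Definition denom (f : jetfun) : jetpoly := \d_(repr f).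

Definition total_var (s : 'I_3) (v : jetvar) : jetpoly :=
  match v with
  | inl i => (i == s)%:R
  | inr (i, j, k) =>
      pvar R (inr ((i + (s == d1))%N, (j + (s == d2))%N, (k + (s == d3))%N)
              : jetvar)
  end.

Definition total_poly (s : 'I_3) : jetpoly -> jetpoly := pder (total_var s).

(* The total derivatives, by the quotient rule. *)
Definition total (s : 'I_3) (f : jetfun) : jetfun :=
  (total_poly s (numer f) * denom f - numer f * total_poly s (denom f))%:F
  / (denom f ^+ 2)%:F.

Local Notation x := (base d1).
Local Notation y := (base d2).
Local Notation z := (base d3).
Local Notation u := (jet 0 0 0).
Local Notation u1 := (jet 1 0 0).
Local Notation u2 := (jet 0 1 0).
Local Notation u3 := (jet 0 0 1).
Local Notation u11 := (jet 2 0 0).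
Local Notation u12 := (jet 1 1 0).
Local Notation u13 := (jet 1 0 1).
Local Notation u22 := (jet 0 2 0).
Local Notation u23 := (jet 0 1 1).
Local Notation u33 := (jet 0 0 2).

(* Phi_A, with the rows of A being (a, b) and (c, d). *)
Definition Phi (A : 'M[R]_2) : 'I_3 -> jetfun :=
  let X := jconst (A 0 0) * x + jconst (A 0 1) * y in
  let Y := jconst (A 1 0) * x + jconst (A 1 1) * y in
  let Z := jconst (\det A) * (z - x * y / 2) + X * Y / 2 in
  tnth [tuple X; Y; Z].

Definition Jac (A : 'M[R]_2) : 'M[jetfun]_3 :=
  \matrix_(s, t) total s (Phi A t).

(* If g is the prolongation of Phi_A to jets, the chain rule gives
   D_s (g^* f) = \sum_t D_s (Phi_A)_t * g^* (D_t f) for every f; hence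
   g^* (D_t f) = prolD A t (g^* f). *)
Definition prolD (A : 'M[R]_2) (t : 'I_3) (f : jetfun) : jetfun :=
  \sum_s invmx (Jac A) t s * total s f.

Definition prol_var (A : 'M[R]_2) (v : jetvar) : jetfun :=
  match v with
  | inl i => Phi A i
  | inr (i, j, k) =>
      iter i (prolD A d1) (iter j (prolD A d2) (iter k (prolD A d3) u))
  end.

(* The pull-back of a rational function by the prolongation of Phi_A. *)
Definition prol (A : 'M[R]_2) (f : jetfun) : jetfun :=
  peval jconst (prol_var A) (numer f) / peval jconst (prol_var A) (denom f).

Definition diff_invariant (f : jetfun) : Prop :=
  forall A : 'M[R]_2, A \in unitmx -> prol A f = f.

Definition total_comb (c : 'I_3 -> jetfun) (f : jetfun) : jetfun :=
  \sum_s c s * total s f.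

Definition invariant_derivation (D : jetfun -> jetfun) : Prop :=
  (exists c, D =1 total_comb c) /\
  (forall A : 'M[R]_2, A \in unitmx -> forall f, prol A (D f) = D (prol A f)).

Definition nabla1 : jetfun -> jetfun :=
  total_comb (tnth [tuple x; y; 2 * z]).
Definition nabla2 : jetfun -> jetfun :=
  total_comb (tnth [tuple 0; 0; x * y - 2 * z]).
Definition nabla3 : jetfun -> jetfun :=
  total_comb (tnth [tuple (x * u3 + u2) * (x * y - 2 * z);
                          - u1 * (x * y - 2 * z);
                          - x * u1 * (x * y - 2 * z)]).
Definition nabla (j : 'I_3) : jetfun -> jetfun :=
  tnth [tuple nabla1; nabla2; nabla3] j.

Definition I_0 : jetfun := u.
Definition I_1a : jetfun := (x * y - 2 * z) * u3.
Definition I_1b : jetfun := x * u1 + y * (u2 + x * u3).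
Definition I_2a : jetfun :=
  y ^+ 2 * u22 + y * (4 * z * u23 + 2 * x * u12 + u2) + 4 * z ^+ 2 * u33
  + z * (4 * x * u13 + 4 * u3) + x * (x * u11 + u1).
Definition I_2b : jetfun :=
  (x * y - 2 * z) * (y * u23 + 2 * z * u33 + x * u13 + 2 * u3).
Definition I_2c : jetfun :=
  - (x * y - 2 * z) *
  (x ^+ 2 * (u1 * u13 - u3 * u11)
   + x * (u1 * (y * u23 + 2 * z * u33 + u3 + u12)
          - y * u3 * u12 - 2 * z * u3 * u13 - u2 * u11)
   + u1 * (y * u22 + 2 * z * u23) - u2 * (y * u12 + 2 * z * u13)).
Definition I_2d : jetfun :=
  (x * y - 2 * z) * (- 2 * u3 + (x * y - 2 * z) * u33).
Definition I_2e : jetfun :=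
  - (x * y - 2 * z) *
  (x ^+ 2 * y * (u1 * u33 - u3 * u13)
   + x * (y * (u1 * u23 - u3 ^+ 2 - u2 * u13)
          + u1 * (- 2 * z * u33 - u3) + 2 * z * u3 * u13)
   - y * u2 * u3 - 2 * z * (u1 * u23 - u2 * u13)).
Definition I_2f : jetfun :=
  (x * y - 2 * z) ^+ 2 *
  (x ^+ 2 * (u1 ^+ 2 * u33 - 2 * u1 * u3 * u13 + u3 ^+ 2 * u11)
   + x * (2 * u1 ^+ 2 * u23 - u1 * u3 ^+ 2 - 2 * u1 * u3 * u12
          - 2 * u1 * u2 * u13 + 2 * u2 * u3 * u11)
   + u1 ^+ 2 * u22 - u1 * u2 * u3 - 2 * u1 * u2 * u12 + u2 ^+ 2 * u11).

(* false indexes the generator I_0 and true the generator I_2f. *)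
Definition generator (b : bool) : jetfun := if b then I_2f else I_0.

Definition formal_syzygy : formal R bool 3 -> Prop :=
  syzygy (@fnabla R bool 3) (fgen R 3 false) (fgen R 3 true).

End Jets.

(* Main.v *)
From HB Require Import structures.
From mathcomp Require Import all_boot all_order all_algebra.
From mathcomp Require Import finmap boolp reals ring zify.
From mathcomp.multinomials Require Import monalg.
Require Import Defs.

Set Implicit Arguments.
Unset Strict Implicit.
Unset Printing Implicit Defensive.

Import Order.TTheory GRing.Theory Num.Theory.
Local Open Scope ring_scope.

(** The nabla_j are invariant vector fields, and together with the point of the
    base they produce a moving frame. The group moves (x, y) linearly, and
    multiplies w = x y - 2 z by the determinant. As nabla_3 is invariant, the
    matrix M with columns (x, y) and (nabla_3 x, nabla_3 y) is sent to A M by the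
    transformation with matrix A; its determinant is - w S, where
    S = nabla_1 u + nabla_2 u. The derivatives nabla_j M are products of M with
    matrices of invariants (R_3, R_4, and frame_N3, where I_2f enters).

    Generation (invariant_ratio). Let F_0 be the field of fractions of the algebra
    generated by the nabla_J I_0 and nabla_J I_2f. The field F_0(M) is stable
    under the nabla_j, contains w = - det M / S and thus the base coordinates, so
    it is stable under the total derivatives and contains all jets. An invariant
    f = n(M) / d(M) satisfies n(A M) d(M) = n(M) d(A M) for real A. This is a
    polynomial identity in A, so A = B M^-1 may be substituted, with B real: then
    f = n(B) / d(B) lies in F_0.

    Syzygies (kernel_diff_ideal). Modulo R_1, ..., R_7, and up to powers of S,
    every formal derivative of the generators is a polynomial in the normal ones:
    N1^i N2^j I_0, N3 N1^i N2^j I_0 with i + j > 0, and N3^l N1^i N2^j I_2f.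
    Indeed R_2, R_3, R_4 allow to reorder derivations, and R_6, R_7 rewrite
    N3 N3 N1 I_0 and N3 N3 N2 I_0 (step_all). On the other side the values of the
    normal derivatives on jets are algebraically independent (normal_indep): their
    leading symbols with respect to the frame nabla_1, nabla_2, nabla_3 are the
    distinct monomials xi_1^i xi_2^j xi_3^l, because I_2f has the symbol xi_3^2
    that nabla_3 nabla_3 u cannot provide, nabla_3 u being zero. Independence is
    deduced from derivations dual to the symbols, by a triangular Jacobian
    criterion (alg_indep). So a formal polynomial that vanishes on jets reduces to
    the zero polynomial in the normal derivatives.

    The same criterion shows that the prolonged coordinates are independent
    (pulled_var_indep), which makes the pull-back a morphism of the field of
    rational functions; its compatibility with the total derivatives is the chain
    rule pull_total, and the invariance of the nabla_j follows (pull_jN). *)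

(** * Derivations along a ring morphism *)

Section DerivAlong.
Context (S T : comNzRingType).

(** The base morphism g covers at once the derivations of a field (g = idfun),
    those of a polynomial ring into its fractions, and the two sides of the chain
    rule for a pull-back g. *)
Definition deriv_along (g D : S -> T) : Prop :=
  (forall a b, D (a + b) = D a + D b) /\
  (forall a b, D (a * b) = D a * g b + g a * D b).

Context (g : {rmorphism S -> T}) (D : S -> T).
Hypothesis dD : deriv_along g D.

Lemma der_add a b : D (a + b) = D a + D b. Proof. exact: dD.1. Qed.
Lemma der_mul a b : D (a * b) = D a * g b + g a * D b. Proof. exact: dD.2. Qed.
Lemma der0 : D 0 = 0.
Proof. by apply: (addIr (D 0)); rewrite -der_add !add0r. Qed.
Lemma der1 : D 1 = 0.
Proof.
have := der_mul 1 1; rewrite mulr1 rmorph1 mulr1 mul1r => h.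
by apply: (addIr (D 1)); rewrite -h add0r.
Qed.
Lemma der_opp a : D (- a) = - D a.
Proof. by apply: (addIr (D a)); rewrite -der_add !addNr der0. Qed.
Lemma der_sub a b : D (a - b) = D a - D b.
Proof. by rewrite der_add der_opp. Qed.
Lemma der_nat n : D n%:R = 0.
Proof. by elim: n => [|n IH]; rewrite ?der0 // -natr1 der_add IH der1 addr0. Qed.
Lemma der_exp a n : D (a ^+ n) = n%:R * g a ^+ n.-1 * D a.
Proof.
elim: n => [|n IH]; first by rewrite expr0 der1 !mul0r.
rewrite exprS der_mul IH rmorphXn /=.
case: n {IH} => [|n] /=; first by rewrite !expr0 !mul0r mulr0 addr0 mulr1 !mul1r.
by rewrite -(natr1 n.+1) exprS; ring.
Qed.
Lemma der_sum (I : Type) (r : seq I) (P : pred I) (F : I -> S) :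
  D (\sum_(i <- r | P i) F i) = \sum_(i <- r | P i) D (F i).
Proof. exact: (big_morph D der_add der0). Qed.

End DerivAlong.

Lemma deriv_along_comb (S T : comNzRingType) (g : S -> T) (I : finType)
    (c : I -> T) (D : I -> S -> T) :
  (forall i, deriv_along g (D i)) ->
  deriv_along g (fun f => \sum_i c i * D i f).
Proof.
move=> h; split=> a b.
  by rewrite -big_split /=; apply: eq_bigr => i _; rewrite (h i).1 mulrDr.
rewrite mulr_suml mulr_sumr -big_split /=.
by apply: eq_bigr => i _; rewrite (h i).2; ring.
Qed.

Lemma deriv_along_post (S T U : comNzRingType) (g : S -> T) (D : S -> T)
    (s : {rmorphism T -> U}) :
  deriv_along g D -> deriv_along (s \o g) (s \o D).
Proof. by move=> [h1 h2]; split=> a b /=; rewrite ?h1 ?h2 rmorphD ?rmorphM. Qed.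

Lemma deriv_along_pre (S T U : comNzRingType) (g : S -> T) (D : S -> T)
    (s : {rmorphism U -> S}) :
  deriv_along g D -> deriv_along (g \o s) (D \o s).
Proof. by move=> [h1 h2]; split=> a b /=; rewrite ?rmorphD ?rmorphM ?h1 ?h2. Qed.

Lemma deriv_along_commutator (F : comNzRingType) (D D' : F -> F) :
  deriv_along idfun D -> deriv_along idfun D' ->
  deriv_along idfun (fun f => D (D' f) - D' (D f)).
Proof.
move=> [h1 h2] [h3 h4]; split=> a b /=; rewrite /= in h2 h4.
  by rewrite h1 !h3 h1; ring.
by rewrite h2 h4 h1 h3 !h2 !h4; ring.
Qed.

Section Field.
Context (F F' : fieldType).

Lemma der_inv (g : {rmorphism F -> F'}) (D : F -> F') (dD : deriv_along g D) a :
  D a^-1 = - (D a / g a ^+ 2).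
Proof.
have [->|a0] := eqVneq a 0; first by rewrite invr0 (der0 dD) mul0r oppr0.
have ga0 : g a != 0 by rewrite fmorph_eq0.
have := der_mul dD a a^-1; rewrite mulfV // (der1 dD) fmorphV => /eqP.
rewrite eq_sym addr_eq0 => /eqP h.
apply: (mulfI ga0); rewrite -(opprK (g a * _)) -h; field; exact: ga0.
Qed.

(** The subfield generated by X. Opposites are omitted because the sets X used
    below contain the constants, or at least generate -1. *)
Inductive gfield (X : F -> Prop) : F -> Prop :=
| gf_gen a of X a : gfield X a
| gf_add a b of gfield X a & gfield X b : gfield X (a + b)
| gf_mul a b of gfield X a & gfield X b : gfield X (a * b)
| gf_inv a of gfield X a : gfield X a^-1.

Lemma gf_sum (X : F -> Prop) (I : Type) (r : seq I) (f : I -> F) :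
  gfield X 0 -> (forall i, gfield X (f i)) -> gfield X (\sum_(i <- r) f i).
Proof. by move=> X0 h; apply: big_ind => // a b; apply: gf_add. Qed.

Lemma gfield_sub (X Y : F -> Prop) f :
  (forall a, X a -> gfield Y a) -> gfield X f -> gfield Y f.
Proof.
move=> XY; elim=> [a /XY //|a b _ ha _ hb|a b _ ha _ hb|a _ ha].
- exact: gf_add.
- exact: gf_mul.
- exact: gf_inv.
Qed.

Lemma deriv_along_ext (X : F -> Prop) (g : {rmorphism F -> F'}) (D D' : F -> F') :
  deriv_along g D -> deriv_along g D' -> (forall a, X a -> D a = D' a) ->
  forall f, gfield X f -> D f = D' f.
Proof.
move=> dD dD' h f; elim=> [a /h //|a b _ ha _ hb|a b _ ha _ hb|a _ ha].
- by rewrite (der_add dD) (der_add dD') ha hb.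
- by rewrite (der_mul dD) (der_mul dD') ha hb.
- by rewrite (der_inv dD) (der_inv dD') ha.
Qed.

End Field.

Lemma gfield_der (F : fieldType) (X Y : F -> Prop) (D : F -> F) :
  deriv_along idfun D -> gfield Y (-1) ->
  (forall a, X a -> gfield Y a) -> (forall a, X a -> gfield Y (D a)) ->
  forall f, gfield X f -> gfield Y (D f).
Proof.
move=> dD Y1 XY h f Xf; suff [] : gfield Y f /\ gfield Y (D f) by [].
elim: Xf => [a Xa|a b _ [a1 a2] _ [b1 b2]|a b _ [a1 a2] _ [b1 b2]|a _ [a1 a2]].
- by split; [apply: XY|apply: h].
- by rewrite (der_add dD); split; apply: gf_add.
- rewrite (der_mul dD); split; first exact: gf_mul.
  by apply: gf_add; apply: gf_mul.
- rewrite (der_inv dD) /= -mulN1r expr2; split; first exact: gf_inv.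
  by do ![apply: gf_mul|apply: gf_inv].
Qed.


(** * Polynomials in an arbitrary set of variables *)

Section MonEval.
Context (V : choiceType) (T : comNzRingType) (t : V -> T).

Definition mon_eval (m : cmonom V) : T := \prod_(v <- finsupp m) t v ^+ m v.

Lemma mon_evalEw (m : cmonom V) (d : {fset V}) : (finsupp m `<=` d)%fset ->
  mon_eval m = \prod_(v <- d) t v ^+ m v.
Proof.
move=> h; rewrite /mon_eval (big_fset_incl _ h) // => v _.
by rewrite -cmE_eq0 => /eqP ->.
Qed.

Lemma mon_eval_mmorphism : mmorphism mon_eval.
Proof.
split=> [m1 m2|]; last by rewrite /mon_eval mdom1 big_seq_fset0.
have h := mdomD m1 m2.
rewrite !(@mon_evalEw _ (finsupp m1 `|` finsupp m2)%fset) ?h ?fsubsetUl ?fsubsetUr //.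
by rewrite -big_split /=; apply: eq_bigr => v _; rewrite cmM exprD.
Qed.
HB.instance Definition _ := isMultiplicative.Build _ _ mon_eval mon_eval_mmorphism.

Lemma mon_evalU v : mon_eval (ucm v) = t v.
Proof. by rewrite /mon_eval mdomU big_seq_fset1 cmUU expr1. Qed.
End MonEval.

Lemma cmonom_ind (V : choiceType) (Q : cmonom V -> Prop) :
  Q mone -> (forall v m, Q m -> Q (mmul (ucm v) m)) -> forall m, Q m.
Proof.
move=> Q1 QM m; have [n] := ubnP (mdeg m); elim: n m => // n IH m le.
have [->|m1] := eqVneq m mone; first by [].
move/eqP: m1 => m1.
have : finsupp m != fset0.
  apply/eqP => h; apply: m1; apply/eqP/cmP => v; rewrite cm1.
  by apply/eqP; rewrite cmE_eq0 h inE.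
move=> /fset0Pn[v vm].
have e : m = mmul (ucm v) (divcm m (ucm v)).
  apply/eqP/cmP => w; rewrite cmM divcmE ucmE subnKC //.
  by case: eqP => // <-; rewrite lt0n cmE_neq0.
rewrite e; apply: QM; apply: IH.
by move: le; rewrite {1}e mdegM mdegU add1n ltnS.
Qed.

Section Vpoly.
Context (R : comNzRingType) (V : choiceType).
Local Notation P := {vpoly R[V]}.

Section Eval.
Context (T : comNzRingType) (c : {rmorphism R -> T}) (t : V -> T).

Definition peval_morph : {rmorphism P -> T} := mmap c (mon_eval t).

Lemma pevalE p : peval c t p = peval_morph p. Proof. by []. Qed.

Lemma peval_var v : peval c t (pvar R v) = t v.
Proof.
by rewrite pevalE /= /pvar mmapU /= rmorph1 mul1r; exact: mon_evalU.
Qed.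

Lemma peval_const a : peval c t (malgC a) = c a.
Proof. by rewrite pevalE /= mmapU /= mmorph1 mulr1. Qed.

Lemma pevalD p q : peval c t (p + q) = peval c t p + peval c t q.
Proof. by rewrite !pevalE rmorphD. Qed.
Lemma pevalM p q : peval c t (p * q) = peval c t p * peval c t q.
Proof. by rewrite !pevalE rmorphM. Qed.
Lemma peval0 : peval c t 0 = 0. Proof. by rewrite pevalE rmorph0. Qed.
Lemma peval1 : peval c t 1 = 1. Proof. by rewrite pevalE rmorph1. Qed.
End Eval.

Lemma mkmalgU_mon (m : cmonom V) : (mkmalgU m 1 : P) = mon_eval (@pvar R V) m.
Proof.
elim/cmonom_ind: m => [|v m IH].
  by rewrite mmorph1 -mpolyC1E.
by rewrite mmorphM /= mon_evalU -IH malgM_def fgmulUU mulr1.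
Qed.

Lemma vpolyE (p : P) :
  p = \sum_(m <- msupp p) malgC p@_m * mon_eval (@pvar R V) m.
Proof.
rewrite {1}(monalgE p); apply: eq_bigr => m _.
by rewrite -mkmalgU_mon malgM_def fgmulUU mulr1 mul1m.
Qed.

(** Bounding the variables by X lets an argument about one polynomial use only
    the finitely many variables that occur in it. *)
Lemma vpoly_ind_on (X : V -> Prop) (Q : P -> Prop) :
  (forall a, Q (malgC a)) -> (forall v, X v -> Q (pvar R v)) ->
  (forall p q, Q p -> Q q -> Q (p + q)) -> (forall p q, Q p -> Q q -> Q (p * q)) ->
  forall p : P, (forall m : cmonom V, m \in msupp p ->
     forall v, v \in finsupp m -> X v) -> Q p.
Proof.
move=> QC QV QD QMul p hp; rewrite (vpolyE p) big_seq; apply: (big_ind Q) => //.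
  by rewrite -malgC0E; apply: QC.
move=> m /hp hm; apply: (QMul); first exact: QC.
elim/cmonom_ind: m hm => [_|v m IH hm]; first by rewrite mmorph1 -mpolyC1E; apply: QC.
rewrite mmorphM /= mon_evalU; apply: (QMul).
  by apply: QV; apply: hm; rewrite mdomD inE mdomU inE eqxx.
by apply: IH => w wm; apply: hm; rewrite mdomD inE wm orbT.
Qed.

Lemma vpoly_ind (Q : P -> Prop) :
  (forall a, Q (malgC a)) -> (forall v, Q (pvar R v)) ->
  (forall p q, Q p -> Q q -> Q (p + q)) -> (forall p q, Q p -> Q q -> Q (p * q)) ->
  forall p, Q p.
Proof. by move=> h1 h2 h3 h4 p; apply: (@vpoly_ind_on (fun _ => True)). Qed.

Lemma vpoly_morph_ext (T : comNzRingType) (g g' : {rmorphism P -> T}) :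
  (forall a, g (malgC a) = g' (malgC a)) ->
  (forall v, g (pvar R v) = g' (pvar R v)) -> g =1 g'.
Proof.
move=> hC hV; apply: vpoly_ind => // p q hp hq.
  by rewrite !rmorphD hp hq.
by rewrite !rmorphM hp hq.
Qed.

Lemma peval_uniq (T : comNzRingType) (c : {rmorphism R -> T}) (t : V -> T)
    (g : {rmorphism P -> T}) :
  (forall a, g (malgC a) = c a) -> (forall v, g (pvar R v) = t v) ->
  forall p, peval c t p = g p.
Proof.
move=> hC hV; apply: (@vpoly_morph_ext T (peval_morph c t) g) => [a|v].
  by rewrite hC -(peval_const c t).
by rewrite hV -(peval_var c t).
Qed.

Lemma deriv_along_vpoly_ext (T : comNzRingType) (g : {rmorphism P -> T}) D D' :
  deriv_along g D -> deriv_along g D' ->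
  (forall a, D (malgC a) = D' (malgC a)) -> (forall v, D (pvar R v) = D' (pvar R v)) ->
  D =1 D'.
Proof.
move=> dD dD' hC hV; apply: vpoly_ind => // p q hp hq.
  by rewrite (der_add dD) (der_add dD') hp hq.
by rewrite (der_mul dD) (der_mul dD') hp hq.
Qed.

Section Der.
Context (T : comNzRingType) (c : {rmorphism R -> T}) (t d : V -> T).

(** The coefficient of 'X in p(t + d 'X), as in pder, but with values in T: with
    T the fraction field this yields derivations that are not polynomial. *)
Definition vder (p : P) : T :=
  (peval (polyC \o c) (fun v => (t v)%:P + (d v)%:P * 'X) p)`_1.

Lemma vder_coef0 (p : P) :
  (peval (polyC \o c) (fun v => (t v)%:P + (d v)%:P * 'X) p)`_0 = peval c t p.
Proof.
elim/vpoly_ind: p => [a|v|p q hp hq|p q hp hq].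
- by rewrite !peval_const /= coefC.
- by rewrite !peval_var coefD coefC coefMX addr0.
- by move: hp hq; rewrite !pevalE !rmorphD coefD => -> ->.
- by move: hp hq; rewrite !pevalE !rmorphM coef0M => -> ->.
Qed.

Lemma vder_deriv : deriv_along (peval c t) vder.
Proof.
split=> p q.
  by rewrite /vder pevalE rmorphD coefD.
rewrite -!vder_coef0 /vder pevalE rmorphM coefM !big_ord_recl big_ord0 addr0 /=.
by rewrite addrC.
Qed.

Lemma vder_const a : vder (malgC a) = 0.
Proof. by rewrite /vder peval_const /= coefC. Qed.

Lemma vder_var v : vder (pvar R v) = d v.
Proof. by rewrite /vder peval_var coefD coefC coefMX coefC add0r. Qed.
End Der.

Lemma pderE (d : V -> P) : pder d = vder (@malgC (cmonom V) R : {rmorphism R -> P}) (@pvar R V) d.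
Proof. by []. Qed.

Lemma peval_id (p : P) : peval (@malgC (cmonom V) R : {rmorphism R -> P}) (@pvar R V) p = p.
Proof.
elim/vpoly_ind: p => [a|v|p q hp hq|p q hp hq].
- by rewrite peval_const.
- by rewrite peval_var.
- by move: hp hq; rewrite !pevalE rmorphD => -> ->.
- by move: hp hq; rewrite !pevalE rmorphM => -> ->.
Qed.

Lemma pder_deriv (d : V -> P) : deriv_along idfun (pder d).
Proof.
have [h1 h2] := vder_deriv (@malgC (cmonom V) R : {rmorphism R -> P}) (@pvar R V) d.
split=> p q; first exact: h1.
by rewrite pderE h2 !peval_id.
Qed.
Lemma pder_const d a : pder d (malgC a : P) = 0. Proof. exact: vder_const. Qed.
Lemma pder_var d v : pder d (pvar R v : P) = d v. Proof. exact: vder_var. Qed.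
End Vpoly.

(** * Morphisms and derivations on fraction fields *)

Section FracExt.
Context (P : idomainType).
Local Notation F := {fraction P}.
Local Notation "p %:F" := (FracField.tofrac p).
Local Open Scope quotient_scope.

Lemma frac_numden (f : F) : f = (\n_(repr f))%:F / (\d_(repr f))%:F.
Proof.
apply: (canRL (mulfK _)); first by rewrite tofrac_eq0 denom_ratioP.
move: (repr f) (reprK f) => x <-; apply/eqP.
have -> : \pi_(FracField.type P) x * (\d_x)%:F =
          FracField.mul (\pi_(FracField.type P) x) (\d_x)%:F by [].
rewrite piE /= FracField.equivfE /FracField.mulf.
by rewrite !numden_Ratio ?mulr1 ?mul1r ?oner_eq0 ?denom_ratioP // [\d__ * _]mulrC.
Qed.

Lemma fracP (f : F) : exists n d, d != 0 /\ f = n%:F / d%:F.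
Proof.
exists (\n_(repr f)), (\d_(repr f)); split; first exact: denom_ratioP.
exact: frac_numden.
Qed.

Lemma frac_add n d n' d' : d != 0 -> d' != 0 ->
  n%:F / d%:F + n'%:F / d'%:F = (n * d' + n' * d)%:F / (d * d')%:F :> F.
Proof.
by move=> d0 d0'; rewrite addf_div ?tofrac_eq0 // -!tofracM -tofracD.
Qed.

Lemma frac_sub n d n' d' : d != 0 -> d' != 0 ->
  n%:F / d%:F - n'%:F / d'%:F = (n * d' - n' * d)%:F / (d * d')%:F :> F.
Proof. by move=> d0 d0'; rewrite -mulNr -tofracN frac_add // mulNr. Qed.

Lemma frac_mul n d n' d' : d != 0 -> d' != 0 ->
  n%:F / d%:F * (n'%:F / d'%:F) = (n * n')%:F / (d * d')%:F :> F.
Proof. by move=> d0 d0'; rewrite mulf_div -!tofracM. Qed.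

Context (K : fieldType) (g : {rmorphism P -> K}).
Hypothesis g_inj : forall p, g p = 0 -> p = 0.

Definition frac_ext (f : F) : K := g (\n_(repr f)) / g (\d_(repr f)).

Lemma g_neq0 p : p != 0 -> g p != 0.
Proof. by apply: contra_neq; apply: g_inj. Qed.

Lemma g_denom_neq0 (f : F) : g (\d_(repr f)) != 0.
Proof. by apply: g_neq0; apply: denom_ratioP. Qed.

(** Injectivity of g makes the value independent of the representative chosen
    in the definition of frac_ext. *)
Lemma frac_extE n d : d != 0 -> frac_ext (n%:F / d%:F) = g n / g d.
Proof.
move=> d0; rewrite /frac_ext; set f : F := n%:F / d%:F.
apply/eqP; rewrite eqr_div ?g_denom_neq0 ?g_neq0 // -!rmorphM; apply/eqP; congr (g _).
apply/eqP; rewrite -tofrac_eq !rmorphM /=; apply/eqP.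
have := frac_numden f; rewrite {1}/f => /eqP.
by rewrite eqr_div ?tofrac_eq0 ?denom_ratioP // => /eqP ->; rewrite mulrC.
Qed.

Lemma frac_ext_tofrac p : frac_ext p%:F = g p.
Proof. by rewrite -[p%:F]divr1 -tofrac1 frac_extE ?oner_eq0 // rmorph1 divr1. Qed.

Lemma frac_ext_is_zmod : zmod_morphism frac_ext.
Proof.
move=> f h; have [n [d [d0 ->]]] := fracP f; have [n' [d' [d0' ->]]] := fracP h.
rewrite frac_sub // !frac_extE ?mulf_neq0 // rmorphB !rmorphM /=.
move: (g n) (g d) (g n') (g d') (g_neq0 d0) (g_neq0 d0') => *.
by field; apply/andP.
Qed.

Lemma frac_ext_is_monoid : monoid_morphism frac_ext.
Proof.
split=> [|f h]; first by rewrite -tofrac1 frac_ext_tofrac rmorph1.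
have [n [d [d0 ->]]] := fracP f; have [n' [d' [d0' ->]]] := fracP h.
rewrite frac_mul // !frac_extE ?mulf_neq0 // !rmorphM /=.
by rewrite mulf_div.
Qed.

HB.instance Definition _ := GRing.isZmodMorphism.Build F K frac_ext frac_ext_is_zmod.
HB.instance Definition _ := GRing.isMonoidMorphism.Build F K frac_ext frac_ext_is_monoid.

Definition frac_morph : {rmorphism F -> K} := frac_ext.

Section Der.
Context (D : P -> K).
Hypothesis dD : deriv_along g D.

Definition frac_der (f : F) : K :=
  (D (\n_(repr f)) * g (\d_(repr f)) - g (\n_(repr f)) * D (\d_(repr f)))
  / g (\d_(repr f)) ^+ 2.

(** Differentiating n d' = n' d shows that the quotient rule is compatible with
    the choice of a representative. *)
Lemma frac_derE n d : d != 0 ->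
  frac_der (n%:F / d%:F) = (D n * g d - g n * D d) / g d ^+ 2.
Proof.
move=> d0; rewrite /frac_der; set f : F := n%:F / d%:F.
have e : n * \d_(repr f) = \n_(repr f) * d.
  apply/eqP; rewrite -tofrac_eq !rmorphM /=; apply/eqP.
  have := frac_numden f; rewrite {1}/f => /eqP.
  by rewrite eqr_div ?tofrac_eq0 ?denom_ratioP // => /eqP.
have gd := g_neq0 d0; have gf := g_denom_neq0 f.
have e1 := congr1 g e; have := congr1 D e; rewrite !(der_mul dD).
move: gf e1; rewrite !rmorphM; set n' := \n__; set d' := \d__.
move=> gf e1 e2.
have en : g n' = g n * g d' / g d by rewrite e1 mulfK.
have eD : D n' = (D n * g d' + g n * D d' - g n' * D d) / g d.
  by rewrite e2 addrK mulfK.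
rewrite eD en.
move: (g n) (g d) (g d') (D n) (D d) (D d') gd gf => *.
by field; apply/andP.
Qed.

Lemma frac_der_deriv : deriv_along frac_ext frac_der.
Proof.
split=> f h; have [n [d [d0 ->]]] := fracP f; have [n' [d' [d0' ->]]] := fracP h;
  have h3 := g_neq0 d0; have h4 := g_neq0 d0'.
  rewrite frac_add // !frac_derE ?mulf_neq0 // !(der_add dD) !(der_mul dD).
  rewrite !(rmorphD, rmorphM) /=.
  move: (g n) (g d) (g n') (g d') (D n) (D d) (D n') (D d') h3 h4 => *.
  by field; apply/andP.
rewrite frac_mul // !frac_derE ?frac_extE ?mulf_neq0 // !(der_mul dD) !rmorphM /=.
move: (g n) (g d) (g n') (g d') (D n) (D d) (D n') (D d') h3 h4 => *.
by field; apply/andP.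
Qed.

Lemma frac_der_tofrac p : frac_der p%:F = D p.
Proof.
rewrite -[p%:F]divr1 -tofrac1 frac_derE ?oner_eq0 // rmorph1 (der1 dD).
by rewrite mulr0 subr0 mulr1 expr1n divr1.
Qed.
End Der.
End FracExt.

(** * Algebraic independence from dual derivations *)

Section MonDeriv.
Context (R P : comNzRingType) (V : choiceType).
Context (X : V -> P) (U : cmonom V -> {additive R -> P}) (v : V) (d : P -> P).
Hypothesis U_cons : forall w m a, U (mmul (ucm w) m) a = X w * U m a.
Hypothesis d1 : d (U mone 1) = 0.
Hypothesis d_cons : forall w q, d (X w * q) = (w == v)%:R * q + X w * d q.

(** The derivative of a monomial, from the product rule with a single variable:
    X w stands for the variable w and U m a for the monomial m with coefficient
    a. *)
Lemma mon_derivE m : d (U m 1) = U (divcm m (ucm v)) (m v)%:R.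
Proof.
elim/cmonom_ind: m => [|w m IH]; first by rewrite d1 cm1 raddf0.
rewrite U_cons d_cons IH cmM ucmE; have [->|wv] := eqVneq w v.
  rewrite mul1r -U_cons.
  have -> : divcm (mmul (ucm v) m) (ucm v) = m.
    by apply/eqP/cmP => k; rewrite divcmE cmM addKn.
  rewrite natrD raddfD; congr (_ + _).
  have [->|m0] := eqVneq (m v) 0%N; first by rewrite !raddf0.
  congr (U _ _); apply/eqP/cmP => k; rewrite cmM divcmE ucmE subnKC //.
  by case: eqP => // <-; rewrite lt0n.
rewrite mul0r add0r -U_cons add0n.
have [->|m0] := eqVneq (m v) 0%N; first by rewrite !raddf0.
congr (U _ _); apply/eqP/cmP => k; rewrite cmM !divcmE cmM !ucmE.
by case: (v =P k) => [<-|_]; rewrite ?(negPf wv) ?subn0 // addnBA ?lt0n.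
Qed.
End MonDeriv.

Section Partial.
Context (R : comNzRingType) (V : choiceType).
Local Notation P := {vpoly R[V]}.

Lemma mkmalgUM (m1 m2 : cmonom V) (a b : R) :
  (mkmalgU m1 a : P) * mkmalgU m2 b = mkmalgU (mmul m1 m2) (a * b).
Proof. by rewrite malgM_def fgmulUU. Qed.

Lemma mkmalgU_cons w (m : cmonom V) (a : R) :
  (mkmalgU (mmul (ucm w) m) a : P) = pvar R w * mkmalgU m a.
Proof. by rewrite /pvar mkmalgUM; congr (mkmalgU _ _); rewrite mul1r. Qed.

Definition partial (v : V) : P -> P := pder (fun w => (w == v)%:R).

Lemma partial_deriv v : deriv_along idfun (partial v).
Proof. exact: pder_deriv. Qed.

Lemma partialM v p q : partial v (p * q) = partial v p * q + p * partial v q.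
Proof. exact: (partial_deriv v).2. Qed.
Lemma partial_const v a : partial v (malgC a) = 0.
Proof. exact: pder_const. Qed.
Lemma partial_var v w : partial v (pvar R w) = (w == v)%:R.
Proof. exact: pder_var. Qed.

Lemma partial_cons v w q :
  partial v (pvar R w * q) = (w == v)%:R * q + pvar R w * partial v q.
Proof. by rewrite partialM partial_var. Qed.

Lemma partial_mon v (m : cmonom V) :
  partial v (mkmalgU m 1) = mkmalgU (divcm m (ucm v)) (m v)%:R.
Proof.
apply: (mon_derivE (X := @pvar R V) (U := fun m => mkmalgU m : {additive R -> P})).
- by move=> w k a; apply: mkmalgU_cons.
- exact: partial_const.
- by move=> w q; apply: partial_cons.
Qed.

Lemma partialC v a q : partial v (malgC a * q) = malgC a * partial v q.
Proof. by rewrite partialM partial_const mul0r add0r. Qed.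

Lemma partial_term v (m : cmonom V) a :
  partial v (mkmalgU m a) = mkmalgU (divcm m (ucm v)) (a * (m v)%:R).
Proof.
have -> : (mkmalgU m a : P) = malgC a * mkmalgU m 1.
  by rewrite mkmalgUM mulr1 mul1m.
by rewrite partialC partial_mon mkmalgUM mul1m.
Qed.

(** As m v + 1 is invertible in characteristic 0, a polynomial with zero partial
    derivative in v does not involve v. *)
Lemma mcoeff_partial v (p : P) (m : cmonom V) :
  (partial v p)@_m = (m v).+1%:R * p@_(mmul (ucm v) m).
Proof.
rewrite {1 2}(monalgE p) (der_sum (g := idfun) (partial_deriv v)) !raddf_sum /=.
rewrite mulr_sumr; apply: eq_bigr => m0 _.
rewrite partial_term !mcoeffU -mulrnAr -[X in _ = _ * X]mulr_natr mulrCA; congr (_ * _).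
have [z|nz] := eqVneq (m0 v) 0%N.
  rewrite z mul0rn; case: eqP => [e|_]; last by rewrite mulr0.
  by move: z; rewrite e cmM ucmE eqxx.
have -> : (divcm m0 (ucm v) == m) = (m0 == mmul (ucm v) m).
  apply/eqP/eqP => [<-|->]; apply/eqP/cmP => k.
    rewrite cmM divcmE ucmE subnKC //; case: eqP => // <-; by rewrite lt0n.
  by rewrite divcmE cmM addKn.
case: eqP => [->|_]; last by rewrite mulr0.
by rewrite cmM ucmE eqxx mulr1 add1n.
Qed.

Lemma mcoeff0_const (p : P) : (forall m : cmonom V, p@_m != 0 -> m = mone) ->
  p = malgC p@_mone.
Proof.
move=> h; apply/malgP => m; rewrite mcoeffC; case: eqVneq => [->//|m1].
by apply/eqP; apply: contraNT m1 => /h ->.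
Qed.

End Partial.

Section ChainStep.
Context (P F : comNzRingType) (ev : {rmorphism P -> F}) (d : F -> F) (pd : P -> P).
Context (k : F).
Hypothesis dd : deriv_along idfun d.
Hypothesis dpd : deriv_along idfun pd.

Lemma chain_add q r : d (ev q) = ev (pd q) * k -> d (ev r) = ev (pd r) * k ->
  d (ev (q + r)) = ev (pd (q + r)) * k.
Proof.
by move=> hq hr; rewrite (der_add dpd) !rmorphD (der_add dd) hq hr mulrDl.
Qed.

Lemma chain_mul q r : d (ev q) = ev (pd q) * k -> d (ev r) = ev (pd r) * k ->
  d (ev (q * r)) = ev (pd (q * r)) * k.
Proof.
move=> hq hr; rewrite (der_mul (g := idfun) dpd) rmorphD !rmorphM.
by rewrite (der_mul (g := idfun) dd) hq hr /= mulrDl mulrAC mulrA.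
Qed.
End ChainStep.

Section Chain.
Context (R F : comNzRingType) (V : choiceType) (c : {rmorphism R -> F}) (e : V -> F).
Context (d : F -> F) (v : V) (pd : {vpoly R[V]} -> {vpoly R[V]}).
Hypothesis dd : deriv_along idfun d.
Hypothesis d_const : forall a, d (c a) = 0.
Hypothesis dpd : deriv_along idfun pd.
Hypothesis pd_const : forall a, pd (malgC a) = 0.
Hypothesis pd_var : forall w, pd (pvar R w) = (w == v)%:R.

(** Among the variables of p only v has a value that d does not kill, so one
    term of the chain rule survives. *)
Lemma chain_rule_at (s : seq V) (p : {vpoly R[V]}) :
  (forall w, w \in s -> w != v -> d (e w) = 0) ->
  (forall m : cmonom V, m \in msupp p -> forall w, w \in finsupp m -> w \in s) ->
  d (peval c e p) = peval c e (pd p) * d (e v).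
Proof.
move=> d_off hs.
refine (@vpoly_ind_on _ _ (fun w => w \in s) (fun q =>
  d (peval c e q) = peval c e (pd q) * d (e v)) _ _ _ _ p hs).
- by move=> a; rewrite peval_const d_const pd_const peval0 mul0r.
- move=> w ws; rewrite peval_var pd_var.
  have [->|wv] := eqVneq w v; first by rewrite peval1 mul1r.
  by rewrite peval0 mul0r d_off.
- exact: (chain_add (ev := peval_morph c e) dd dpd).
- exact: (chain_mul (ev := peval_morph c e) dd dpd).
Qed.
End Chain.

Section AlgIndep.
Context (R : numFieldType) (V : choiceType).
Local Notation P := {vpoly R[V]}.
Context (F : fieldType) (c : {rmorphism R -> F}) (e : V -> F) (rk : V -> nat).
Context (d : V -> F -> F).
Hypothesis d_deriv : forall v, deriv_along idfun (d v).
Hypothesis d_const : forall v a, d v (c a) = 0.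
Hypothesis d_diag : forall v, d v (e v) != 0.
Hypothesis d_off : forall v w, (rk w <= rk v)%N -> w != v -> d v (e w) = 0.

Lemma max_rank (s : seq V) : s != [::] ->
  exists2 v, v \in s & forall w, w \in s -> (rk w <= rk v)%N.
Proof.
elim: s => // v [|v' s] IH _.
  by exists v => [|w]; rewrite inE // => /eqP ->.
have [//|w ws wm] := IH; have [le|lt] := leqP (rk v) (rk w).
  exists w => [|k]; first by rewrite inE ws orbT.
  by rewrite inE => /orP[/eqP ->|/wm].
exists v => [|k]; first by rewrite inE eqxx.
rewrite inE => /orP[/eqP -> //|/wm h]; exact: leq_trans h (ltnW lt).
Qed.

(** The Jacobian criterion in triangular form. In a relation p take a variable v
    of highest rank. Applying d v to the relation leaves a relation for the
    partial derivative of p in v, of smaller degree; by induction that partial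
    derivative is zero, so that v does not occur in p. *)
Theorem alg_indep (p : P) : peval c e p = 0 -> p = 0.
Proof.
suff: forall n (q : P), (forall m : cmonom V, q@_m != 0 -> (mdeg m < n)%N) ->
    peval c e q = 0 -> q = 0.
  move=> /(_ (mmeasure mdeg p) p); apply=> m.
  by rewrite mcoeff_neq0; apply: mmeasure_mnm_lt.
elim=> [|n IH] {}p hp p0.
  by apply/malgP => m; rewrite mcoeff0; apply/eqP/negPn/negP => /hp.
pose s := flatten [seq (finsupp m : seq V) | m : cmonom V <- enum_fset (msupp p)].
have hs (m : cmonom V) : m \in msupp p -> forall v, v \in finsupp m -> v \in s.
  move=> mp v vm; apply/flattenP; exists (finsupp m : seq V) => //.
  by apply/mapP; exists m.
have [s0|sN] := eqVneq s [::].
  have pC : p = malgC p@_mone.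
    apply: mcoeff0_const => m; rewrite mcoeff_neq0 => mp.
    apply/eqP/cmP => v; rewrite cm1; apply/eqP; rewrite cmE_eq0.
    by apply/negP => /(hs _ mp); rewrite s0.
  move: p0; rewrite pC peval_const => /eqP; rewrite fmorph_eq0 => /eqP ->.
  by rewrite malgC0E.
have [v vs vmax] := max_rank sN.
have chain : d v (peval c e p) = peval c e (partial v p) * d v (e v).
  refine (chain_rule_at (d_deriv v) (d_const v) (partial_deriv R v)
    (partial_const v) (partial_var R v) _ hs) => w ws wv.
  by rewrite d_off // vmax.
have : peval c e (partial v p) = 0.
  move: chain; rewrite p0 (der0 (g := idfun) (d_deriv v)) => /esym/eqP.
  by rewrite mulf_eq0 (negPf (d_diag v)) orbF => /eqP.
move=> /IH h.
have {}h : partial v p = 0.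
  apply: h => m; rewrite mcoeff_partial mulf_eq0 pnatr_eq0 /= => /hp.
  by rewrite mdegM mdegU add1n ltnS.
case/flattenP: vs => _ /mapP[m mp ->] vm.
have := mcoeff_partial v p (divcm m (ucm v)); rewrite h mcoeff0 => /esym/eqP.
rewrite mulf_eq0 pnatr_eq0 /=.
have -> : mmul (ucm v) (divcm m (ucm v)) = m.
  apply/eqP/cmP => k; rewrite cmM divcmE ucmE subnKC //.
  by case: eqP => // <-; rewrite lt0n cmE_neq0.
by rewrite mcoeff_eq0 mp.
Qed.
End AlgIndep.

(** * The field of rational functions on the jet space *)

Lemma tofrac_quotient (P : idomainType) (a b n d : P) :
  FracField.tofrac (a * d - n * b) / FracField.tofrac (d ^+ 2) =
  (FracField.tofrac a * FracField.tofrac d - FracField.tofrac n * FracField.tofrac b)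
  / FracField.tofrac d ^+ 2 :> {fraction P}.
Proof. by rewrite tofracB !tofracM. Qed.

Lemma gfield_peval (R : comNzRingType) (V : choiceType) (F : fieldType)
    (c : {rmorphism R -> F}) (t : V -> F) (X : F -> Prop) p :
  (forall a, gfield X (c a)) -> (forall v, gfield X (t v)) ->
  gfield X (peval c t p).
Proof.
move=> hC hV; elim/vpoly_ind: p => [a|v|p q hp hq|p q hp hq].
- by rewrite peval_const; apply: hC.
- by rewrite peval_var; apply: hV.
- by rewrite pevalD; apply: gf_add.
- by rewrite pevalM; apply: gf_mul.
Qed.

Section JetField.
Context (R : realType).
Local Notation F := (jetfun R).
Local Notation P := (jetpoly R).
Local Notation tofrac := (@FracField.tofrac P).
Local Notation "p %:F" := (tofrac p).

Lemma tofrac_inj0 (p : P) : tofrac p = 0 -> p = 0.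
Proof. by move=> /eqP; rewrite tofrac_eq0 => /eqP. Qed.

Lemma jconst_zmod : zmod_morphism (@jconst R).
Proof. by move=> a b; rewrite /jconst raddfB raddfB. Qed.
Lemma jconst_monoid : monoid_morphism (@jconst R).
Proof.
split=> [|a b]; first by rewrite /jconst rmorph1.
by rewrite /jconst rmorphM tofracM.
Qed.
HB.instance Definition _ := GRing.isZmodMorphism.Build R F (@jconst R) jconst_zmod.
HB.instance Definition _ := GRing.isMonoidMorphism.Build R F (@jconst R) jconst_monoid.

Definition jvar (v : jetvar) : F := (pvar R v : P)%:F.

Lemma peval_tofrac (p : P) : peval (@jconst R) jvar p = p%:F.
Proof. exact: (peval_uniq (g := tofrac : {rmorphism P -> F})). Qed.

Lemma gfield_poly (X : F -> Prop) (p : P) :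
  (forall a, gfield X (jconst a)) -> (forall v, gfield X (jvar v)) ->
  gfield X p%:F.
Proof.
move=> hC hV; rewrite -peval_tofrac.
by apply: (gfield_peval (c := @jconst R)) => [a|v]; [apply: hC|apply: hV].
Qed.

Lemma gfield_all (X : F -> Prop) :
  (forall a, gfield X (jconst a)) -> (forall v, gfield X (jvar v)) ->
  forall f, gfield X f.
Proof.
move=> hC hV f; have [n [d [_ ->]]] := fracP f.
by apply: gf_mul; [|apply: gf_inv]; apply: gfield_poly.
Qed.

Lemma frac_ext_id (f : F) : frac_ext tofrac f = f.
Proof. by rewrite {2}[f]frac_numden. Qed.

Definition jder (d : jetvar -> F) : F -> F :=
  frac_der tofrac (vder (@jconst R) jvar d).

Lemma vder_jder d : deriv_along tofrac (vder (@jconst R) jvar d).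
Proof.
have [h1 h2] := vder_deriv (@jconst R) jvar d.
by split=> p q; [exact: h1|rewrite h2 !peval_tofrac].
Qed.

Lemma frac_der_idfun (D : P -> F) :
  deriv_along tofrac D -> deriv_along idfun (frac_der tofrac D : F -> F).
Proof.
move=> dD; have [h1 h2] := frac_der_deriv tofrac_inj0 dD.
by split=> p q; [exact: h1|rewrite h2 !frac_ext_id].
Qed.

Lemma jder_deriv d : deriv_along idfun (jder d).
Proof. exact: (frac_der_idfun (vder_jder d)). Qed.

Lemma jder_const d a : jder d (jconst a) = 0.
Proof. by rewrite /jder (frac_der_tofrac tofrac_inj0 (vder_jder d)) vder_const. Qed.

Lemma jder_var d v : jder d (jvar v) = d v.
Proof. by rewrite /jder (frac_der_tofrac tofrac_inj0 (vder_jder d)) vder_var. Qed.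

Lemma total_poly_deriv s : deriv_along tofrac (fun p : P => (total_poly s p)%:F).
Proof.
exact: (deriv_along_post (tofrac : {rmorphism P -> F})
  (pder_deriv (@total_var R s : jetvar -> P))).
Qed.

Lemma totalE s f : total s f = frac_der tofrac (fun p : P => (total_poly s p)%:F) f.
Proof. exact: tofrac_quotient. Qed.

Lemma total_deriv s : deriv_along idfun (@total R s).
Proof.
have [h1 h2] := frac_der_idfun (total_poly_deriv s).
by split=> p q; rewrite !totalE; [exact: h1|exact: h2].
Qed.

Lemma total_tofrac s (p : P) : total s (p%:F : F) = (total_poly s p)%:F.
Proof. by rewrite totalE (frac_der_tofrac tofrac_inj0 (total_poly_deriv s)). Qed.

Lemma total_const s a : total s (jconst a : F) = 0.
Proof. by rewrite total_tofrac /total_poly pder_const rmorph0. Qed.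

Lemma total_base s i : total s (base R i) = (i == s)%:R.
Proof. by rewrite total_tofrac /total_poly pder_var /= rmorph_nat. Qed.

Lemma total_jet s i j k :
  total s (jet R i j k) = jet R (i + (s == d1)) (j + (s == d2)) (k + (s == d3)).
Proof. by rewrite total_tofrac /total_poly pder_var. Qed.
End JetField.

(** * Jet fields and symbols *)

(** What the arguments need of the field of rational functions on the jet
    space: the total derivatives jD, derivations jd with arbitrary values on the
    coordinates (which include the vertical ones), and generation by the
    coordinates. *)
Record jet_field (R : numFieldType) := JetField {
  jf :> fieldType;
  jc : {rmorphism R -> jf};
  jX : jetvar -> jf;
  jD : 'I_3 -> jf -> jf;
  jd : (jetvar -> jf) -> jf -> jf;
  jD_deriv : forall s, deriv_along idfun (jD s);
  jD_const : forall s a, jD s (jc a) = 0;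
  jD_base : forall s i, jD s (jX (inl i)) = (i == s)%:R;
  jD_jet : forall s i j k, jD s (jX (inr (i, j, k))) =
    jX (inr ((i + (s == d1))%N, (j + (s == d2))%N, (k + (s == d3))%N));
  jd_deriv : forall d, deriv_along idfun (jd d);
  jd_const : forall d a, jd d (jc a) = 0;
  jd_var : forall d v, jd d (jX v) = d v;
  jf_gen : forall Y : jf -> Prop, (forall a, gfield Y (jc a)) ->
    (forall v, gfield Y (jX v)) -> forall f, gfield Y f
}.

Definition multidx : Type := (nat * nat * nat)%type.
Definition wt (a : multidx) : nat := (a.1.1 + a.1.2 + a.2)%N.
Definition mi_coord (j : 'I_3) (a : multidx) : nat := tnth [tuple a.1.1; a.1.2; a.2] j.
Definition incr_mi (j : 'I_3) (a : multidx) : multidx :=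
  ((a.1.1 + (j == d1))%N, (a.1.2 + (j == d2))%N, (a.2 + (j == d3))%N).
Definition decr_mi (j : 'I_3) (a : multidx) : multidx :=
  ((a.1.1 - (j == d1))%N, (a.1.2 - (j == d2))%N, (a.2 - (j == d3))%N).

Lemma ord3_ind (Q : 'I_3 -> Prop) : Q d1 -> Q d2 -> Q d3 -> forall j, Q j.
Proof.
move=> h1 h2 h3 [[|[|[|//]]] lt].
- by rewrite (_ : Ordinal lt = d1) //; apply: val_inj.
- by rewrite (_ : Ordinal lt = d2) //; apply: val_inj.
- by rewrite (_ : Ordinal lt = d3) //; apply: val_inj.
Qed.

Lemma sumI3 (V : nmodType) (f : 'I_3 -> V) : \sum_j f j = f d1 + f d2 + f d3.
Proof.
rewrite !big_ord_recl big_ord0 addr0 addrA.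
by congr (f _ + f _ + f _); apply: val_inj.
Qed.

Lemma wt_incr j a : wt (incr_mi j a) = (wt a).+1.
Proof.
by case: a => [[a b] c]; elim/ord3_ind: j; rewrite /wt /= ?addn0 ?addn1 ?addnS ?addSn.
Qed.
Lemma wt_decr j a : mi_coord j a != 0%N -> (wt (decr_mi j a)).+1 = wt a.
Proof.
case: a => [[a b] c]; elim/ord3_ind: j; rewrite /mi_coord (tnth_nth 0%N) /wt /= => h; lia.
Qed.
Lemma decr_eq j a t : mi_coord j a != 0%N -> (decr_mi j a == t) = (a == incr_mi j t).
Proof.
case: a t => [[a b] c] [[a' b'] c']; elim/ord3_ind: j;
  rewrite /mi_coord (tnth_nth 0%N) /decr_mi /incr_mi /= => h;
  by rewrite !xpair_eqE /=; lia.
Qed.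
Lemma mi_coord_incr j t : mi_coord j (incr_mi j t) != 0%N.
Proof. by case: t => [[a b] c]; elim/ord3_ind: j; rewrite /mi_coord (tnth_nth 0%N) /= addn1. Qed.

Section JetTheory.
Context (R : numFieldType) (J : jet_field R).
Local Notation F := (jf J).

Let zero_deriv : deriv_along (idfun : F -> F) (fun _ => 0).
Proof. by split=> a b; rewrite ?addr0 // mul0r mulr0 addr0. Qed.

Definition jgen (f : F) : Prop := (exists a, f = jc J a) \/ exists v, f = jX J v.
Lemma jgen_all f : gfield jgen f.
Proof.
by apply: jf_gen => [a|v]; apply: gf_gen; [left; exists a|right; exists v].
Qed.

Lemma jet_deriv_ext (K : fieldType) (g : {rmorphism F -> K}) (D D' : F -> K) :
  deriv_along g D -> deriv_along g D' ->
  (forall a, D (jc J a) = D' (jc J a)) ->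
  (forall v, D (jX J v) = D' (jX J v)) -> D =1 D'.
Proof.
move=> dD dD' hC hV f; apply: (deriv_along_ext dD dD') (jgen_all f).
by move=> _ [[a ->]|[v ->]].
Qed.

Lemma jD_comm s t f : jD s (jD t f) = jD t (jD s f) :> F.
Proof.
apply/eqP; rewrite -subr_eq0; apply/eqP.
have h := deriv_along_commutator (jD_deriv J s) (jD_deriv J t).
apply: (jet_deriv_ext (g := idfun) h zero_deriv) => [a|[i|[[i j] k]]] /=.
- by rewrite !jD_const !(der0 (g := idfun) (jD_deriv _ _)) subr0.
- by rewrite !jD_base !(der_nat (g := idfun) (jD_deriv _ _)) subr0.
- by rewrite !jD_jet -!addnA ![(nat_of_bool (s == _) + _)%N]addnC subrr.
Qed.

Definition base_gen (f : F) : Prop :=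
  (exists a, f = jc J a) \/ exists i, f = jX J (inl i).
Definition base_fun := gfield base_gen.
(** Order at most m is defined by generation, so that properties of functions of
    bounded order are checked on coordinates. *)
Definition ord_gen (m : nat) (f : F) : Prop :=
  (exists a, f = jc J a) \/ (exists i, f = jX J (inl i)) \/
  exists2 a : multidx, (wt a <= m)%N & f = jX J (inr a).
Definition ord_le (m : nat) := gfield (ord_gen m).

Lemma ord_const m a : ord_le m (jc J a). Proof. by apply: gf_gen; left; exists a. Qed.
Lemma ord_nat m n : ord_le m n%:R.
Proof. by rewrite -(rmorph_nat (jc J)); apply: ord_const. Qed.
Lemma ord_opp m f : ord_le m f -> ord_le m (- f).
Proof.
move=> h; rewrite -mulN1r; apply: gf_mul => //.
by rewrite -(rmorphN1 (jc J)); apply: ord_const.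
Qed.
Lemma ord_base m i : ord_le m (jX J (inl i)).
Proof. by apply: gf_gen; right; left; exists i. Qed.
Lemma ord_jet m (a : multidx) : (wt a <= m)%N -> ord_le m (jX J (inr a)).
Proof. by move=> h; apply: gf_gen; right; right; exists a. Qed.
Lemma ord_base_fun m f : base_fun f -> ord_le m f.
Proof.
apply: gfield_sub => _ [[a ->]|[i ->]]; [exact: ord_const|exact: ord_base].
Qed.
Lemma ord_leW m n f : (m <= n)%N -> ord_le m f -> ord_le n f.
Proof.
move=> mn; apply: gfield_sub => _ [[a ->]|[[i ->]|[a am ->]]].
- exact: ord_const.
- exact: ord_base.
- by apply: ord_jet; apply: leq_trans mn.
Qed.
Lemma ord_D m s f : ord_le m f -> ord_le m.+1 (jD s f).
Proof.
apply: gfield_der; first exact: jD_deriv.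
- by apply: ord_opp; apply: (ord_nat _ 1).
- by move=> a h; apply: (@ord_leW m) => //; apply: gf_gen.
move=> _ [[a ->]|[[i ->]|[[[i j] k] am ->]]].
- by rewrite jD_const; apply: (ord_nat _ 0).
- by rewrite jD_base; apply: ord_nat.
- by rewrite jD_jet; apply: ord_jet; rewrite -/(incr_mi s (i, j, k)) wt_incr.
Qed.

(** The rows of E are the coefficients of three derivations frame_der j, of
    symbols xi_1, xi_2, xi_3. In the dual coordinates the symbol of the total
    derivative jD s is the linear form \sum_j N s j * xi_j, where N = E^-1.
    A polynomial in xi is given by its coefficients, a function
    multidx -> F: then shift_mi j is the multiplication by xi_j, sym_mul s the
    multiplication by the symbol of jD s, and sym_coef a the symbol of the jet
    coordinate of index a. *)
Section Symbol.
Context (E : 'M[F]_3).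
Hypothesis E_unit : E \in unitmx.
Let N := invmx E.

Definition frame_der (j : 'I_3) (f : F) : F := \sum_s E j s * jD s f.

Lemma frame_der_deriv j : deriv_along idfun (frame_der j).
Proof. by apply: deriv_along_comb => s; apply: jD_deriv. Qed.

Definition shift_mi (j : 'I_3) (g : multidx -> F) (a : multidx) : F :=
  if mi_coord j a == 0%N then 0 else g (decr_mi j a).
Definition sym_mul (s : 'I_3) (g : multidx -> F) (a : multidx) : F := \sum_j N s j * shift_mi j g a.

Lemma shift_comm i j g a : shift_mi i (shift_mi j g) a = shift_mi j (shift_mi i g) a.
Proof.
rewrite /shift_mi /mi_coord /decr_mi; case: a => [[a b] c].
elim/ord3_ind: i; elim/ord3_ind: j => //=; rewrite !(tnth_nth 0%N) /= ?subn0;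
  by do ![case: eqP => //=].
Qed.

Lemma sym_mul_comm s t g : sym_mul s (sym_mul t g) = sym_mul t (sym_mul s g).
Proof.
apply/funext => a.
have shT i r h : shift_mi i (sym_mul r h) a = \sum_j N r j * shift_mi i (shift_mi j h) a.
  rewrite {1}/shift_mi; case: ifP => c0.
    by rewrite big1 // => j _; rewrite {1}/shift_mi c0 mulr0.
  by apply: eq_bigr => j _; rewrite {2}/shift_mi c0.
transitivity (\sum_i \sum_j N s i * N t j * shift_mi i (shift_mi j g) a).
  apply: eq_bigr => i _; rewrite shT mulr_sumr; apply: eq_bigr => j _; by rewrite mulrA.
rewrite exchange_big /=; apply: eq_bigr => j _; rewrite shT mulr_sumr.
by apply: eq_bigr => i _; rewrite mulrA [N t j * _]mulrC shift_comm.
Qed.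

(** E N = 1: the symbol of frame_der j is xi_j. *)
Lemma frame_sym_mul j g a : \sum_s E j s * sym_mul s g a = shift_mi j g a.
Proof.
transitivity (\sum_s \sum_i E j s * N s i * shift_mi i g a).
  by apply: eq_bigr => s _; rewrite mulr_sumr; apply: eq_bigr => i _; rewrite mulrA.
have EN i : \sum_s E j s * N s i = (j == i)%:R.
  by have := mulmxV E_unit => /matrixP/(_ j i); rewrite !mxE.
rewrite exchange_big /= (bigD1 j) //= -mulr_suml EN eqxx mul1r.
by rewrite big1 ?addr0 // => i ij; rewrite -mulr_suml EN eq_sym (negPf ij) mul0r.
Qed.

Definition sym_coef (a : multidx) : multidx -> F :=
  iter a.1.1 (sym_mul d1) (iter a.1.2 (sym_mul d2) (iter a.2 (sym_mul d3)
    (fun b => (b == (0, 0, 0)%N)%:R))).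

Lemma iter_sym_mul s t n g : sym_mul s (iter n (sym_mul t) g) = iter n (sym_mul t) (sym_mul s g).
Proof. by elim: n => //= n IH; rewrite sym_mul_comm IH. Qed.

Lemma sym_coef_incr s a : sym_coef (incr_mi s a) = sym_mul s (sym_coef a).
Proof.
case: a => [[i j] k]; rewrite /sym_coef /incr_mi /=.
by elim/ord3_ind: s; rewrite /= !addn0 !addn1 //= ?iter_sym_mul //.
Qed.

Lemma sym_mul_homog n s g : (forall a, wt a != n -> g a = 0) ->
  forall a, wt a != n.+1 -> sym_mul s g a = 0.
Proof.
move=> h a an; rewrite /sym_mul big1 // => j _; rewrite /shift_mi; case: eqP => [_|/eqP c0].
  by rewrite mulr0.
by rewrite h ?mulr0 // -eqSS wt_decr.
Qed.

Lemma sym_coef_homog a b : wt b != wt a -> sym_coef a b = 0.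
Proof.
suff it s n m (g : multidx -> F) : (forall a, wt a != m -> g a = 0) ->
    forall a, wt a != (n + m)%N -> iter n (sym_mul s) g a = 0.
  case: a => [[i j] k] h; rewrite /sym_coef /=.
  have h0 : forall c : multidx, wt c != 0%N -> (c == (0, 0, 0)%N)%:R = 0 :> F.
    by move=> [[[|?] [|?]] [|?]].
  have h1 := it d2 j _ _ (it d3 k _ _ h0).
  by apply: (it d1 i _ _ h1); move: h; rewrite /wt /= addn0 addnA.
move=> h; elim: n => [|n IH] //= c; rewrite addSn => cn.
exact: sym_mul_homog IH _ cn.
Qed.

(** On functions of order wt a this vertical derivation reads off the
    coefficient of xi^a in the symbol; it kills functions of lower order. *)
Definition sym_der (a : multidx) : F -> F :=
  jd (fun v => if v is inr b then sym_coef b a else 0).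
Lemma sym_der_deriv a : deriv_along idfun (sym_der a). Proof. exact: jd_deriv. Qed.
Lemma sym_der_const a c : sym_der a (jc J c) = 0. Proof. exact: jd_const. Qed.

Lemma sym_der_base a f : base_fun f -> sym_der a f = 0.
Proof.
move=> hf; apply: (deriv_along_ext (g := idfun) (sym_der_deriv a) zero_deriv) hf.
by move=> _ [[b ->]|[i ->]]; [apply: sym_der_const|apply: jd_var].
Qed.

Lemma sym_der_low m a f : (m < wt a)%N -> ord_le m f -> sym_der a f = 0.
Proof.
move=> ma; apply: (deriv_along_ext (g := idfun) (sym_der_deriv a) zero_deriv).
move=> _ [[b ->]|[[i ->]|[b bm ->]]]; first exact: sym_der_const.
  exact: jd_var.
rewrite /sym_der jd_var sym_coef_homog // neq_ltn; apply/orP; right.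
exact: leq_ltn_trans bm ma.
Qed.

(** Symbols are multiplicative: that of jD s f is the product of those of jD s
    and f. For a product the terms in which sym_der a meets an undifferentiated
    factor vanish, that factor being of order less than wt a. *)
Lemma sym_der_D m a s f : wt a = m.+1 -> ord_le m f ->
  sym_der a (jD s f) = sym_mul s (fun b => sym_der b f) a.
Proof.
move=> am hf; have da := sym_der_deriv a; have dD := jD_deriv J s.
pose D' f := sym_mul s (fun b => sym_der b f) a.
have dD' : deriv_along idfun D'.
  apply: deriv_along_comb => j; rewrite /shift_mi; case: eqP => _; last exact: sym_der_deriv.
  exact: zero_deriv.
suff [] : sym_der a f = 0 /\ sym_der a (jD s f) = D' f by [].
have low g : ord_le m g -> sym_der a g = 0 by apply: sym_der_low; rewrite am.
elim: hf => [g hg|b c _ [b0 b1] _ [c0 c1]|b c _ [b0 b1] _ [c0 c1]|b _ [b0 b1]].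
- split; first by apply: low; apply: gf_gen.
  case: hg => [[b ->]|[[i ->]|[b bm ->]]].
  + rewrite jD_const (der0 (g := idfun) da) /D' /sym_mul big1 // => j _.
    by rewrite /shift_mi sym_der_const; case: eqP; rewrite mulr0.
  + rewrite jD_base (der_nat (g := idfun) da) /D' /sym_mul big1 // => j _.
    by rewrite /shift_mi /sym_der jd_var; case: eqP; rewrite mulr0.
  + case: b bm => [[i j] k] bm; rewrite jD_jet.
    rewrite /sym_der jd_var -/(incr_mi s (i, j, k)) sym_coef_incr /D'.
    by apply: eq_bigr => r _; rewrite /shift_mi /sym_der jd_var.
- by rewrite !(der_add dD, der_add da, der_add dD') b0 c0 b1 c1 addr0.
- rewrite (der_mul (g := idfun) dD) !(der_add da) !(der_mul (g := idfun) da).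
  rewrite (der_mul (g := idfun) dD') /= b0 c0 b1 c1.
  by rewrite !(mulr0, mul0r, addr0, add0r).
- rewrite (der_inv (g := idfun) dD) (der_opp da) (der_mul (g := idfun) da).
  rewrite (der_inv (g := idfun) dD') /= !(der_inv (g := idfun) da) expr2.
  rewrite !(der_mul (g := idfun) da) /= b0 b1.
  by rewrite !(mulr0, mul0r, addr0, oppr0).
Qed.

Lemma frame_der_ord m j f : (forall s, ord_le m.+1 (E j s)) -> ord_le m f ->
  ord_le m.+1 (frame_der j f).
Proof.
move=> hE hf; apply: gf_sum => [|s]; first exact: (ord_nat _ 0).
by apply: gf_mul; [exact: hE|exact: ord_D].
Qed.

Lemma sym_der_frame_der m a j f : wt a = m.+1 -> (forall s, ord_le m (E j s)) ->
  ord_le m f -> sym_der a (frame_der j f) = shift_mi j (fun b => sym_der b f) a.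
Proof.
move=> am hE hf; have da := sym_der_deriv a.
rewrite -frame_sym_mul /frame_der (der_sum da); apply: eq_bigr => s _.
rewrite (der_mul (g := idfun) da) /= (sym_der_low _ (hE s)) ?am // mul0r add0r.
by rewrite (sym_der_D _ am hf).
Qed.

(** The leading part of f, of order wt t, is the monomial xi^t. *)
Definition has_symbol (t : multidx) (f : F) : Prop :=
  ord_le (wt t) f /\ forall b, wt b = wt t -> sym_der b f = (b == t)%:R.

Lemma shift_delta j b t : shift_mi j (fun b => (b == t)%:R : F) b = (b == incr_mi j t)%:R.
Proof.
rewrite /shift_mi; case: eqP => [b0|/eqP b0]; last by rewrite decr_eq.
by case: eqP => // e; have := mi_coord_incr j t; rewrite -e b0.
Qed.

Lemma has_symbol_frame_der j t f : (forall s, ord_le (wt t) (E j s)) ->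
  has_symbol t f -> has_symbol (incr_mi j t) (frame_der j f).
Proof.
move=> hE [h1 h2]; rewrite /has_symbol wt_incr; split.
  by apply: frame_der_ord => // s; apply: ord_leW (hE s).
move=> b bt; rewrite (sym_der_frame_der bt) // -shift_delta /shift_mi.
by case: eqP => // /eqP b0; rewrite h2 //; apply/eqP; rewrite -eqSS wt_decr ?bt.
Qed.

Lemma has_symbol_u : has_symbol (0, 0, 0)%N (jX J (inr (0, 0, 0)%N)).
Proof.
split; first exact: ord_jet.
by move=> b _; rewrite /sym_der jd_var /sym_coef.
Qed.

Lemma has_symbol_iter j n t f : (forall s, ord_le (wt t) (E j s)) ->
  has_symbol t f -> has_symbol (iter n (incr_mi j) t) (iter n (frame_der j) f).
Proof.
move=> hE hf; elim: n => //= n IH; apply: has_symbol_frame_der => // s.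
apply: ord_leW (hE s); elim: n {IH} => //= n IH; rewrite wt_incr; exact: leq_trans IH _.
Qed.
End Symbol.
End JetTheory.

(** * Prolongation of a transformation of the base *)

Section Prolongation.
Context (R : numFieldType) (J : jet_field R).
Local Notation F := (jf J).
Context (phi : 'I_3 -> F).

Definition jacobian : 'M[F]_3 := \matrix_(s, t) jD s (phi t).

(** The total derivatives with respect to the new base coordinates phi. *)
Definition pulled_frame : 'M[F]_3 := invmx jacobian.

Definition pulled_var (v : jetvar) : F :=
  match v with
  | inl i => phi i
  | inr (i, j, k) =>
      iter i (frame_der pulled_frame d1) (iter j (frame_der pulled_frame d2)
        (iter k (frame_der pulled_frame d3) (jX J (inr (0, 0, 0)%N))))
  end.

Hypothesis jac_unit : jacobian \in unitmx.
Let E := pulled_frame.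

Lemma pulled_frame_unit : E \in unitmx.
Proof. by rewrite unitmx_inv. Qed.

Lemma pulled_frame_phi i t : frame_der E i (phi t) = (i == t)%:R.
Proof.
have := mulVmx jac_unit => /matrixP/(_ i t); rewrite !mxE => <-.
by apply: eq_bigr => s _; rewrite !mxE.
Qed.

Lemma jac_pulled s t : \sum_r jD s (phi r) * E r t = (s == t)%:R.
Proof.
have := mulmxV jac_unit => /matrixP/(_ s t); rewrite !mxE => <-.
by apply: eq_bigr => r _; rewrite !mxE.
Qed.

Lemma jac_frame_der s f : \sum_t jD s (phi t) * frame_der E t f = jD s f.
Proof.
transitivity (\sum_r (\sum_t jD s (phi t) * E t r) * jD r f).
  rewrite (eq_bigr (fun t => \sum_r jD s (phi t) * E t r * jD r f)) => [|t _].
    by rewrite exchange_big; apply: eq_bigr => r _; rewrite mulr_suml.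
  by rewrite mulr_sumr; apply: eq_bigr => r _; rewrite mulrA.
rewrite (bigD1 s) //= jac_pulled eqxx mul1r big1 ?addr0 // => r rs.
by rewrite jac_pulled eq_sym (negPf rs) mul0r.
Qed.

Lemma frame_der_commutator a b f :
  frame_der E a (frame_der E b f) - frame_der E b (frame_der E a f) =
  \sum_t (frame_der E a (E b t) - frame_der E b (E a t)) * jD t f.
Proof.
have exp c e : frame_der E c (frame_der E e f) =
    \sum_t frame_der E c (E e t) * jD t f + \sum_s \sum_t E c s * E e t * jD s (jD t f).
  rewrite {1}/frame_der.
  rewrite (eq_bigr (fun s => \sum_t E c s * jD s (E e t) * jD t f +
                             \sum_t E c s * E e t * jD s (jD t f))) => [|s _].
    rewrite big_split /=; congr (_ + _); rewrite exchange_big /=.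
    by apply: eq_bigr => t _; rewrite mulr_suml.
  rewrite (der_sum (jD_deriv J s)) mulr_sumr -big_split /=; apply: eq_bigr => t _.
  by rewrite (der_mul (g := idfun) (jD_deriv J s)) /= mulrDr !mulrA.
rewrite !exp; set S1 := \sum_s \sum_t _; set S2 := (X in _ - (_ + X)).
have -> : S1 = S2.
  rewrite /S1 exchange_big; apply: eq_bigr => s _; apply: eq_bigr => t _.
  by rewrite jD_comm [E a t * _]mulrC.
rewrite opprD addrACA subrr addr0 -sumrB.
by apply: eq_bigr => t _; rewrite mulrBl.
Qed.

(** The commutator is a combination of total derivatives that kills every phi,
    and the Jacobian matrix of phi is invertible. *)
Lemma frame_der_comm a b f :
  frame_der E a (frame_der E b f) = frame_der E b (frame_der E a f).
Proof.
(* the coefficients of the commutator on the total derivatives *)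
pose gam t := frame_der E a (E b t) - frame_der E b (E a t).
have gphi i : \sum_t gam t * jD t (phi i) = 0.
  rewrite -frame_der_commutator !pulled_frame_phi.
  by rewrite !(der_nat (g := idfun) (frame_der_deriv _ _)) subrr.
have g0 s : gam s = 0.
  transitivity (\sum_i (\sum_t gam t * jD t (phi i)) * E i s); last first.
    by rewrite big1 // => i _; rewrite gphi mul0r.
  rewrite (eq_bigr (fun i => \sum_t gam t * (jD t (phi i) * E i s))) => [|i _].
    rewrite exchange_big /= (bigD1 s) //= -mulr_sumr jac_pulled eqxx mulr1.
    rewrite big1 ?addr0 // => t ts.
    by rewrite -mulr_sumr jac_pulled (negPf ts) mulr0.
  by rewrite mulr_suml; apply: eq_bigr => t _; rewrite mulrA.
apply/eqP; rewrite -subr_eq0 frame_der_commutator big1 // => t _.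
by rewrite -/(gam t) g0 mul0r.
Qed.

Lemma pulled_var_incr t (a : multidx) :
  pulled_var (inr (incr_mi t a)) = frame_der E t (pulled_var (inr a)).
Proof.
have it s r n g : frame_der E s (iter n (frame_der E r) g) =
                  iter n (frame_der E r) (frame_der E s g).
  by elim: n => //= n IH; rewrite frame_der_comm IH.
case: a => [[i j] k]; rewrite /incr_mi /pulled_var /= -/E.
by elim/ord3_ind: t; rewrite /= !addn0 !addn1 //= ?it.
Qed.

Section Indep.
Hypothesis phi_base : forall t, base_fun (phi t).
Hypothesis E_base : forall s t, base_fun (E s t).

(** Unlike frame_der i, with which it agrees on functions of the base, it kills
    the jet coordinates. *)
Definition dbase (i : 'I_3) : F -> F :=
  jd (fun v => if v is inl s then E i s else 0).

Lemma dbaseE i f : base_fun f -> dbase i f = frame_der E i f.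
Proof.
move=> hf; apply: (deriv_along_ext (g := idfun) _ _ _ hf).
- exact: jd_deriv.
- exact: frame_der_deriv.
- move=> _ [[a ->]|[s ->]]; rewrite /dbase.
    by rewrite jd_const /frame_der big1 // => t _; rewrite jD_const mulr0.
  rewrite jd_var /frame_der (bigD1 s) //= jD_base eqxx mulr1 big1 ?addr0 // => t ts.
  by rewrite jD_base eq_sym (negPf ts) mulr0.
Qed.

Lemma pulled_symbol (a : multidx) : has_symbol E a (pulled_var (inr a)).
Proof.
case: a => [[i j] k].
have iti s n (a : multidx) : iter n (incr_mi s) a =
  ((a.1.1 + n * (s == d1))%N, (a.1.2 + n * (s == d2))%N, (a.2 + n * (s == d3))%N).
  elim: n => [|n IH] /=; first by case: a => [[? ?] ?]; rewrite !addn0.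
  by rewrite IH /incr_mi /= !mulSn; congr (_, _, _); lia.
have e : (i, j, k) = iter i (incr_mi d1) (iter j (incr_mi d2)
    (iter k (incr_mi d3) (0, 0, 0)%N)).
  by rewrite !iti /=; congr (_, _, _); lia.
rewrite {1}e /pulled_var.
by do 3![apply: (has_symbol_iter pulled_frame_unit) => [s|]; first exact: ord_base_fun];
  apply: has_symbol_u.
Qed.

(** In the pulled frame the pulled back jet coordinate of index a has symbol
    xi^a, so the derivations sym_der are dual to these coordinates; the functions
    phi, of rank 0, are separated by dbase. It follows that pulling back extends
    from polynomials to rational functions. *)
Theorem pulled_var_indep p : peval (jc J) pulled_var p = 0 -> p = 0.
Proof.
pose rk (v : jetvar) := if v is inr a then (wt a).+1 else 0%N.
pose d (v : jetvar) := match v with inl i => dbase i | inr a => sym_der E a end.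
apply: (@alg_indep R jetvar F (jc J) pulled_var rk d).
- by case=> [i|a]; apply: jd_deriv.
- by case=> [i|a] c; apply: jd_const.
- case=> [i|a] /=; first by rewrite (dbaseE _ (phi_base i)) pulled_frame_phi eqxx oner_eq0.
  by have [_ h] := pulled_symbol a; rewrite h // eqxx oner_eq0.
case=> [i|a] [j|b] //= h ab.
- rewrite (dbaseE _ (phi_base j)) pulled_frame_phi; have [ij|//] := eqVneq i j.
  by move: ab; rewrite ij eqxx.
- exact: sym_der_base.
- have [h1 h2] := pulled_symbol b; case: (ltngtP (wt b) (wt a)) => [lt|lt|e].
  + exact: sym_der_low lt h1.
  + by move: h; rewrite ltnS leqNgt lt.
  + rewrite h2 //; have [e'|//] := eqVneq a b.
    by move: ab; rewrite e' eqxx.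
Qed.
End Indep.

Section Pullback.
Context (sg : {rmorphism F -> F}).
Hypothesis sg_const : forall a, sg (jc J a) = jc J a.
Hypothesis sg_var : forall v, sg (jX J v) = pulled_var v.

Lemma pull_total t f : sg (jD t f) = frame_der E t (sg f).
Proof.
apply: (@jet_deriv_ext R J F sg (sg \o jD t) (frame_der E t \o sg)).
- exact: (deriv_along_post sg (jD_deriv J t)).
- exact: (deriv_along_pre sg (frame_der_deriv E t)).
- move=> a /=; rewrite jD_const sg_const rmorph0 /frame_der big1 // => s _.
  by rewrite jD_const mulr0.
- case=> [i|[[i j] k]] /=.
    by rewrite jD_base sg_var /= pulled_frame_phi rmorph_nat eq_sym.
  by rewrite jD_jet !sg_var -/(incr_mi t (i, j, k)) pulled_var_incr.
Qed.

Lemma total_pull s f : jD s (sg f) = \sum_t jD s (phi t) * sg (jD t f).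
Proof. by rewrite -jac_frame_der; apply: eq_bigr => t _; rewrite pull_total. Qed.

(** By the chain rule, invariance of a combination of total derivatives is a
    condition on its values on the base coordinates. *)
Lemma pull_frame_der (C : 'M[F]_3) j f :
  (forall t, \sum_s C j s * jD s (phi t) = sg (C j t)) ->
  sg (frame_der C j f) = frame_der C j (sg f).
Proof.
move=> h; rewrite /frame_der rmorph_sum /=.
rewrite (eq_bigr (fun t => \sum_s C j s * (jD s (phi t) * sg (jD t f)))) => [|t _].
  rewrite exchange_big; apply: eq_bigr => s _.
  by rewrite -mulr_sumr total_pull.
by rewrite rmorphM -h mulr_suml; apply: eq_bigr => s _; rewrite mulrA.
Qed.
End Pullback.
End Prolongation.

(** * The syzygies as identities between jets *)

Section Frame.
Context (T : comNzRingType) (Dx Dy Dz : T -> T) (x y z u : T).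
Hypothesis dx : deriv_along idfun Dx.
Hypothesis dy : deriv_along idfun Dy.
Hypothesis dz : deriv_along idfun Dz.
Hypothesis Dyx : forall f, Dy (Dx f) = Dx (Dy f).
Hypothesis Dzx : forall f, Dz (Dx f) = Dx (Dz f).
Hypothesis Dzy : forall f, Dz (Dy f) = Dy (Dz f).
Hypothesis Dxb : (Dx x = 1) * (Dx y = 0) * (Dx z = 0).
Hypothesis Dyb : (Dy x = 0) * (Dy y = 1) * (Dy z = 0).
Hypothesis Dzb : (Dz x = 0) * (Dz y = 0) * (Dz z = 1).

Local Notation w := (x * y - 2 * z).
Definition fN1 f := x * Dx f + y * Dy f + 2 * z * Dz f.
Definition fN2 f := w * Dz f.
Definition fN3 f := (x * Dz u + Dy u) * w * Dx f + (- Dx u * w) * Dy f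
   + (- x * Dx u * w) * Dz f.
Definition fN (j : 'I_3) : T -> T := tnth [tuple fN1; fN2; fN3] j.

Let dM D (d : deriv_along idfun D) a b : D (a * b) = D a * b + a * D b :> T.
Proof. exact: d.2. Qed.
Let dtwo D (d : deriv_along idfun D) : D 2 = 0 :> T.
Proof. exact: (der_nat (g := idfun) d). Qed.

Let rules := (der_add dx, der_add dy, der_add dz, der_opp dx, der_opp dy, der_opp dz,
  dM dx, dM dy, dM dz, dtwo dx, dtwo dy, dtwo dz, der1 (g := idfun) dx,
  der1 (g := idfun) dy, der1 (g := idfun) dz, der0 dx, der0 dy, der0 dz, Dyx, Dzx, Dzy, Dxb, Dyb, Dzb).

Definition fI2f :=
  w ^+ 2 *
  (x ^+ 2 * (Dx u ^+ 2 * Dz (Dz u) - 2 * Dx u * Dz u * Dx (Dz u) + Dz u ^+ 2 * Dx (Dx u))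
   + x * (2 * Dx u ^+ 2 * Dy (Dz u) - Dx u * Dz u ^+ 2 - 2 * Dx u * Dz u * Dx (Dy u)
          - 2 * Dx u * Dy u * Dx (Dz u) + 2 * Dy u * Dz u * Dx (Dx u))
   + Dx u ^+ 2 * Dy (Dy u) - Dx u * Dy u * Dz u - 2 * Dx u * Dy u * Dx (Dy u)
   + Dy u ^+ 2 * Dx (Dx u)).

Let fNE : ((fN d1 = fN1) * (fN d2 = fN2) * (fN d3 = fN3))%type.
Proof. by []. Qed.

Lemma syz1 : R1 fN u = 0.
Proof. by rewrite /R1 !fNE /fN3; ring. Qed.

Lemma syz2 f : R2 fN f = 0.
Proof. by rewrite /R2 /commutator !fNE /fN1 /fN2 !rules; ring. Qed.

Lemma syz3 f : R3 fN u f = 0.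
Proof. by rewrite /R3 /commutator !fNE /fN1 /fN2 /fN3 !rules; ring. Qed.

Lemma syz4 f : R4 fN u f = 0.
Proof. by rewrite /R4 /commutator !fNE /fN1 /fN2 /fN3 !rules; ring. Qed.

(** R_5 is, up to sign, R_3 evaluated at N2 u. *)
Lemma syz5 : R5 fN u = 0.
Proof.
by rewrite -[RHS]oppr0 -(syz3 (fN2 u)) /R5 /R3 /commutator !fNE; ring.
Qed.

Local Notation u1 := (Dx u).
Local Notation u2 := (Dy u).
Local Notation u3 := (Dz u).
Local Notation u11 := (Dx (Dx u)).
Local Notation u12 := (Dx (Dy u)).
Local Notation u13 := (Dx (Dz u)).
Local Notation u22 := (Dy (Dy u)).
Local Notation u23 := (Dy (Dz u)).
Local Notation u33 := (Dz (Dz u)).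

Lemma N1N1u : fN1 (fN1 u) =
  y ^+ 2 * u22 + y * (4 * z * u23 + 2 * x * u12 + u2) + 4 * z ^+ 2 * u33
  + z * (4 * x * u13 + 4 * u3) + x * (x * u11 + u1).
Proof. by rewrite /fN1 !rules; ring. Qed.

Lemma N1N2u : fN1 (fN2 u) = w * (y * u23 + 2 * z * u33 + x * u13 + 2 * u3).
Proof. by rewrite /fN1 /fN2 !rules; ring. Qed.

Lemma N3N1u : fN3 (fN1 u) =
  - w * (x ^+ 2 * (u1 * u13 - u3 * u11)
   + x * (u1 * (y * u23 + 2 * z * u33 + u3 + u12)
          - y * u3 * u12 - 2 * z * u3 * u13 - u2 * u11)
   + u1 * (y * u22 + 2 * z * u23) - u2 * (y * u12 + 2 * z * u13)).
Proof. by rewrite /fN1 /fN3 !rules; ring. Qed.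

Lemma N2N2u : fN2 (fN2 u) = w * (- 2 * u3 + w * u33).
Proof. by rewrite /fN2 !rules; ring. Qed.

Lemma N3N2u : fN3 (fN2 u) =
  - w * (x ^+ 2 * y * (u1 * u33 - u3 * u13)
   + x * (y * (u1 * u23 - u3 ^+ 2 - u2 * u13)
          + u1 * (- 2 * z * u33 - u3) + 2 * z * u3 * u13)
   - y * u2 * u3 - 2 * z * (u1 * u23 - u2 * u13)).
Proof. by rewrite /fN2 /fN3 !rules; ring. Qed.

Lemma syz6 : R6 fN u fI2f = 0.
Proof.
(* expanding the second order invariants first keeps the derivatives small *)
rewrite /R6 !fNE N1N1u N1N2u N3N1u N3N2u /fI2f /fN1 /fN2 /fN3.
rewrite !expr2 !rules.
ring.
Qed.

Lemma syz7 : R7 fN u fI2f = 0.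
Proof.
rewrite /R7 !fNE N1N2u N3N1u N3N2u N2N2u /fI2f /fN1 /fN2 /fN3.
rewrite !expr2 !rules.
ring.
Qed.

Lemma N3x : fN3 x = (x * u3 + u2) * w.
Proof. by rewrite /fN3 !rules; ring. Qed.
Lemma N3y : fN3 y = - u1 * w.
Proof. by rewrite /fN3 !rules; ring. Qed.

Definition fS := fN1 u + fN2 u.

Lemma frame_det : x * fN3 y - y * fN3 x = - (w * fS).
Proof. by rewrite N3x N3y /fS /fN1 /fN2; ring. Qed.

(** Here I_2f appears as a structure function of the moving frame with columns
    (x, y) and (N3 x, N3 y); S and N3 S are the other ones. *)
Lemma frame_N3 (t : T) : t = x \/ t = y ->
  fS * fN3 (fN3 t) = - fI2f * t + (fS ^+ 2 + fN3 fS) * fN3 t.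
Proof.
have e : fN3 fS = fN3 (fN1 u) + fN3 (fN2 u) by rewrite /fS /fN3 !rules; ring.
rewrite e N3N1u N3N2u => -[->|->].
  by rewrite N3x /fS /fN1 /fN2 /fN3 /fI2f !rules; ring.
by rewrite N3y /fS /fN1 /fN2 /fN3 /fI2f !rules; ring.
Qed.

(** Up to first order terms I_2f is the second derivative of u in the direction
    of N3: its symbol is the square of that of N3. *)
Lemma I2f_N3 : fI2f = fN3 x * fN3 (Dx u) + fN3 y * fN3 (Dy u) + fN3 z * fN3 (Dz u)
  - w ^+ 2 * Dx u * Dz u * (x * Dz u + Dy u).
Proof. by rewrite /fI2f /fN3 !rules; ring. Qed.

Lemma frame_N12 : fN1 x = x /\ fN1 y = y /\ fN2 x = 0 /\ fN2 y = 0.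
Proof. by rewrite /fN1 /fN2 !rules; split; [|split; [|split]]; ring. Qed.
End Frame.

(** * Invariance under the linear contact transformations *)

Lemma det2 (T : comNzRingType) (A : 'M[T]_2) : \det A = A 0 0 * A 1 1 - A 0 1 * A 1 0.
Proof.
rewrite (expand_det_row _ 0) !big_ord_recl big_ord0 addr0 /cofactor !det_mx11 !mxE /=.
by rewrite expr0 expr1 mul1r mulN1r mulrN;
  congr (A _ _ * A _ _ - A _ _ * A _ _); apply: val_inj.
Qed.


(** X, Y, Z are the components of Phi_A, Zx and Zy the derivatives of Z along x
    and y, and p_i, v_i the new and old first derivatives of u, related by the
    chain rule. The function x y - 2 z is multiplied by the determinant, and the
    coefficients of nabla_1 and nabla_3 are transformed as a vector field. *)
Section ContactAlgebra.
Context (F : fieldType) (x y z a b a' b' p1 p2 p3 v1 v2 v3 : F).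
Hypothesis two_neq0 : 2 != 0 :> F.
Local Notation w := (x * y - 2 * z).
Local Notation dA := (a * b' - b * a').
Local Notation X := (a * x + b * y).
Local Notation Y := (a' * x + b' * y).
Local Notation Z := (dA * (z - x * y / 2) + X * Y / 2).
Local Notation Zx := (((a * Y + X * a') - dA * y) / 2).
Local Notation Zy := (((b * Y + X * b') - dA * x) / 2).

Lemma contact_N1 : x * Zx + y * Zy + 2 * z * dA = 2 * Z.
Proof. by field. Qed.

Lemma contact_w : w * dA = X * Y - 2 * Z.
Proof. by field. Qed.

Hypothesis v1E : v1 = a * p1 + a' * p2 + Zx * p3.
Hypothesis v2E : v2 = b * p1 + b' * p2 + Zy * p3.
Hypothesis v3E : v3 = dA * p3.

Lemma contact_N3x :
  (x * v3 + v2) * w * a + - v1 * w * b = (X * p3 + p2) * (X * Y - 2 * Z).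
Proof. by rewrite -contact_w v1E v2E v3E; field. Qed.

Lemma contact_N3y :
  (x * v3 + v2) * w * a' + - v1 * w * b' = - p1 * (X * Y - 2 * Z).
Proof. by rewrite -contact_w v1E v2E v3E; field. Qed.

Lemma contact_N3z :
  (x * v3 + v2) * w * Zx + - v1 * w * Zy + - x * v1 * w * dA
  = - X * p1 * (X * Y - 2 * Z).
Proof. by rewrite -contact_w v1E v2E v3E; field. Qed.
End ContactAlgebra.

Section Matrix3.
Context (F : fieldType).
Definition cyc : 'I_3 -> 'I_3 := tnth [tuple d2; d3; d1].
(** Cyclic indices absorb the signs of the cofactors. *)
Definition minor3 (M : 'M[F]_3) (j s : 'I_3) : F :=
  M (cyc j) (cyc s) * M (cyc (cyc j)) (cyc (cyc s))
  - M (cyc j) (cyc (cyc s)) * M (cyc (cyc j)) (cyc s).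
Definition det3 (M : 'M[F]_3) : F := \sum_s M d1 s * minor3 M d1 s.

Lemma cycE : ((cyc d1 = d2) * (cyc d2 = d3) * (cyc d3 = d1))%type.
Proof. by split; [split|]; apply: val_inj. Qed.

Lemma unit3 (M : 'M[F]_3) : det3 M != 0 ->
  M \in unitmx /\ forall s j, invmx M s j = minor3 M j s / det3 M.
Proof.
move=> M0; pose B : 'M[F]_3 := \matrix_(s, j) (minor3 M j s / det3 M).
have MB : M *m B = 1%:M.
  apply/matrixP => i j; rewrite !mxE sumI3 !mxE.
  rewrite !mulrA -!mulrDl.
  have -> : M i d1 * minor3 M j d1 + M i d2 * minor3 M j d2 + M i d3 * minor3 M j d3
          = (i == j)%:R * det3 M.
    rewrite /det3 /minor3 sumI3.
    by elim/ord3_ind: i; elim/ord3_ind: j; rewrite !cycE /=; ring.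
  by rewrite mulfK.
have [h _] := mulmx1_unit MB; split=> // s j.
have -> : invmx M = B by rewrite -[B]mul1mx -(mulVmx h) -mulmxA MB mulmx1.
by rewrite mxE.
Qed.
End Matrix3.

Section Group.
Context (R : numFieldType) (J : jet_field R).
Local Notation F := (jf J).
Local Notation c := (jc J).
Local Notation Dt := (@jD R J).
Local Notation x := (jX J (inl d1)).
Local Notation y := (jX J (inl d2)).
Local Notation z := (jX J (inl d3)).
Local Notation u := (jX J (inr (0, 0, 0)%N)).
Local Notation w := (x * y - 2 * z).

Definition jN := fN (Dt d1) (Dt d2) (Dt d3) x y z u.
Definition jI2f := fI2f (Dt d1) (Dt d2) (Dt d3) x y z u.
Definition jS := fS (Dt d1) (Dt d2) (Dt d3) x y z u.

Definition nabla_mx : 'M[F]_3 := \matrix_(j, s) jN j (jX J (inl s)).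

Let Db s : ((Dt s x = (d1 == s)%:R) * (Dt s y = (d2 == s)%:R)
            * (Dt s z = (d3 == s)%:R))%type.
Proof. by split; [split|]; apply: jD_base. Qed.

Lemma jN1 f : jN d1 f = x * Dt d1 f + y * Dt d2 f + 2 * z * Dt d3 f.
Proof. by []. Qed.
Lemma jN2 f : jN d2 f = w * Dt d3 f. Proof. by []. Qed.
Lemma jN3 f : jN d3 f = (x * Dt d3 u + Dt d2 u) * w * Dt d1 f
  + (- Dt d1 u * w) * Dt d2 f + (- x * Dt d1 u * w) * Dt d3 f.
Proof. by []. Qed.

Lemma jNE j f : jN j f = frame_der nabla_mx j f.
Proof.
rewrite /frame_der sumI3 !mxE.
by elim/ord3_ind: j; rewrite ?jN1 ?jN2 ?jN3 !Db /=; ring.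
Qed.

Lemma jN_deriv j : deriv_along idfun (jN j).
Proof.
have [h1 h2] := frame_der_deriv nabla_mx j.
by split=> f g; rewrite !jNE; [apply: h1|apply: h2].
Qed.

Lemma nat_neq0 n : n.+1%:R != 0 :> F.
Proof. by rewrite -(rmorph_nat c) fmorph_eq0 pnatr_eq0. Qed.

Lemma x_neq0 : x != 0.
Proof.
apply/eqP => x0; have := jD_base J d1 d1; rewrite x0 (der0 (jD_deriv J d1)).
by move/eqP; rewrite eq_sym oner_eq0.
Qed.

Lemma w_neq0 : w != 0.
Proof.
apply/eqP => w0; have := jD_deriv J d3 => dd.
have : Dt d3 w = 0 by rewrite w0 (der0 dd).
rewrite (der_sub dd) !(der_mul (g := idfun) dd) (der_nat (g := idfun) dd) !Db /=.
rewrite mul0r mulr0 mul0r !add0r mulr1 => /eqP.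
by rewrite oppr_eq0 (negPf (nat_neq0 1)).
Qed.

Lemma jS_neq0 : jS != 0.
Proof.
(* the derivation along u_x maps S to x *)
pose d := jd (fun v => if v == inr (1, 0, 0)%N then 1 else 0 : F).
have dd : deriv_along idfun d := jd_deriv _.
have dv v : d (jX J v) = if v == inr (1, 0, 0)%N then 1 else 0 by apply: jd_var.
have S0 : d jS = x.
  rewrite /jS /fS /fN1 /fN2 !jD_jet /=.
  rewrite !(der_add dd, der_opp dd, der_mul (g := idfun) dd, der_nat (g := idfun) dd, dv) /=.
  by ring.
by apply: contra_neq x_neq0 => S1; rewrite -S0 S1 (der0 dd).
Qed.

Lemma jDxb : ((Dt d1 x = 1) * (Dt d1 y = 0) * (Dt d1 z = 0))%type.
Proof. by rewrite !Db. Qed.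
Lemma jDyb : ((Dt d2 x = 0) * (Dt d2 y = 1) * (Dt d2 z = 0))%type.
Proof. by rewrite !Db. Qed.
Lemma jDzb : ((Dt d3 x = 0) * (Dt d3 y = 0) * (Dt d3 z = 1))%type.
Proof. by rewrite !Db. Qed.

Lemma frame_det_neq0 : x * jN d3 y - y * jN d3 x != 0.
Proof.
rewrite (_ : x * jN d3 y - y * jN d3 x = - (w * jS)).
  by rewrite oppr_eq0 mulf_eq0 (negPf w_neq0) (negPf jS_neq0).
exact: (frame_det _ jDxb jDyb jDzb).
Qed.

Lemma det3_nabla_neq0 : det3 nabla_mx != 0.
Proof.
rewrite /det3 /minor3 sumI3 !cycE !mxE.
have -> : jN d2 x = 0 by rewrite jN2 !Db mulr0.
have -> : jN d2 y = 0 by rewrite jN2 !Db mulr0.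
have -> : jN d2 z = w by rewrite jN2 !Db mulr1.
have -> : jN d1 x = x by rewrite !jN1 !Db /=; ring.
have -> : jN d1 y = y by rewrite !jN1 !Db /=; ring.
have -> : x * (0 * jN d3 z - w * jN d3 y) + y * (w * jN d3 x - 0 * jN d3 z)
   + jN d1 z * (0 * jN d3 y - 0 * jN d3 x) = - (w * (x * jN d3 y - y * jN d3 x)) by ring.
by rewrite oppr_eq0 mulf_eq0 (negPf w_neq0) (negPf frame_det_neq0).
Qed.

Lemma nabla_mx_unit : nabla_mx \in unitmx.
Proof. exact: (unit3 det3_nabla_neq0).1. Qed.

Lemma jframe_N3 t : t = x \/ t = y ->
  jS * jN d3 (jN d3 t) = - jI2f * t + (jS ^+ 2 + jN d3 jS) * jN d3 t.
Proof.
exact: (frame_N3 u (jD_deriv J d1) (jD_deriv J d2) (jD_deriv J d3)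
  (jD_comm _ _) (jD_comm _ _) (jD_comm _ _) jDxb jDyb jDzb).
Qed.

Lemma jframe_N12 : jN d1 x = x /\ jN d1 y = y /\ jN d2 x = 0 /\ jN d2 y = 0.
Proof. exact: (frame_N12 jDxb jDyb jDzb). Qed.

Lemma jsyz r : syzygy jN u jI2f r -> r = 0.
Proof.
have h1 := jD_deriv J d1; have h2 := jD_deriv J d2; have h3 := jD_deriv J d3.
have h4 := @jD_comm _ J d2 d1; have h5 := @jD_comm _ J d3 d1; have h6 := @jD_comm _ J d3 d2.
have h7 := jDxb; have h8 := jDyb; have h9 := jDzb.
case=> [|f|f|f|||].
- exact: syz1.
- exact: syz2.
- exact: syz3.
- exact: syz4.
- exact: syz5.
- exact: syz6.
- exact: syz7.
Qed.

Section Phi.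
Context (A : 'M[R]_2).
Hypothesis A_unit : A \in unitmx.

Let a := c (A 0 0).
Let b := c (A 0 1).
Let a' := c (A 1 0).
Let b' := c (A 1 1).
Let dA := c (\det A).

Definition jPhi : 'I_3 -> F :=
  let X := c (A 0 0) * x + c (A 0 1) * y in
  let Y := c (A 1 0) * x + c (A 1 1) * y in
  let Z := c (\det A) * (z - x * y / 2) + X * Y / 2 in
  tnth [tuple X; Y; Z].

Lemma dAE : dA = a * b' - b * a'.
Proof. by rewrite /dA det2 rmorphB !rmorphM. Qed.

Lemma dA_neq0 : dA != 0.
Proof. by rewrite fmorph_eq0 -unitfE -unitmxE. Qed.

Lemma jPhi1 : jPhi d1 = a * x + b * y. Proof. by []. Qed.
Lemma jPhi2 : jPhi d2 = a' * x + b' * y. Proof. by []. Qed.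
Lemma jPhi3 : jPhi d3 = dA * (z - x * y / 2) + (a * x + b * y) * (a' * x + b' * y) / 2.
Proof. by []. Qed.

Let two_neq0 : 2 != 0 :> F := nat_neq0 1.

Let Dc s r : Dt s (c r) = 0. Proof. exact: jD_const. Qed.
Let DM s f g : Dt s (f * g) = Dt s f * g + f * Dt s g.
Proof. exact: (jD_deriv J s).2. Qed.
Let D2 s : Dt s 2^-1 = 0.
Proof. by rewrite -[2]/(2%:R) -(rmorph_nat c) -fmorphV Dc. Qed.

Lemma D_jPhi1 s : Dt s (jPhi d1) = a * (d1 == s)%:R + b * (d2 == s)%:R.
Proof.
by rewrite jPhi1 (der_add (jD_deriv J s)) !DM !Dc !Db; ring.
Qed.
Lemma D_jPhi2 s : Dt s (jPhi d2) = a' * (d1 == s)%:R + b' * (d2 == s)%:R.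
Proof.
by rewrite jPhi2 (der_add (jD_deriv J s)) !DM !Dc !Db; ring.
Qed.
Lemma D_jPhi3 s : Dt s (jPhi d3) =
   dA * ((d3 == s)%:R - ((d1 == s)%:R * y + x * (d2 == s)%:R) / 2)
   + ((a * (d1 == s)%:R + b * (d2 == s)%:R) * (a' * x + b' * y)
      + (a * x + b * y) * (a' * (d1 == s)%:R + b' * (d2 == s)%:R)) / 2.
Proof.
have ds := jD_deriv J s.
by rewrite jPhi3 !(der_add ds, der_opp ds, DM, Dc, D2, Db); ring.
Qed.
Let D_jPhi := (D_jPhi1, D_jPhi2, D_jPhi3).

Lemma D_jPhi_values :
  [/\ [/\ Dt d1 (jPhi d1) = a, Dt d2 (jPhi d1) = b & Dt d3 (jPhi d1) = 0],
      [/\ Dt d1 (jPhi d2) = a', Dt d2 (jPhi d2) = b' & Dt d3 (jPhi d2) = 0] &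
      [/\ Dt d1 (jPhi d3) = ((a * (a' * x + b' * y) + (a * x + b * y) * a') - dA * y) / 2,
          Dt d2 (jPhi d3) = ((b * (a' * x + b' * y) + (a * x + b * y) * b') - dA * x) / 2 &
          Dt d3 (jPhi d3) = dA]].
Proof. by rewrite !D_jPhi /=; split; split; ring. Qed.

Lemma jac_det3 : det3 (jacobian jPhi) = dA ^+ 2.
Proof.
rewrite /det3 /minor3 sumI3 !cycE !mxE !D_jPhi /= dAE.
by field.
Qed.

Lemma jac_unit : jacobian jPhi \in unitmx.
Proof. by apply: (unit3 _).1; rewrite jac_det3 expf_neq0 // dA_neq0. Qed.

Lemma base_fun_nat n : @base_fun R J n%:R.
Proof. by rewrite -(rmorph_nat c); apply: gf_gen; left; exists n%:R. Qed.
Lemma base_fun_const r : base_fun (c r). Proof. by apply: gf_gen; left; exists r. Qed.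
Lemma base_fun_var i : base_fun (jX J (inl i)). Proof. by apply: gf_gen; right; exists i. Qed.
Lemma base_fun_opp f : @base_fun R J f -> base_fun (- f).
Proof.
move=> h; rewrite -mulN1r; apply: gf_mul => //.
by rewrite -(rmorphN1 c); apply: base_fun_const.
Qed.
Lemma base_fun_D s f : base_fun f -> base_fun (Dt s f).
Proof.
apply: gfield_der; first exact: jD_deriv.
- by apply: base_fun_opp; apply: (base_fun_nat 1).
- by move=> g hg; apply: gf_gen.
- move=> _ [[r ->]|[i ->]]; first by rewrite jD_const; apply: (base_fun_nat 0).
  by rewrite jD_base; apply: base_fun_nat.
Qed.

Lemma jPhi_base t : base_fun (jPhi t).
Proof.
elim/ord3_ind: t; rewrite ?jPhi1 ?jPhi2 ?jPhi3;
  repeat (apply: gf_add || apply: gf_mul || apply: base_fun_opp || apply: base_fun_const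
   || apply: base_fun_var || (apply: gf_inv; apply: (base_fun_nat 2))).
Qed.

Lemma frame_base s t : base_fun (pulled_frame jPhi s t).
Proof.
have [|_ ->] := @unit3 _ (jacobian jPhi); first by rewrite jac_det3 expf_neq0 // dA_neq0.
rewrite jac_det3 /minor3 !mxE expr2.
by repeat (apply: gf_add || apply: gf_inv || apply: gf_mul || apply: base_fun_opp
  || apply: base_fun_D || apply: jPhi_base || apply: base_fun_const).
Qed.

Lemma prol_var_indep p : peval c (pulled_var jPhi) p = 0 -> p = 0.
Proof. exact: (pulled_var_indep jac_unit jPhi_base frame_base). Qed.

Section Prol.
Context (sg : {rmorphism F -> F}).
Hypothesis sg_const : forall r, sg (c r) = c r.
Hypothesis sg_var : forall v, sg (jX J v) = pulled_var jPhi v.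

Lemma pull_u : sg u = u. Proof. by rewrite sg_var. Qed.

Lemma total_u s : Dt s u = Dt s (jPhi d1) * sg (Dt d1 u) + Dt s (jPhi d2) * sg (Dt d2 u)
  + Dt s (jPhi d3) * sg (Dt d3 u).
Proof.
by rewrite -{1}pull_u (total_pull jac_unit sg_const sg_var) sumI3.
Qed.

(** By pull_frame_der this amounts to nine identities, the pull-back of
    nabla_j x_t being nabla_j of the t-th component of Phi_A. *)
Lemma pull_jN j f : sg (jN j f) = jN j (sg f).
Proof.
rewrite !jNE; apply: (pull_frame_der jac_unit sg_const sg_var) => t.
have sx : sg x = a * x + b * y by rewrite sg_var.
have sy : sg y = a' * x + b' * y by rewrite sg_var.
have sz : sg z = dA * (z - x * y / 2) + (a * x + b * y) * (a' * x + b' * y) / 2.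
  by rewrite sg_var.
have s2 : sg 2 = 2 by rewrite rmorph_nat.
have sw : sg w = (a * x + b * y) * (a' * x + b' * y)
   - 2 * (dA * (z - x * y / 2) + (a * x + b * y) * (a' * x + b' * y) / 2).
  by rewrite rmorphB !rmorphM sx sy sz s2.
have e1 := total_u d1; have e2 := total_u d2; have e3 := total_u d3.
have [[q11 q21 q31] [q12 q22 q32] [q13 q23 q33]] := D_jPhi_values.
rewrite ?(q11, q12, q13) in e1; rewrite ?(q21, q22, q23) in e2.
rewrite ?(q31, q32, q33) !mul0r !add0r in e3.
transitivity (jN j (jPhi t)); first by rewrite jNE.
rewrite mxE; elim/ord3_ind: j; elim/ord3_ind: t; rewrite ?jN1 ?jN2 ?jN3
  ?(q11, q12, q13, q21, q22, q23, q31, q32, q33) !Db /=.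
- by rewrite !(mulr1, mulr0, addr0) sx; ring.
- by rewrite !(mulr1, mulr0, addr0, add0r) sy; ring.
- rewrite !(mulr1, mulr0, addr0, add0r) rmorphM sz s2 dAE.
  exact: contact_N1.
- by rewrite !mulr0 rmorph0.
- by rewrite !mulr0 rmorph0.
- rewrite mulr1 sw dAE; exact: contact_w.
- rewrite !(mulr1, mulr0, addr0, add0r) rmorphM rmorphD rmorphM sx sw dAE.
  by rewrite dAE in e1 e2 e3; exact: (@contact_N3x F x y z a b a' b' _ _ _ _ _ _ two_neq0 e1 e2 e3).
- rewrite !(mulr1, mulr0, addr0, add0r) rmorphM rmorphN sw dAE.
  by rewrite dAE in e1 e2 e3; exact: (@contact_N3y F x y z a b a' b' _ _ _ _ _ _ two_neq0 e1 e2 e3).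
- rewrite !(mulr1, mulr0, addr0, add0r) !rmorphM rmorphN sx sw dAE.
  by rewrite dAE in e1 e2 e3; exact: (@contact_N3z F x y z a b a' b' _ _ _ _ _ _ two_neq0 e1 e2 e3).
Qed.

End Prol.
End Phi.
End Group.

(** * Polynomial functions of a 2 x 2 matrix *)

Section PolyFun.
Context (F : fieldType).
(** The arguments substitute matrices in polynomial functions and never look at
    their coefficients, except through K: hence this inductive description. *)
Inductive pfun (K : F -> Prop) : ('M[F]_2 -> F) -> Prop :=
| pf_const k of K k : pfun K (fun _ => k)
| pf_entry i j : pfun K (fun M => M i j)
| pf_add p q of pfun K p & pfun K q : pfun K (fun M => p M + q M)
| pf_mul p q of pfun K p & pfun K q : pfun K (fun M => p M * q M).

Lemma pfun_sub (K K' : F -> Prop) p : (forall k, K k -> K' k) -> pfun K p -> pfun K' p.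
Proof.
move=> KK; elim=> [k /KK|i j|q r _ hq _ hr|q r _ hq _ hr].
- exact: pf_const.
- exact: pf_entry.
- exact: pf_add.
- exact: pf_mul.
Qed.

Lemma pfun_line K p (L : F -> 'M[F]_2) : pfun K p ->
  (forall i j, exists q : {poly F}, forall t, L t i j = q.[t]) ->
  exists q : {poly F}, forall t, p (L t) = q.[t].
Proof.
move=> hp hL; elim: hp => [k _|i j|r s _ [q1 h1] _ [q2 h2]|r s _ [q1 h1] _ [q2 h2]].
- by exists k%:P => t; rewrite hornerC.
- exact: hL.
- by exists (q1 + q2) => t; rewrite hornerD h1 h2.
- by exists (q1 * q2) => t; rewrite hornerM h1 h2.
Qed.

Lemma pfun_mulr K p (M : 'M[F]_2) : (forall i j, K (M i j)) -> pfun K p ->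
  K 0 -> pfun K (fun A => p (A *m M)).
Proof.
move=> hM hp K0; elim: hp => [k Kk|i j|q r _ hq _ hr|q r _ hq _ hr].
- exact: pf_const.
- have -> : (fun A : 'M_2 => (A *m M) i j) = (fun A => A i 0 * M 0 j + A i 1 * M 1 j).
    apply/funext => A; rewrite mxE !big_ord_recl big_ord0 addr0.
    by congr (A _ _ * M _ _ + A _ _ * M _ _); apply: val_inj.
  by apply: pf_add; apply: pf_mul; (exact: pf_entry || exact: pf_const).
- exact: pf_add.
- exact: pf_mul.
Qed.

Context (R : numFieldType) (c : {rmorphism R -> F}).

Lemma poly_zero (q : {poly F}) : (forall r, q.[c r] = 0) -> q = 0.
Proof.
move=> h; apply/eqP; apply: contraT => q0.
have := @max_poly_roots _ q [seq c n%:R | n <- iota 0 (size q)] q0.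
rewrite size_map size_iota ltnn => -> //.
  by apply/allP => _ /mapP[n _ ->]; rewrite /root h.
rewrite map_inj_uniq ?iota_uniq // => m n /fmorph_inj /eqP.
by rewrite eqr_nat => /eqP.
Qed.

Definition mx4 (a b d e : F) : 'M[F]_2 :=
  \matrix_(i, j) if i == 0 then (if j == 0 then a else b) else (if j == 0 then d else e).

Lemma pfun_line_zero K p (L : F -> 'M[F]_2) : pfun K p ->
  (forall i j, exists q : {poly F}, forall t, L t i j = q.[t]) ->
  (forall r, p (L (c r)) = 0) -> forall t, p (L t) = 0.
Proof.
move=> hp hL h t; have [q hq] := pfun_line hp hL.
by rewrite hq (@poly_zero q) ?horner0 // => r; rewrite -hq h.
Qed.

(** The entries are freed one at a time: in each of them the function is a
    polynomial of one variable that vanishes on the infinite field R. *)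
Lemma pfun_zero K p : pfun K p -> (forall B : 'M[R]_2, p (map_mx c B) = 0) ->
  forall M, p M = 0.
Proof.
move=> hp h0 M.
have mxc a b d e : exists B : 'M[R]_2, mx4 (c a) (c b) (c d) (c e) = map_mx c B.
  exists (\matrix_(i, j) if i == 0 then (if j == 0 then a else b)
                         else (if j == 0 then d else e)).
  by apply/matrixP => i j; rewrite !mxE; do 2![case: eqP].
have lin (L : F -> 'M[F]_2) : (L = (fun t => mx4 t (L 0 0 1) (L 0 1 0) (L 0 1 1)) \/
    L = (fun t => mx4 (L 0 0 0) t (L 0 1 0) (L 0 1 1)) \/
    L = (fun t => mx4 (L 0 0 0) (L 0 0 1) t (L 0 1 1)) \/
    L = (fun t => mx4 (L 0 0 0) (L 0 0 1) (L 0 1 0) t)) ->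
    forall i j, exists q : {poly F}, forall t, L t i j = q.[t].
  move=> hL i j.
  have cst k : exists q : {poly F}, forall t : F, k = q.[t].
    by exists k%:P => t; rewrite hornerC.
  have var : exists q : {poly F}, forall t : F, t = q.[t].
    by exists 'X => t; rewrite hornerX.
  by case: hL => [->|[->|[->|->]]]; rewrite /mx4;
    (under eq_exists => q do under eq_forall => t do rewrite mxE);
    case: eqP => _; case: eqP => _.
have s1 a b d e : p (mx4 a (c b) (c d) (c e)) = 0.
  apply: (pfun_line_zero (L := fun t => mx4 t (c b) (c d) (c e)) hp) => [|r].
    by apply: lin; left; apply/funext => t; rewrite !mxE.
  by have [B ->] := mxc r b d e.
have s2 a b d e : p (mx4 a b (c d) (c e)) = 0.
  apply: (pfun_line_zero (L := fun t => mx4 a t (c d) (c e)) hp) => [|r]; last exact: s1.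
  by apply: lin; right; left; apply/funext => t; rewrite !mxE.
have s3 a b d e : p (mx4 a b d (c e)) = 0.
  apply: (pfun_line_zero (L := fun t => mx4 a b t (c e)) hp) => [|r]; last exact: s2.
  by apply: lin; do 2!right; left; apply/funext => t; rewrite !mxE.
have s4 a b d e : p (mx4 a b d e) = 0.
  apply: (pfun_line_zero (L := fun t => mx4 a b d t) hp) => [|r]; last exact: s3.
  by apply: lin; do 3!right; apply/funext => t; rewrite !mxE.
have -> : M = mx4 (M 0 0) (M 0 1) (M 1 0) (M 1 1); last exact: s4.
apply/matrixP => i j; rewrite mxE.
have two k : k = 0 \/ k = 1 :> 'I_2.
  by case: k => [[|[|//]] lt]; [left|right]; apply: val_inj.
by case: (two i) => ->; case: (two j) => ->.
Qed.
End PolyFun.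

(** * Generation of the invariants *)

Section RatioOf.
Context (P : comNzRingType) (F : fieldType) (ev : {rmorphism P -> F}).

Definition ratio_of (f : F) : Prop := exists p q, ev q != 0 /\ f = ev p / ev q.

Lemma ratio_of_ev p : ratio_of (ev p).
Proof. by exists p, 1; rewrite rmorph1 oner_eq0 divr1. Qed.

Lemma gfield_ratio_of f : gfield ratio_of f -> ratio_of f.
Proof.
elim=> [//|a b _ [p [q [q0 ->]]] _ [p' [q' [q0' ->]]]|
        a b _ [p [q [q0 ->]]] _ [p' [q' [q0' ->]]]|a _ [p [q [q0 ->]]]].
- exists (p * q' + p' * q), (q * q'); rewrite rmorphD !rmorphM mulf_neq0 //.
  by split=> //; rewrite addf_div.
- exists (p * p'), (q * q'); rewrite !rmorphM mulf_neq0 //.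
  by split=> //; rewrite mulf_div.
have [p0|p0] := eqVneq (ev p) 0.
  by exists 0, 1; rewrite p0 mul0r invr0 rmorph0 rmorph1 oner_eq0 mul0r.
by exists q, p; rewrite invf_div.
Qed.

Lemma ratio_of_der (D : F -> F) (d : P -> P) f : deriv_along idfun D ->
  (forall p, ev (d p) = D (ev p)) -> ratio_of f -> ratio_of (D f).
Proof.
move=> dD evd [p [q [q0 ->]]]; apply: gfield_ratio_of.
rewrite (der_mul (g := idfun) dD) (der_inv (g := idfun) dD) /= expr2 -mulN1r.
rewrite -(rmorphN1 ev) -!evd.
by repeat (apply: gf_add || apply: gf_mul || apply: gf_inv
  || (apply: gf_gen; exact: ratio_of_ev)).
Qed.
End RatioOf.

Section Generation.
Context (R : numFieldType) (J : jet_field R).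
Local Notation F := (jf J).
Local Notation c := (jc J).
Local Notation Dt := (@jD R J).
Local Notation x := (jX J (inl d1)).
Local Notation y := (jX J (inl d2)).
Local Notation z := (jX J (inl d3)).
Local Notation u := (jX J (inr (0, 0, 0)%N)).
Local Notation w := (x * y - 2 * z).
Local Notation N := (@jN R J).
Local Notation S := (@jS R J).

Definition jgenerator (b : bool) : F := if b then jI2f J else u.
Definition jword (v : bool * seq 'I_3) : F :=
  foldr (fun j f => N j f) (jgenerator v.1) v.2.
Definition jev : {rmorphism formal R bool 3 -> F} := peval_morph c jword.

Lemma fnabla_deriv j : deriv_along idfun (@fnabla R bool 3 j).
Proof. exact: pder_deriv. Qed.

Lemma jev_var v : jev (pvar R v) = jword v.
Proof. exact: (peval_var c jword). Qed.
Lemma jev_const a : jev (malgC a) = c a.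
Proof. exact: (peval_const c jword). Qed.

Lemma jN_const j a : N j (c a) = 0.
Proof. by rewrite jNE /frame_der big1 // => s _; rewrite jD_const mulr0. Qed.

Lemma fnabla_var j v : fnabla j (pvar R v : formal R bool 3) = pvar R (v.1, j :: v.2).
Proof. exact: pder_var. Qed.
Lemma fnabla_const j a : fnabla j (malgC a : formal R bool 3) = 0.
Proof. exact: pder_const. Qed.

Lemma jev_nabla j P : jev (fnabla j P) = N j (jev P).
Proof.
have h1 := deriv_along_post jev (fnabla_deriv j).
have h2 := deriv_along_pre jev (jN_deriv J j).
apply: (deriv_along_vpoly_ext (g := jev) h1 h2) => [a|v].
  by rewrite /= fnabla_const jev_const rmorph0 jN_const.
have a1 := congr1 jev (fnabla_var j v).
have a2 := jev_var (v.1, j :: v.2).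
have a3 := congr1 (N j) (jev_var v).
have a4 : jword (v.1, j :: v.2) = N j (jword v) by [].
exact (etrans a1 (etrans a2 (etrans a4 (esym a3)))).
Qed.

Definition ratio_inv : F -> Prop := ratio_of jev.

Lemma ratio_ev P : ratio_inv (jev P). Proof. exact: ratio_of_ev. Qed.
Lemma gfield_ratio f : gfield ratio_inv f -> ratio_inv f. Proof. exact: gfield_ratio_of. Qed.
Lemma ratio_const a : ratio_inv (c a).
Proof. by rewrite -jev_const; apply: ratio_ev. Qed.
Lemma ratio_nat n : ratio_inv n%:R.
Proof. by rewrite -(rmorph_nat c); apply: ratio_const. Qed.
Lemma ratio_N1 : ratio_inv (-1).
Proof. by rewrite -(rmorphN1 c); apply: ratio_const. Qed.
Lemma ratio_N j f : ratio_inv f -> ratio_inv (N j f).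
Proof. exact: (ratio_of_der (jN_deriv J j) (jev_nabla j)). Qed.

Lemma ratio_u : ratio_inv u.
Proof. by have := ratio_ev (pvar R (false, [::])); rewrite jev_var. Qed.
Lemma ratio_I2f : ratio_inv (jI2f J).
Proof. by have := ratio_ev (pvar R (true, [::])); rewrite jev_var. Qed.

Lemma jS_N : S = N d1 u + N d2 u. Proof. by []. Qed.

Lemma ratio_S : ratio_inv S.
Proof.
by rewrite jS_N; apply: gfield_ratio; apply: gf_add; apply: gf_gen;
  apply: ratio_N; apply: ratio_u.
Qed.

(** The columns are (x, y) and its derivative along nabla_3. The first is moved
    linearly by the group, hence so is the second, nabla_3 being invariant. *)
Definition frame_mx : 'M[F]_2 :=
  \matrix_(i, j) (if j == 0 then id else N d3) (if i == 0 then x else y).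

Definition frame_gen (f : F) : Prop := ratio_inv f \/ exists i j, f = frame_mx i j.
Local Notation K := (gfield frame_gen).

Lemma frame_field_ratio f : ratio_inv f -> K f. Proof. by move=> h; apply: gf_gen; left. Qed.
Lemma frame_field_frame i j : K (frame_mx i j). Proof. by apply: gf_gen; right; exists i, j. Qed.
Lemma frame_field_x : K x. Proof. by have := frame_field_frame 0 0; rewrite mxE. Qed.
Lemma frame_field_y : K y. Proof. by have := frame_field_frame 1 0; rewrite mxE. Qed.
Lemma frame_field_N3x : K (N d3 x). Proof. by have := frame_field_frame 0 1; rewrite mxE. Qed.
Lemma frame_field_N3y : K (N d3 y). Proof. by have := frame_field_frame 1 1; rewrite mxE. Qed.
Lemma frame_field_opp f : K f -> K (- f).
Proof. by move=> h; rewrite -mulN1r; apply: gf_mul => //; apply: frame_field_ratio ratio_N1. Qed.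

Ltac frame_field_step :=
  lazymatch goal with
  | |- gfield _ (_ + _) => apply: gf_add
  | |- gfield _ (_ * _) => apply: gf_mul
  | |- gfield _ (- _) => apply: frame_field_opp
  | |- gfield _ (_^-1) => apply: gf_inv
  | |- gfield _ _ => first
     [ assumption | exact: frame_field_x | exact: frame_field_y | exact: frame_field_N3x | exact: frame_field_N3y
     | exact: frame_field_ratio ratio_S | exact: frame_field_ratio ratio_I2f | exact: frame_field_ratio (ratio_nat 2)
     | exact: frame_field_ratio (ratio_N _ ratio_S) | exact: frame_field_ratio (ratio_N _ (ratio_N _ ratio_u))
     | exact: frame_field_ratio (ratio_N _ ratio_u) ]
  end.

Lemma frame_field_N1N3 t : N d1 t = t -> N d2 t = 0 -> K t -> K (N d3 t) -> K (N d1 (N d3 t)).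
Proof.
move=> t1 t2 Kt K3.
have := jsyz (Syz3 _ _ _ t : syzygy N u (jI2f J) _).
rewrite /R3 /commutator t1 t2 -jS_N => e.
have -> : N d1 (N d3 t) = N d3 t + S^-1 * (- (N d3 (N d1 u) * t)
    + (N d1 (N d1 u) + N d1 (N d2 u)) * N d3 t).
  apply: (mulfI (jS_neq0 J)); apply/eqP; rewrite -subr_eq0; apply/eqP.
  by rewrite -[RHS]e; field; apply: jS_neq0.
by repeat frame_field_step.
Qed.

Lemma frame_field_N2N3 t : N d1 t = t -> N d2 t = 0 -> K t -> K (N d3 t) -> K (N d2 (N d3 t)).
Proof.
move=> t1 t2 Kt K3.
have := jsyz (Syz4 _ _ _ t : syzygy N u (jI2f J) _).
rewrite /R4 /commutator t1 t2 -jS_N (der0 (jN_deriv J d3)) => e.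
have -> : N d2 (N d3 t) = S^-1 * ((N d2 u * S - N d3 (N d2 u)) * t
    + (N d1 (N d2 u) + N d2 (N d2 u) - 2 * S) * N d3 t).
  apply: (mulfI (jS_neq0 J)); apply/eqP; rewrite -subr_eq0; apply/eqP.
  by rewrite -[RHS]e; field; apply: jS_neq0.
by repeat frame_field_step.
Qed.

Lemma frame_field_N3N3 t : t = x \/ t = y -> K t -> K (N d3 t) -> K (N d3 (N d3 t)).
Proof.
move=> ht Kt K3; have e := jframe_N3 ht.
have -> : N d3 (N d3 t) = S^-1 * (- jI2f J * t + (S ^+ 2 + N d3 S) * N d3 t).
  by rewrite -e mulKf // jS_neq0.
rewrite expr2; by repeat frame_field_step.
Qed.

(** The derivatives of the frame are combinations of the frame with invariant
    coefficients: along nabla_1 and nabla_2 by R_3 and R_4 evaluated at x and y,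
    along nabla_3 by jframe_N3. *)
Lemma frame_field_N j f : K f -> K (N j f).
Proof.
have [x1 [y1 [x2 y2]]] := jframe_N12 J.
apply: gfield_der; first exact: jN_deriv.
- exact: frame_field_ratio ratio_N1.
- by move=> a; apply: gf_gen.
move=> a [/(ratio_N j) h|[i [k ->]]]; first exact: frame_field_ratio.
rewrite mxE; case: (i == 0); case: (k == 0); elim/ord3_ind: j => /=;
  rewrite ?x1 ?x2 ?y1 ?y2; do ?[exact: frame_field_x|exact: frame_field_y|exact: frame_field_N3x|exact: frame_field_N3y
   |exact: frame_field_ratio (ratio_nat 0)].
- exact: frame_field_N1N3 x1 x2 frame_field_x frame_field_N3x.
- exact: frame_field_N2N3 x1 x2 frame_field_x frame_field_N3x.
- exact: frame_field_N3N3 (or_introl erefl) frame_field_x frame_field_N3x.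
- exact: frame_field_N1N3 y1 y2 frame_field_y frame_field_N3y.
- exact: frame_field_N2N3 y1 y2 frame_field_y frame_field_N3y.
- exact: frame_field_N3N3 (or_intror erefl) frame_field_y frame_field_N3y.
Qed.

(** w S is the determinant of the frame, up to sign. *)
Lemma frame_field_w : K w.
Proof.
have := frame_det u (jDxb J) (jDyb J) (jDzb J) => e.
have -> : w = - ((x * N d3 y - y * N d3 x) / S).
  by rewrite [X in X / _](e : x * N d3 y - y * N d3 x = - (w * S)) mulNr opprK mulfK // jS_neq0.
by repeat frame_field_step.
Qed.

Lemma frame_field_base i : K (jX J (inl i)).
Proof.
elim/ord3_ind: i; [exact: frame_field_x|exact: frame_field_y|].
have two0 : 2 != 0 :> F := nat_neq0 J 1.
have -> : z = (x * y - w) / 2 by field.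
by repeat (exact: frame_field_w || frame_field_step).
Qed.

Lemma frame_field_nabla_mx i j : K (nabla_mx J i j).
Proof. by rewrite mxE; apply: frame_field_N; apply: frame_field_base. Qed.

Lemma det3_nabla_mx_neq0 : det3 (nabla_mx J) != 0.
Proof. exact: det3_nabla_neq0. Qed.

Lemma frame_field_D s f : K f -> K (Dt s f).
Proof.
move=> Kf; have U := nabla_mx_unit J.
have -> : Dt s f = \sum_j invmx (nabla_mx J) s j * N j f.
  transitivity (\sum_j \sum_t invmx (nabla_mx J) s j * nabla_mx J j t * Dt t f).
    have NE t : \sum_j invmx (nabla_mx J) s j * nabla_mx J j t = (s == t)%:R.
      by have := mulVmx U => /matrixP/(_ s t); rewrite !mxE.
    rewrite exchange_big /= (bigD1 s) //= -mulr_suml NE eqxx mul1r.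
    by rewrite big1 ?addr0 // => t ts; rewrite -mulr_suml NE eq_sym (negPf ts) mul0r.
  apply: eq_bigr => j _; rewrite jNE /frame_der mulr_sumr.
  by apply: eq_bigr => t _; rewrite mulrA.
apply: gf_sum => [|j]; first exact: frame_field_ratio (ratio_nat 0).
apply: gf_mul; last exact: frame_field_N.
have [_ ->] := unit3 det3_nabla_mx_neq0.
rewrite /det3 /minor3 sumI3.
by repeat (exact: frame_field_nabla_mx || frame_field_step).
Qed.

Lemma frame_field_jet (a : multidx) : K (jX J (inr a)).
Proof.
have inc s (b : multidx) : K (jX J (inr b)) -> K (jX J (inr (incr_mi s b))).
  by case: b => [[i j] k] h; rewrite -[inr _]/(inr _) -jD_jet; apply: frame_field_D.
case: a => [[i j] k]; elim: i => [|i IH]; last first.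
  by have := inc d1 _ IH; rewrite /incr_mi /= addn1 !addn0.
elim: j => [|j IH]; last by have := inc d2 _ IH; rewrite /incr_mi /= addn1 !addn0.
elim: k => [|k IH]; last by have := inc d3 _ IH; rewrite /incr_mi /= addn1 !addn0.
exact: frame_field_ratio ratio_u.
Qed.

(** The total derivatives are combinations of the nabla_j with coefficients in
    the field generated by the invariants and the frame. That field is therefore
    stable under them; it contains the base coordinates and u, hence every jet. *)
Lemma frame_field_all f : K f.
Proof.
apply: (@jf_gen R J) f => [a|[i|a]].
- exact: frame_field_ratio (ratio_const a).
- exact: frame_field_base.
- exact: frame_field_jet.
Qed.

Lemma frame_mx_det : \det frame_mx != 0.
Proof.
rewrite det2 !mxE /= mulrC [X in _ - X]mulrC -[_ * _]mulrC.
rewrite (_ : _ - _ = x * N d3 y - y * N d3 x); first exact: frame_det_neq0.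
by ring.
Qed.

Lemma ratio_of_frame f : exists n d, [/\ pfun ratio_inv n, pfun ratio_inv d,
  d frame_mx != 0 & f = n frame_mx / d frame_mx].
Proof.
elim: {f} (frame_field_all f) => [f [h|[i [j ->]]]|a b _ [n [d [hn hd d0 ->]]] _ [n' [d' [hn' hd' d0' ->]]]|
  a b _ [n [d [hn hd d0 ->]]] _ [n' [d' [hn' hd' d0' ->]]]|a _ [n [d [hn hd d0 ->]]]].
- exists (fun _ => f), (fun _ => 1); split; try exact: pf_const.
  + by apply: pf_const; apply: (ratio_nat 1).
  + exact: oner_neq0.
  + by rewrite divr1.
- exists (fun M => M i j), (fun _ => 1); split; first exact: pf_entry.
  + by apply: pf_const; apply: (ratio_nat 1).
  + exact: oner_neq0.
  + by rewrite divr1.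
- exists (fun M => n M * d' M + n' M * d M), (fun M => d M * d' M); split.
  + by apply: pf_add; apply: pf_mul.
  + exact: pf_mul.
  + exact: mulf_neq0.
  + by rewrite addf_div.
- exists (fun M => n M * n' M), (fun M => d M * d' M); split; try exact: pf_mul.
  + exact: mulf_neq0.
  + by rewrite mulf_div.
have [n0|n0] := eqVneq (n frame_mx) 0; last by exists d, n; rewrite invf_div.
exists (fun _ => 0), (fun _ => 1); split.
- by apply: pf_const; apply: (ratio_nat 0).
- by apply: pf_const; apply: (ratio_nat 1).
- exact: oner_neq0.
- by rewrite n0 !mul0r invr0.
Qed.

Lemma ratio_pfun_const p (B : 'M[R]_2) : pfun ratio_inv p -> ratio_inv (p (map_mx c B)).
Proof.
move=> hp; apply: gfield_ratio; elim: hp => [k hk|i j|q r _ hq _ hr|q r _ hq _ hr].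
- exact: gf_gen.
- by rewrite mxE; apply: gf_gen; apply: ratio_const.
- exact: gf_add.
- exact: gf_mul.
Qed.

Context (sg : forall A : 'M[R]_2, {rmorphism F -> F}).
Hypothesis sg_const : forall A r, A \in unitmx -> sg A (c r) = c r.
Hypothesis sg_var : forall A v, A \in unitmx -> sg A (jX J v) = pulled_var (jPhi J A) v.

Section OneA.
Context (A : 'M[R]_2).
Hypothesis A_unit : A \in unitmx.
Let sc r : sg A (c r) = c r. Proof. exact: sg_const. Qed.
Let sv v : sg A (jX J v) = pulled_var (jPhi J A) v. Proof. exact: sg_var. Qed.
Let sN j f : sg A (N j f) = N j (sg A f). Proof. exact: (pull_jN A_unit sc sv). Qed.
Let su : sg A u = u. Proof. by rewrite sv. Qed.

(** The relation jframe_N3 holds for x and y, hence for the linear combination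
    x' of them that is the pull-back of x. Comparing it with the pull-back of the
    relation for x gives the invariance of the coefficient of x'. *)
Lemma pull_I2f : sg A (jI2f J) = jI2f J.
Proof.
have e := jframe_N3 (or_introl (erefl x)).
have ey := jframe_N3 (or_intror (erefl y)).
have sS : sg A S = S by rewrite jS_N rmorphD !sN su.
have e' : sg A S * sg A (N d3 (N d3 x)) = - sg A (jI2f J) * sg A x
    + (sg A S ^+ 2 + sg A (N d3 S)) * sg A (N d3 x).
  by rewrite -rmorphXn -rmorphN -(rmorphD _ (S ^+ 2)) -!rmorphM -rmorphD e.
rewrite !sN sS in e'; set x' := sg A x in e'.
have x'E : x' = c (A 0 0) * x + c (A 0 1) * y by rewrite /x' sv.
have x'0 : x' != 0 by rewrite fmorph_eq0 x_neq0.
have N3x' : N d3 x' = c (A 0 0) * N d3 x + c (A 0 1) * N d3 y.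
  have dN := jN_deriv J d3.
  by rewrite x'E (der_add dN) !(der_mul (g := idfun) dN) !jN_const !mul0r !add0r.
have N33x' : N d3 (N d3 x') = c (A 0 0) * N d3 (N d3 x) + c (A 0 1) * N d3 (N d3 y).
  have dN := jN_deriv J d3.
  by rewrite N3x' (der_add dN) !(der_mul (g := idfun) dN) !jN_const !mul0r !add0r.
apply: (mulIf x'0); apply: oppr_inj; rewrite -[LHS]mulNr -[RHS]mulNr.
apply: (addIr ((S ^+ 2 + N d3 S) * N d3 x')); rewrite -e' N33x' N3x' x'E.
transitivity (c (A 0 0) * (S * N d3 (N d3 x)) + c (A 0 1) * (S * N d3 (N d3 y))).
  by ring.
by rewrite e ey; ring.
Qed.

Lemma pull_ev P : sg A (jev P) = jev P.
Proof.
apply: (vpoly_morph_ext (g := sg A \o jev) (g' := jev)) => [a|[b s]] /=.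
  by rewrite !jev_const sc.
rewrite !jev_var /jword /=; elim: s => [|j s IH] /=; last by rewrite sN IH.
by case: b => /=; [apply: pull_I2f|].
Qed.

Lemma pull_ratio f : ratio_inv f -> sg A f = f.
Proof. by move=> [P [Q [_ ->]]]; rewrite fmorph_div !pull_ev. Qed.

Lemma pull_frame_mx : map_mx (sg A) frame_mx = map_mx c A *m frame_mx.
Proof.
have dN := jN_deriv J d3.
have ex : sg A x = c (A 0 0) * x + c (A 0 1) * y by rewrite sv.
have ey : sg A y = c (A 1 0) * x + c (A 1 1) * y by rewrite sv.
apply/matrixP => i j; rewrite !mxE !big_ord_recl big_ord0 addr0 !mxE /=.
have two (k : 'I_2) : k = 0 \/ k = 1.
  by case: k => [[|[|//]] lt]; [left|right]; apply: val_inj.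
have -> : lift ord0 ord0 = 1 :> 'I_2 by apply: val_inj.
have -> : ord0 = 0 :> 'I_2 by apply: val_inj.
case: (two i) => ->; case: (two j) => -> /=; rewrite ?sN ?ex ?ey //.
  by rewrite (der_add dN) !(der_mul (g := idfun) dN) !jN_const !mul0r !add0r.
by rewrite (der_add dN) !(der_mul (g := idfun) dN) !jN_const !mul0r !add0r.
Qed.

Lemma pull_pfun p M : pfun ratio_inv p -> sg A (p M) = p (map_mx (sg A) M).
Proof.
elim=> [k /pull_ratio //|i j|q r _ hq _ hr|q r _ hq _ hr].
- by rewrite mxE.
- by rewrite rmorphD hq hr.
- by rewrite rmorphM hq hr.
Qed.
End OneA.

(** Write f = n(M) / d(M) with M the frame and n, d polynomial with coefficients
    generated by I_0 and I_2f. Invariance gives n(A M) d(M) = n(M) d(A M) for all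
    real A, thus for A with entries in the field. With A = B M^-1 and B real this
    reads f = n(B) / d(B). *)
Theorem invariant_ratio f : (forall A, A \in unitmx -> sg A f = f) -> ratio_inv f.
Proof.
move=> inv; have [n [d [hn hd d0 fE]]] := ratio_of_frame f.
set M := frame_mx in d0 fE.
pose dt (B : 'M[F]_2) := B 0 0 * B 1 1 + (-1) * (B 0 1 * B 1 0).
have dtE B : dt B = \det B by rewrite det2 /dt mulN1r.
have Kdt (K0 : F -> Prop) : K0 (-1) -> pfun K0 dt.
  by move=> h; do ![apply: pf_add|apply: pf_mul|apply: pf_const|apply: pf_entry].
(* the factor dt B makes h vanish on singular real matrices too *)
pose h (B : 'M[F]_2) := dt B * (n (B *m M) * d M + (-1) * (n M * d (B *m M))).
have hh : pfun (fun _ => True) h.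
  have T p : pfun ratio_inv p -> pfun (fun _ => True) p by apply: pfun_sub.
  apply: pf_mul; first exact: Kdt.
  have hn' := pfun_mulr (M := M) (fun _ _ => I) (T _ hn) I.
  have hd' := pfun_mulr (M := M) (fun _ _ => I) (T _ hd) I.
  by repeat (exact: hn' || exact: hd' || apply: pf_add || apply: pf_mul || (apply: pf_const)).
have h0 B : h B = 0.
  apply: (pfun_zero (c := c) hh) => {}B; rewrite /h dtE det_map_mx.
  have [B0|B0] := boolP (B \in unitmx); last first.
    move: B0; rewrite unitmxE unitfE negbK => /eqP ->.
    by rewrite rmorph0 mul0r.
  have := inv B B0; rewrite fE fmorph_div !(pull_pfun B0) // pull_frame_mx //.
  move=> /eqP; rewrite eqr_div //; last first.
    by rewrite -pull_frame_mx // -(pull_pfun B0) // fmorph_eq0.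
  by move=> /eqP e; rewrite e mulN1r addrC addNr mulr0.
(* otherwise dt * d would vanish on all matrices, and it does not at M *)
have [B hB] : exists B : 'M[R]_2, dt (map_mx c B) * d (map_mx c B) != 0.
  apply: contrapT => no.
  have : dt M * d M = 0.
    apply: (pfun_zero (c := c) (p := fun M => dt M * d M)
      (pf_mul (Kdt _ ratio_N1) hd)) => B.
    by apply/eqP; apply: contrapT => /negP hB; apply: no; exists B.
  by move/eqP; rewrite mulf_eq0 dtE (negPf frame_mx_det) (negPf d0).
move: hB; rewrite mulf_eq0 negb_or => /andP[B0 dB0].
have Mu : M \in unitmx by rewrite unitmxE unitfE frame_mx_det.
pose C := map_mx c B *m invmx M.
have CM : C *m M = map_mx c B by rewrite /C -mulmxA mulVmx // mulmx1.
have : dt C != 0.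
  have : \det C * \det M != 0 by rewrite -det_mulmx CM -dtE.
  by rewrite dtE mulf_eq0 negb_or => /andP[].
have := h0 C; rewrite /h CM => /eqP; rewrite mulf_eq0 => /orP[->//|/eqP e] _.
have -> : f = n (map_mx c B) / d (map_mx c B).
  rewrite fE; apply/eqP; rewrite eqr_div // eq_sym -subr_eq0 -mulN1r.
  by rewrite [X in _ + _ * X]mulrC -[X in _ + X]mulrC in e *; apply/eqP; rewrite -e; ring.
by apply: gfield_ratio; apply: gf_mul; [|apply: gf_inv]; apply: gf_gen; apply: ratio_pfun_const.
Qed.
End Generation.

(** * Normal forms modulo the syzygies *)

Section Reduction.
Context (T : comNzRingType) (D : 'I_3 -> T -> T) (I0 I2f : T).
Hypothesis dD : forall j, deriv_along idfun (D j).
Local Notation "'N1'" := (D d1).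
Local Notation "'N2'" := (D d2).
Local Notation "'N3'" := (D d3).
Let S := N1 I0 + N2 I0.

Context (Z : T -> Prop).
Hypothesis Z0 : Z 0.
Hypothesis Zadd : forall P Q, Z P -> Z Q -> Z (P + Q).
Hypothesis Zmul : forall Q P, Z P -> Z (Q * P).
Hypothesis Zder : forall j P, Z P -> Z (D j P).
Hypothesis Zsyz : forall P, syzygy D I0 I2f P -> Z P.

Context (C : T -> Prop).
Hypothesis C_nat : forall n, C n%:R.
Hypothesis C_N1 : C (-1).
Hypothesis C_der : forall j a, C a -> D j a = 0.

Let Dadd j a b : D j (a + b) = D j a + D j b. Proof. exact: (dD j).1. Qed.
Let Dmul j a b : D j (a * b) = D j a * b + a * D j b. Proof. exact: (dD j).2. Qed.
Let Dsub j a b : D j (a - b) = D j a - D j b. Proof. exact: (der_sub (dD j)). Qed.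

Lemma Zopp P : Z P -> Z (- P).
Proof. by move=> h; rewrite -mulN1r; apply: Zmul. Qed.
(** Polynomials in the elements of X with coefficients in C, divided by powers
    of S and taken modulo Z. *)
Inductive red (X : T -> Prop) : T -> Prop :=
| rd_gen P of X P : red X P
| rd_const a of C a : red X a
| rd_add P Q of red X P & red X Q : red X (P + Q)
| rd_mul P Q of red X P & red X Q : red X (P * Q)
| rd_cong P Q of Z (Q - P) & red X P : red X Q
| rd_div P of red X (S * P) : red X P.

Lemma rd_opp X P : red X P -> red X (- P).
Proof. by move=> h; rewrite -mulN1r; apply: rd_mul => //; apply: rd_const. Qed.
Lemma rd_sub X P Q : red X P -> red X Q -> red X (P - Q).
Proof. by move=> h1 h2; apply: rd_add => //; apply: rd_opp. Qed.
Lemma rd_nat X n : red X n%:R. Proof. exact: rd_const. Qed.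
Lemma rd_Z X P : Z P -> red X P.
Proof. by move=> h; apply: (@rd_cong _ 0); [rewrite subr0|apply: (rd_nat X 0)]. Qed.

Lemma red_sub (X Y : T -> Prop) P : (forall Q, X Q -> red Y Q) -> red X P -> red Y P.
Proof.
move=> XY; elim=> [Q /XY //|a Ca|Q Q' _ h _ h'|Q Q' _ h _ h'|Q Q' zQ _ h|Q _ h].
- exact: rd_const.
- exact: rd_add.
- exact: rd_mul.
- exact: rd_cong zQ h.
- exact: rd_div.
Qed.

Lemma red_der (X Y : T -> Prop) j P : (forall Q, X Q -> red Y Q) ->
  (forall Q, X Q -> red Y (D j Q)) -> red Y S -> red Y (D j S) ->
  red X P -> red Y (D j P).
Proof.
move=> XY XD YS YDS hP; have : red Y P /\ red Y (D j P); last by case.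
elim: hP => [Q hQ|a Ca|Q Q' _ [h1 h2] _ [h3 h4]|Q Q' _ [h1 h2] _ [h3 h4]|Q Q' zQ _ [h1 h2]
  |Q _ [h1 h2]].
- by split; [apply: XY|apply: XD].
- by split; [apply: rd_const|rewrite (C_der _ Ca); apply: (rd_nat Y 0)].
- by rewrite Dadd; split; apply: rd_add.
- rewrite Dmul; split; first exact: rd_mul.
  by apply: rd_add; apply: rd_mul.
- split; first exact: rd_cong zQ h1.
  by apply: rd_cong h2; rewrite -Dsub; apply: Zder.
- have h3 := rd_div h1; split=> //; apply: rd_div.
  have -> : S * D j Q = D j (S * Q) - D j S * Q by rewrite Dmul addrAC subrr add0r.
  by apply: rd_sub => //; apply: rd_mul.
Qed.

(** On jets nrm a has the symbol xi^a. As N3 I0 vanishes, the elements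
    divisible by xi_3^2 are built on I2f, of symbol xi_3^2, and (0, 0, 1) is
    never used as an index. *)
Definition nrm (a : multidx) : T :=
  match a.2 with
  | 0 => iter a.1.1 N1 (iter a.1.2 N2 I0)
  | 1 => N3 (iter a.1.1 N1 (iter a.1.2 N2 I0))
  | l.+2 => iter l N3 (iter a.1.1 N1 (iter a.1.2 N2 I2f))
  end.

(** nset k consists of the normal derivatives of order at most k, cset k of those
    built on I2f. Applying a derivation to cset k, or N3 to the elements
    nrm (i, j, 1) of nset k, leads to order k + 1, but only through cset k.+1:
    hence wset k. *)
Definition nset (k : nat) (P : T) : Prop :=
  exists a, [/\ (wt a <= k)%N, a != (0, 0, 1)%N & P = nrm a].
Definition cset (k : nat) (P : T) : Prop :=
  exists i j l, (i + j + l.+2 <= k)%N /\ P = nrm (i, j, l.+2).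
Definition wset (k : nat) (P : T) : Prop := nset k P \/ cset k.+1 P.

Lemma nsetW k m P : (k <= m)%N -> nset k P -> nset m P.
Proof. by move=> km [a [h1 h2 h3]]; exists a; split=> //; apply: leq_trans km. Qed.
Lemma cset_nset k P : cset k P -> nset k P.
Proof.
by move=> [i [j [l [h ->]]]]; exists (i, j, l.+2); rewrite !xpair_eqE !andbF.
Qed.

Lemma red_wset k P : red (nset k) P -> red (wset k) P.
Proof. by apply: red_sub => Q h; apply: rd_gen; left. Qed.
Lemma red_wset_nset k P : red (wset k) P -> red (nset k.+1) P.
Proof.
apply: red_sub => Q [h|h]; apply: rd_gen; [exact: nsetW h|exact: cset_nset].
Qed.

Lemma red_nrm k (a : multidx) : (wt a <= k)%N -> a != (0, 0, 1)%N -> red (nset k) (nrm a).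
Proof. by move=> h1 h2; apply: rd_gen; exists a. Qed.

Lemma red_K1 k : (0 < k)%N -> red (nset k) (N1 I0).
Proof. by move=> h; apply: (@red_nrm k (1, 0, 0)%N). Qed.
Lemma red_K2 k : (0 < k)%N -> red (nset k) (N2 I0).
Proof. by move=> h; apply: (@red_nrm k (0, 1, 0)%N). Qed.
Lemma red_S k : (0 < k)%N -> red (nset k) S.
Proof. by move=> h; apply: rd_add; [apply: red_K1|apply: red_K2]. Qed.

Definition second_order (P : T) : Prop :=
  P = N1 (N1 I0) \/ P = N1 (N2 I0) \/ P = N2 (N2 I0) \/
  P = N3 (N1 I0) \/ P = N3 (N2 I0) \/ P = I2f.
Lemma red_2 k P : (1 < k)%N -> second_order P -> red (nset k) P.
Proof.
move=> h [->|[->|[->|[->|[->|->]]]]].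
- exact: (@red_nrm k (2, 0, 0)%N).
- exact: (@red_nrm k (1, 1, 0)%N).
- exact: (@red_nrm k (0, 2, 0)%N).
- exact: (@red_nrm k (1, 0, 1)%N).
- exact: (@red_nrm k (0, 1, 1)%N).
- exact: (@red_nrm k (0, 0, 2)%N).
Qed.

Lemma Z_comm12 f : Z (N2 (N1 f) - N1 (N2 f)).
Proof. by rewrite -opprB; apply: Zopp; apply: (Zsyz (Syz2 _ _ _ f)). Qed.

Lemma red_DS k j : (1 < k)%N -> red (nset k) (D j S).
Proof.
move=> h; have r2 P := @red_2 k P h.
rewrite /S Dadd; elim/ord3_ind: j; apply: rd_add; try (apply: r2; rewrite /second_order; tauto).
apply: rd_cong (Z_comm12 I0) _; apply: r2; rewrite /second_order; tauto.
Qed.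

Lemma Z_iter12 i f : Z (N2 (iter i N1 f) - iter i N1 (N2 f)).
Proof.
elim: i => [|i IH] /=; first by rewrite subrr.
have -> : N2 (N1 (iter i N1 f)) - N1 (iter i N1 (N2 f)) =
    (N2 (N1 (iter i N1 f)) - N1 (N2 (iter i N1 f)))
    + N1 (N2 (iter i N1 f) - iter i N1 (N2 f)).
  by rewrite Dsub addrA addrNK.
by apply: Zadd; [apply: Z_comm12|apply: Zder].
Qed.

(** The coefficients of the commutator of N_r with N3, for r = 1, 2, as
    prescribed by R_3 and R_4 after multiplication by S. *)
Definition comm_coef1 (r : 'I_3) : T :=
  if r == d1 then - N3 (N1 I0) else N2 I0 * S - N3 (N2 I0).
Definition comm_coef2 (r : 'I_3) : T :=
  if r == d1 then - N3 (N1 I0) else - (N1 I0 * S + N3 (N2 I0)).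
Definition comm_coef3 (r : 'I_3) : T :=
  if r == d1 then N1 (N1 I0) + N1 (N2 I0) else N1 (N2 I0) + N2 (N2 I0) - 2 * S.
Definition comm_rhs (r : 'I_3) (f : T) : T :=
  comm_coef1 r * N1 f + comm_coef2 r * N2 f + comm_coef3 r * N3 f.

Lemma Z_comm3 r f : r != d3 -> Z (S * (D r (N3 f) - N3 (D r f)) - comm_rhs r f).
Proof.
elim/ord3_ind: r => // _; rewrite /comm_rhs /comm_coef1 /comm_coef2 /comm_coef3 /=.
- have := Zsyz (Syz3 D I0 I2f f); rewrite /R3 /commutator -/S.
  by congr (Z _); ring.
- have := Zsyz (Syz4 D I0 I2f f); rewrite /R4 /commutator -/S.
  by congr (Z _); ring.
Qed.

Lemma red_comm_coef k r : (1 < k)%N -> [/\ red (nset k) (comm_coef1 r), red (nset k) (comm_coef2 r)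
  & red (nset k) (comm_coef3 r)].
Proof.
move=> h; have r2 P := @red_2 k P h; have h0 : (0 < k)%N by apply: ltnW.
have rS := red_S h0; have r1 := red_K1 h0; have r1' := red_K2 h0.
have ra : red (nset k) (N1 (N1 I0)) by apply: r2; rewrite /second_order; tauto.
have rb : red (nset k) (N1 (N2 I0)) by apply: r2; rewrite /second_order; tauto.
have rc : red (nset k) (N3 (N1 I0)) by apply: r2; rewrite /second_order; tauto.
have rd : red (nset k) (N2 (N2 I0)) by apply: r2; rewrite /second_order; tauto.
have re : red (nset k) (N3 (N2 I0)) by apply: r2; rewrite /second_order; tauto.
by rewrite /comm_coef1 /comm_coef2 /comm_coef3; case: eqP => _; split;
  do ![assumption|exact: (rd_nat _ 2)|apply: rd_sub|apply: rd_opp|apply: rd_add|apply: rd_mul].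
Qed.

Lemma red_comm_rhs k X r f : (1 < k)%N -> (forall P, nset k P -> red X P) ->
  (forall j, red X (D j f)) -> red X (comm_rhs r f).
Proof.
move=> h kX hf; have [h1 h2 h3] := red_comm_coef r h.
by do ![apply: rd_add]; apply: rd_mul => //; apply: red_sub kX _.
Qed.

Lemma red_swap X r f : r != d3 -> red X S -> red X (comm_rhs r f) ->
  red X (N3 (D r f)) -> red X (D r (N3 f)).
Proof.
move=> r3 XS h1 h2; apply: rd_div.
apply: (@rd_cong _ (S * N3 (D r f) + comm_rhs r f)); last first.
  by apply: rd_add => //; apply: rd_mul.
by have := Z_comm3 f r3; congr (Z _); ring.
Qed.
Lemma red_swap' X r f : r != d3 -> red X S -> red X (comm_rhs r f) ->
  red X (D r (N3 f)) -> red X (N3 (D r f)).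
Proof.
move=> r3 XS h1 h2; apply: rd_div.
apply: (@rd_cong _ (S * D r (N3 f) - comm_rhs r f)); last first.
  by apply: rd_sub => //; apply: rd_mul.
by have := Zopp (Z_comm3 f r3); congr (Z _); ring.
Qed.

(** Derivatives of normal elements of order k reduce to order k + 1. The two
    refinements are part of the induction: they ensure that N3 can be applied
    once more without meeting elements nrm (i, j, 1) of the highest order. *)
Definition step (k : nat) : Prop :=
  [/\ forall n j, nset k n -> red (nset k.+1) (D j n),
      forall n j, cset k n -> red (wset k) (D j n) &
      forall i j, (0 < i + j < k)%N -> red (wset k) (N3 (nrm (i, j, 1)%N))].

Lemma Z_nrm_N2 i j : Z (N2 (nrm (i, j, 0)%N) - nrm (i, j.+1, 0)%N) /\
  Z (N2 (nrm (i, j, 2)%N) - nrm (i, j.+1, 2)%N).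
Proof. by split; apply: Z_iter12. Qed.

Lemma red_comm_rhs_W k r n : (2 < k)%N -> step k.-1 -> nset k.-1 n ->
  red (nset k) (comm_rhs r n).
Proof.
move=> k2 [h _ _] hn; apply: (@red_comm_rhs k) => [|P|j]; first exact: ltnW.
  exact: rd_gen.
by have := h n j hn; rewrite prednK // ltnW // ltnW.
Qed.

Lemma red_wset_D k r n : (2 < k)%N -> step k.-1 ->
  (forall Q, cset k Q -> red (wset k) (D r Q)) ->
  red (wset k.-1) n -> red (wset k) (D r n).
Proof.
move=> k2 [h _ _] hc; have kk : k.-1.+1 = k by rewrite prednK // ltnW // ltnW.
have WS P : red (nset k) P -> red (wset k) P by apply: red_wset.
apply: red_der.
- move=> Q [hQ|]; first by apply: WS; apply: rd_gen; apply: nsetW hQ; apply: leq_pred.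
  by rewrite kk => hQ; apply: WS; apply: rd_gen; apply: cset_nset.
- move=> Q [hQ|]; first by apply: WS; have := h Q r hQ; rewrite kk.
  by rewrite kk => /hc.
- by apply: WS; apply: red_S; do 2!apply: ltnW.
- by apply: WS; apply: red_DS; apply: ltnW.
Qed.

Lemma red_cset_N3 k Q : cset k Q -> red (wset k) (N3 Q).
Proof.
move=> [i [j [l [hl ->]]]]; apply: rd_gen; right.
by exists i, j, l.+1; split=> //; lia.
Qed.

(** For an element N3 n' one commutes N_r with N3: in N3 (N_r n') the inner term
    reduces to wset in order k - 1, on which N3 is under control. *)
Lemma step_c k : (forall m, (m < k)%N -> step m) ->
  forall n j, cset k n -> red (wset k) (D j n).
Proof.
move=> IH n r [i [j [l [h ->]]]]; have [r3|r3] := eqVneq r d3.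
  by rewrite r3; apply: red_cset_N3; exists i, j, l.
case: l h => [|l] h.
  have gen i' j' : (i' + j' <= (i + j).+1)%N -> red (wset k) (nrm (i', j', 2)).
    by move=> le; apply: rd_gen; right; exists i', j', 0%N; split=> //; lia.
  elim/ord3_ind: r r3 => // _; first by apply: (gen i.+1 j); lia.
  by apply: rd_cong (proj2 (Z_nrm_N2 i j)) _; apply: gen; lia.
have k2 : (2 < k)%N by lia.
have Sk : step k.-1 by apply: IH; lia.
have hn : cset k.-1 (nrm (i, j, l.+2)) by exists i, j, l; split=> //; lia.
apply: (@red_swap _ r (nrm (i, j, l.+2))) => //.
- by apply: red_wset; apply: red_S; lia.
- by apply: red_wset; apply: red_comm_rhs_W => //; apply: cset_nset.
- apply: red_wset_D => //; first exact: red_cset_N3.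
  by case: Sk => _ h2 _; apply: h2.
Qed.

(** R_6 is solved for N3 I_2c, the only third order term it has besides N1 I2f. *)
Lemma red_N3_I2c k : (1 < k)%N -> red (wset k) (N3 (N3 (N1 I0))).
Proof.
move=> k1; have k0 : (0 < k)%N by apply: ltnW.
have r2 P : second_order P -> red (wset k) P.
  by move=> hP; apply: red_wset; apply: red_2.
have rS : red (wset k) S by apply: red_wset; apply: red_S.
have r1 : red (wset k) (N1 I0) by apply: red_wset; apply: red_K1.
have r1' : red (wset k) (N2 I0) by apply: red_wset; apply: red_K2.
have ra : red (wset k) (N1 (N1 I0)) by apply: r2; rewrite /second_order; tauto.
have rb : red (wset k) (N1 (N2 I0)) by apply: r2; rewrite /second_order; tauto.
have rc : red (wset k) (N3 (N1 I0)) by apply: r2; rewrite /second_order; tauto.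
have re : red (wset k) (N3 (N2 I0)) by apply: r2; rewrite /second_order; tauto.
have rf : red (wset k) I2f by apply: r2; rewrite /second_order; tauto.
have rg : red (wset k) (N1 I2f).
  by apply: rd_gen; right; exists 1%N, 0%N, 0%N.
apply: rd_div.
apply: (@rd_cong _ (S * N1 I2f + 3 * (N3 (N1 I0) * N3 (N1 I0))
  + (N1 I0 * N1 I0 + N1 I0 * N2 I0 + 3 * N3 (N2 I0)) * N3 (N1 I0)
  - 3 * I2f * (N1 (N1 I0) + N1 (N2 I0)))).
  by have := Zsyz (Syz6 D I0 I2f); rewrite /R6 -/S; congr (Z _); ring.
by do ![assumption|exact: (rd_nat _ 3)|apply: rd_sub|apply: rd_add|apply: rd_mul].
Qed.

Lemma red_N3_I2e k : (1 < k)%N -> red (wset k) (N3 (N3 (N2 I0))).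
Proof.
move=> k1; have k0 : (0 < k)%N by apply: ltnW.
have r2 P : second_order P -> red (wset k) P.
  by move=> hP; apply: red_wset; apply: red_2.
have rS : red (wset k) S by apply: red_wset; apply: red_S.
have r1 : red (wset k) (N1 I0) by apply: red_wset; apply: red_K1.
have r1' : red (wset k) (N2 I0) by apply: red_wset; apply: red_K2.
have rb : red (wset k) (N1 (N2 I0)) by apply: r2; rewrite /second_order; tauto.
have rd : red (wset k) (N2 (N2 I0)) by apply: r2; rewrite /second_order; tauto.
have rc : red (wset k) (N3 (N1 I0)) by apply: r2; rewrite /second_order; tauto.
have re : red (wset k) (N3 (N2 I0)) by apply: r2; rewrite /second_order; tauto.
have rf : red (wset k) I2f by apply: r2; rewrite /second_order; tauto.
have rg : red (wset k) (N2 I2f).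
  by apply: rd_gen; right; exists 0%N, 1%N, 0%N.
apply: rd_div; set a := N1 I0 in r1 *; set b := N2 I0 in r1' *.
have Q : exists2 E, red (wset k) E & S * N3 (N3 b) - E = - R7 D I0 I2f.
  pose E := S * N2 I2f - b * b * b * b - 4 * a * (b * b * b)
    - (5 * (a * a) + 2 * N3 a) * (b * b)
    - (2 * (a * a * a) + (2 * N3 a - 3 * N3 b) * a - 4 * I2f) * b
    + 3 * N3 b * (a * a) + 4 * I2f * a + 3 * (N3 b * N3 b) + 3 * N3 a * N3 b
    - 3 * I2f * (N1 b + N2 b).
  exists E; last by rewrite /E /R7 -/a -/b /S -/a -/b; ring.
  rewrite /E; do ![assumption|exact: (rd_nat _ 2)|exact: (rd_nat _ 3)|exact: (rd_nat _ 4)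
    |exact: (rd_nat _ 5)|apply: rd_sub|apply: rd_add|apply: rd_mul].
case: Q => E hE eE; apply: rd_cong hE; rewrite eE; apply: Zopp.
exact: (Zsyz (Syz7 D I0 I2f)).
Qed.

(** Commuting N_r with N3 twice turns N3 N3 N_r m into N_r N3 N3 m, up to terms
    of order at most k. *)
Lemma red_N3N3 k r m : r != d3 -> (2 < k)%N -> step k.-1 -> step k.-2 ->
  (forall n j, cset k n -> red (wset k) (D j n)) ->
  nset k.-2 m -> nset k.-1 (N3 m) -> nset k (N3 (D r m)) ->
  red (wset k.-1) (N3 (N3 m)) -> red (wset k) (N3 (N3 (D r m))).
Proof.
move=> r3 k2 st1 st2 hc hm h3m h3rm h33m.
have kk : k.-1.+1 = k by lia.
have WS P : red (nset k) P -> red (wset k) P by apply: red_wset.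
have rS : red (nset k) S by apply: red_S; lia.
have rDS : red (nset k) (N3 S) by apply: red_DS; lia.
have rE : red (nset k.-1) (comm_rhs r m).
  apply: (@red_comm_rhs k.-1) => [|P|j]; [by lia|exact: rd_gen|].
  by case: st2 => h _ _; have := h m j hm; rewrite (_ : k.-2.+1 = k.-1) //; lia.
have rDE : red (nset k) (N3 (comm_rhs r m)).
  apply: red_der rE => // [Q hQ|Q hQ].
    by apply: rd_gen; apply: nsetW hQ; lia.
  by case: st1 => h _ _; have := h Q d3 hQ; rewrite kk.
have rr3 : red (nset k) (D r (N3 m)).
  by case: st1 => h _ _; have := h _ r h3m; rewrite kk.
have r3r3 : red (wset k) (N3 (D r (N3 m))).
  apply: red_swap' => //; first exact: WS.
    by apply: WS; apply: red_comm_rhs_W.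
  by apply: red_wset_D => // Q hQ; apply: hc.
apply: rd_div.
apply: (@rd_cong _ (N3 S * D r (N3 m) + S * N3 (D r (N3 m)) - N3 (comm_rhs r m)
   - N3 S * N3 (D r m))); last first.
  apply: rd_sub; last by apply: WS; apply: rd_mul => //; apply: rd_gen.
  apply: rd_sub; last exact: WS.
  by apply: rd_add; [apply: WS; apply: rd_mul|apply: rd_mul => //; apply: WS].
have := Zopp (Zder d3 (Z_comm3 m r3)); rewrite Dsub Dmul Dsub.
by congr (Z _); ring.
Qed.

Lemma step_b k : (forall m, (m < k)%N -> step m) ->
  forall i j, (0 < i + j < k)%N -> red (wset k) (N3 (nrm (i, j, 1)%N)).
Proof.
move=> IH i j /andP[ij0 ijk].
have [ij1|ij1] := leqP (i + j) 1.
  have k1 : (1 < k)%N by lia.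
  case: i ij0 ijk ij1 => [|i] ij0 ijk ij1.
    by rewrite (_ : j = 1%N); [apply: red_N3_I2e|lia].
  rewrite (_ : i.+1 = 1%N); last by lia.
  by rewrite (_ : j = 0%N); [apply: red_N3_I2c|lia].
have k2 : (2 < k)%N by lia.
have st1 : step k.-1 by apply: IH; lia.
have st2 : step k.-2 by apply: IH; lia.
have hc := step_c IH.
have ns k' i' j' l' : (i' + j' + l' <= k')%N -> (i', j', l') != (0, 0, 1)%N ->
  nset k' (nrm (i', j', l')) by move=> h1 h2; exists (i', j', l').
case: i ij0 ijk ij1 => [|i] ij0 ijk ij1.
  case: j ij0 ijk ij1 => [//|j] ij0 ijk ij1.
  apply: (@red_N3N3 k d2 (nrm (0, j, 0)%N)) => //.
  - by apply: (ns k.-2 0 j 0)%N; rewrite ?xpair_eqE; lia.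
  - by apply: (ns k.-1 0 j 1)%N; rewrite ?xpair_eqE; lia.
  - by apply: (ns k 0 j.+1 1)%N; rewrite ?xpair_eqE; lia.
  - by case: st1 => _ _ h; apply: (h 0 j)%N; lia.
apply: (@red_N3N3 k d1 (nrm (i, j, 0)%N)) => //.
- by apply: (ns k.-2 i j 0)%N; rewrite ?xpair_eqE; lia.
- by apply: (ns k.-1 i j 1)%N; rewrite ?xpair_eqE; lia.
- by apply: (ns k i.+1 j 1)%N; rewrite ?xpair_eqE; lia.
- by case: st1 => _ _ h; apply: (h i j)%N; lia.
Qed.

Lemma step_all k : step k.
Proof.
elim/ltn_ind: k => k IH.
have hc := step_c IH; have hb := step_b IH.
split=> // n r [[[i j] l] [hw hne ->]].
have nr i' j' l' : (i' + j' + l' <= k.+1)%N -> (i', j', l') != (0, 0, 1)%N ->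
  red (nset k.+1) (nrm (i', j', l')) by move=> h1 h2; apply: red_nrm.
rewrite /wt /= in hw.
case: l hw hne => [|[|l]] hw hne; last first.
- by apply: red_wset_nset; apply: hc; exists i, j, l; split=> //; lia.
- have ij0 : (0 < i + j)%N by move: hne; rewrite !xpair_eqE; lia.
  have [->|r3] := eqVneq r d3.
    by apply: red_wset_nset; apply: hb; lia.
  have n0 : nset k (nrm (i, j, 0)%N) by exists (i, j, 0)%N; rewrite /wt !xpair_eqE /=; split=> //; lia.
  have n1 : nset k (nrm (i, j, 1)%N) by exists (i, j, 1)%N; rewrite /wt /=; split=> //; lia.
  have n1' i' j' : (i' + j' <= (i + j).+1)%N -> (0 < i' + j')%N ->
    red (nset k.+1) (nrm (i', j', 1)%N) by move=> h1 h2; apply: nr; rewrite ?xpair_eqE; lia.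
  have nN2 : red (nset k.+1) (N2 (nrm (i, j, 0)%N)).
    apply: rd_cong (proj1 (Z_nrm_N2 i j)) _; apply: (nr i j.+1 0)%N; rewrite ?xpair_eqE; lia.
  apply: (@red_swap _ r (nrm (i, j, 0)%N)) => //.
  + by apply: red_S.
  + apply: (@red_comm_rhs k.+1) => [|P|s]; [by lia|exact: rd_gen|].
    elim/ord3_ind: s => //; first by apply: (nr i.+1 j 0)%N; rewrite ?xpair_eqE; lia.
    by apply: (n1' i j); lia.
  + elim/ord3_ind: r r3 => // _; first by apply: (n1' i.+1 j); lia.
    apply: (@rd_cong _ (nrm (i, j.+1, 1)%N)); last by apply: n1'; lia.
    by rewrite -Dsub; apply: Zder; exact: (proj1 (Z_nrm_N2 i j)).
- elim/ord3_ind: r.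
  + by apply: (nr i.+1 j 0)%N; rewrite ?xpair_eqE; lia.
  + by apply: rd_cong (proj1 (Z_nrm_N2 i j)) _; apply: (nr i j.+1 0)%N; rewrite ?xpair_eqE; lia.
  + have [ij0|ij0] := posnP (i + j); last by apply: (nr i j 1)%N; rewrite ?xpair_eqE; lia.
    have [-> ->] : i = 0%N /\ j = 0%N by lia.
    by apply: rd_Z; apply: (Zsyz (Syz1 D I0 I2f)).
Qed.

Definition normal (P : T) : Prop := exists a, a != (0, 0, 1)%N /\ P = nrm a.

Lemma red_normal_I0 : red normal I0.
Proof. by apply: rd_gen; exists (0, 0, 0)%N. Qed.
Lemma red_normal_I2f : red normal I2f.
Proof. by apply: rd_gen; exists (0, 0, 2)%N. Qed.

Lemma red_normal_D j P : red normal P -> red normal (D j P).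
Proof.
have up k Q : red (nset k) Q -> red normal Q.
  by apply: red_sub => {}Q [a [_ h1 h2]]; apply: rd_gen; exists a.
apply: red_der => [Q|Q [a [h ->]]||].
- exact: rd_gen.
- by apply: (up (wt a).+1); have [h1 _ _] := step_all (wt a); apply: h1; exists a.
- exact: (up 1%N _ (red_S (isT : (0 < 1)%N))).
- exact: (up 2%N _ (red_DS j (isT : (1 < 2)%N))).
Qed.

(** Up to a power of S and modulo Z, a reduced element is an honest polynomial
    in the normal derivatives: this is what the independence of their values on
    jets can be applied to. *)
Lemma red_image (Q0 : comNzRingType) (psi : {rmorphism Q0 -> T}) :
  (forall a, C a -> exists q, a = psi q) -> (forall P, normal P -> exists q, P = psi q) ->
  forall P, red normal P -> exists k q, Z (S ^+ k * P - psi q).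
Proof.
move=> psiC psiN P.
have [s sE] : exists s, S = psi s.
  have [q1 e1] := psiN (N1 I0) (ex_intro _ (1, 0, 0)%N (conj isT erefl)).
  have [q2 e2] := psiN (N2 I0) (ex_intro _ (0, 1, 0)%N (conj isT erefl)).
  by exists (q1 + q2); rewrite rmorphD -e1 -e2.
elim=> [Q /psiN[q ->]|a /psiC[q ->]|Q Q' _ [k [q h]] _ [k' [q' h']]
  |Q Q' _ [k [q h]] _ [k' [q' h']]|Q Q' zQ _ [k [q h]]|Q _ [k [q h]]].
- by exists 0%N, q; rewrite expr0 mul1r subrr.
- by exists 0%N, q; rewrite expr0 mul1r subrr.
- exists (k + k')%N, (s ^+ k' * q + s ^+ k * q').
  have -> : S ^+ (k + k') * (Q + Q') - psi (s ^+ k' * q + s ^+ k * q') =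
    S ^+ k' * (S ^+ k * Q - psi q) + S ^+ k * (S ^+ k' * Q' - psi q').
    by rewrite exprD rmorphD !rmorphM !rmorphXn -sE; ring.
  by apply: Zadd; apply: Zmul.
- exists (k + k')%N, (q * q').
  have -> : S ^+ (k + k') * (Q * Q') - psi (q * q') =
    S ^+ k' * Q' * (S ^+ k * Q - psi q) + psi q * (S ^+ k' * Q' - psi q').
    by rewrite exprD rmorphM; ring.
  by apply: Zadd; apply: Zmul.
- exists k, q; have -> : S ^+ k * Q' - psi q = (S ^+ k * Q - psi q) + S ^+ k * (Q' - Q).
    by ring.
  by apply: Zadd => //; apply: Zmul.
- by exists k.+1, q; rewrite exprSr -mulrA.
Qed.
End Reduction.

(** * Completeness of the syzygies *)

Section Saturation.
Context (T : comNzRingType) (D : 'I_3 -> T -> T) (S : T).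
Hypothesis dD : forall j, deriv_along idfun (D j).
Context (I : T -> Prop).
Hypothesis I0 : I 0.
Hypothesis Iadd : forall P Q, I P -> I Q -> I (P + Q).
Hypothesis Imul : forall Q P, I P -> I (Q * P).
Hypothesis Ider : forall j P, I P -> I (D j P).

(** The contraction of the ideal I of the localisation at S. *)
Definition saturated (P : T) : Prop := exists k, I (S ^+ k * P).

Lemma sat_gen P : I P -> saturated P.
Proof. by move=> h; exists 0%N; rewrite expr0 mul1r. Qed.
Lemma sat_add P Q : saturated P -> saturated Q -> saturated (P + Q).
Proof.
move=> [k h] [k' h']; exists (k + k')%N.
have -> : S ^+ (k + k') * (P + Q) = S ^+ k' * (S ^+ k * P) + S ^+ k * (S ^+ k' * Q).
  by rewrite exprD; ring.
by apply: Iadd; apply: Imul.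
Qed.
Lemma sat_mul Q P : saturated P -> saturated (Q * P).
Proof. by move=> [k h]; exists k; rewrite mulrCA; apply: Imul. Qed.
Lemma sat_der j P : saturated P -> saturated (D j P).
Proof.
move=> [k h]; exists k.+1.
have h1 : I (D j (S ^+ k.+1 * P)).
  by apply: Ider; rewrite exprS -mulrA; apply: Imul.
have h2 : I ((- k.+1%:R * D j S) * (S ^+ k * P)) by apply: Imul.
have := Iadd h1 h2; rewrite (der_mul (g := idfun) (dD j)) (der_exp (g := idfun) (dD j)) /=.
by congr (I _); ring.
Qed.
End Saturation.

Lemma iter_incr_mi s n (a : multidx) : iter n (incr_mi s) a =
  ((a.1.1 + n * (s == d1))%N, (a.1.2 + n * (s == d2))%N, (a.2 + n * (s == d3))%N).
Proof.
elim: n => [|n IH] /=; first by case: a => [[? ?] ?]; rewrite !addn0.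
by rewrite IH /incr_mi /= !mulSn; congr (_, _, _); lia.
Qed.

Section Normal.
Context (R : numFieldType) (J : jet_field R).
Local Notation F := (jf J).
Local Notation c := (jc J).
Local Notation Dt := (@jD R J).
Local Notation x := (jX J (inl d1)).
Local Notation y := (jX J (inl d2)).
Local Notation z := (jX J (inl d3)).
Local Notation u := (jX J (inr (0, 0, 0)%N)).
Local Notation w := (x * y - 2 * z).
Local Notation N := (@jN R J).
Local Notation E := (nabla_mx J).

Let Eu : E \in unitmx := nabla_mx_unit J.

Lemma base_fun_jN12 r s : r != d3 -> base_fun (E r s).
Proof.
have bn n : gfield (@base_gen R J) n%:R := base_fun_nat J n.
have bv i : gfield (@base_gen R J) (jX J (inl i)) := base_fun_var J i.
have bz : base_fun (2 * z) by apply: gf_mul; [exact: bn|exact: bv].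
have bw : base_fun w.
  apply: gf_add; first by apply: gf_mul; exact: bv.
  exact: base_fun_opp.
move=> r3; rewrite mxE; elim/ord3_ind: r r3 => // _; rewrite ?jN1 ?jN2 !jD_base.
  apply: gf_add; last by apply: gf_mul; [exact: bz|exact: bn].
  by apply: gf_add; apply: gf_mul; [exact: bv|exact: bn|exact: bv|exact: bn].
by apply: gf_mul; [exact: bw|exact: bn].
Qed.

Ltac ord_step :=
  lazymatch goal with
  | |- gfield _ (_ + _) => apply: gf_add
  | |- gfield _ (_ * _) => apply: gf_mul
  end.

Lemma ord_E r s : ord_le 1 (E r s).
Proof.
have [->|r3] := eqVneq r d3; last by apply: ord_base_fun; apply: base_fun_jN12.
have on n : gfield (ord_gen (J := J) 1) n%:R := ord_nat J 1 n.
have ob i : gfield (ord_gen (J := J) 1) (jX J (inl i)) := ord_base J 1 i.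
have ou t : gfield (ord_gen (J := J) 1) (Dt t u) by apply: ord_D; apply: ord_jet.
have oo f : gfield (ord_gen (J := J) 1) f -> gfield (ord_gen 1) (- f) := @ord_opp R J 1 f.
by rewrite mxE jN3 !jD_base /ord_le; do ![exact: on|exact: ob|exact: ou|ord_step|apply: oo].
Qed.

Lemma jI2f_N3 : jI2f J = \sum_t E d3 t * N d3 (Dt t u)
  - w ^+ 2 * Dt d1 u * Dt d3 u * (x * Dt d3 u + Dt d2 u).
Proof.
rewrite sumI3 !mxE.
exact: (I2f_N3 u (jD_comm d2 d1) (jD_comm d3 d1) (jD_comm d3 d2) (jDxb J) (jDyb J) (jDzb J)).
Qed.

(** By jI2f_N3, the derivation sym_der b passes twice through frame_der d3. *)
Lemma symbol_I2f : has_symbol E (0, 0, 2)%N (jI2f J).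
Proof.
have on n : gfield (ord_gen (J := J) 1) n%:R := ord_nat J 1 n.
have ob i : gfield (ord_gen (J := J) 1) (jX J (inl i)) := ord_base J 1 i.
have ou t : gfield (ord_gen (J := J) 1) (Dt t u) by apply: ord_D; apply: ord_jet.
have oo f : gfield (ord_gen (J := J) 1) f -> gfield (ord_gen 1) (- f) := @ord_opp R J 1 f.
set g := w ^+ 2 * Dt d1 u * Dt d3 u * (x * Dt d3 u + Dt d2 u).
have og : @ord_le R J 1 g.
  by rewrite /g expr2 /ord_le; do ![exact: on|exact: ob|exact: ou|ord_step|apply: oo].
split.
  rewrite jI2f_N3; apply: gf_add; last first.
    by apply: ord_opp; apply: (ord_leW _ og).
  apply: gf_sum => [|t]; first exact: (ord_nat J 2 0).
  apply: gf_mul; first exact: (ord_leW _ (ord_E d3 t)).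
  rewrite jNE; apply: frame_der_ord => // s.
  exact: (ord_leW _ (ord_E d3 s)).
move=> b b2; have db := sym_der_deriv E b.
have wb : (1 < wt b)%N by rewrite b2.
rewrite jI2f_N3 (der_sub db) (sym_der_low E wb og) subr0 (der_sum db).
transitivity (\sum_t E d3 t * shift_mi d3 (fun a => sym_der E a (Dt t u)) b).
  apply: eq_bigr => t _; rewrite (der_mul (g := idfun) db) /=.
  rewrite (sym_der_low E wb (ord_E d3 t)) mul0r add0r jNE.
  by rewrite (sym_der_frame_der Eu b2) // => s; apply: ord_E.
rewrite /shift_mi; have [b0|b0] := eqVneq (mi_coord d3 b) 0%N.
  rewrite big1 => [|t _]; last by rewrite mulr0.
  by case: eqP => // e; move: b0; rewrite e.
have wd : wt (decr_mi d3 b) = 1%N by have := wt_decr b0; rewrite b2 => -[].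
transitivity (\sum_t E d3 t * sym_mul E t (fun a => sym_der E a u) (decr_mi d3 b)).
  apply: eq_bigr => t _; rewrite (sym_der_D _ _ wd) //; exact: ord_jet.
rewrite (frame_sym_mul Eu).
have -> : (fun a => sym_der E a u) = (fun a => (a == (0, 0, 0)%N)%:R).
  by apply/funext => a; rewrite /sym_der jd_var.
by rewrite shift_delta decr_eq.
Qed.

Lemma iter_jN r n f : iter n (N r) f = iter n (frame_der E r) f.
Proof. by elim: n => //= n ->; rewrite jNE. Qed.

Lemma symbol_N12 i j t f : has_symbol E t f ->
  has_symbol E ((t.1.1 + i)%N, (t.1.2 + j)%N, t.2) (iter i (N d1) (iter j (N d2) f)).
Proof.
move=> h; rewrite !iter_jN.
have -> : ((t.1.1 + i)%N, (t.1.2 + j)%N, t.2) =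
    iter i (incr_mi d1) (iter j (incr_mi d2) t).
  by rewrite !iter_incr_mi /=; congr (_, _, _); lia.
by do 2![apply: (has_symbol_iter Eu) => [s|]; first by apply: ord_base_fun; apply: base_fun_jN12].
Qed.

Lemma symbol_nrm a : a != (0, 0, 1)%N -> has_symbol E a (nrm N u (jI2f J) a).
Proof.
case: a => [[i j] [|[|l]]] h; rewrite /nrm /=.
- exact: (symbol_N12 i j (has_symbol_u E)).
- have hs := symbol_N12 i j (has_symbol_u E); rewrite /= !add0n in hs.
  have ij : (0 < i + j)%N by move: h; rewrite !xpair_eqE; lia.
  have := has_symbol_frame_der Eu (j := d3) _ hs.
  rewrite jNE /incr_mi /= !addn0 add0n; apply=> s.
  by apply: (ord_leW _ (ord_E d3 s)); rewrite /wt /= addn0.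
- have hs := symbol_N12 i j symbol_I2f; rewrite /= !add0n in hs.
  have := has_symbol_iter Eu (j := d3) l _ hs.
  rewrite iter_incr_mi /= !muln0 !addn0 muln1 -(iter_jN d3 l) add2n; apply=> s.
  by apply: (ord_leW _ (ord_E d3 s)); rewrite /wt /=; lia.
Qed.

Definition normal_idx : choiceType := {a : nat * nat * nat | a != (0, 0, 1)%N}.
Definition nrm_val (v : normal_idx) : F := nrm N u (jI2f J) (val v).

(** Distinct normal derivatives have distinct monomials as symbols. *)
Theorem normal_indep p : peval c nrm_val p = 0 -> p = 0.
Proof.
apply: (@alg_indep R normal_idx F c nrm_val (fun v => wt (val v)) (fun v => sym_der E (val v))).
- by move=> v; apply: sym_der_deriv.
- by move=> v a; apply: sym_der_const.
- by move=> v; have [_ h] := symbol_nrm (valP v); rewrite h // eqxx oner_eq0.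
move=> v v' le ne; have [h1 h2] := symbol_nrm (valP v').
case: (ltngtP (wt (val v')) (wt (val v))) le => // [lt|e] _.
  exact: sym_der_low lt h1.
by rewrite h2 //; case: eqP => // /val_inj e'; rewrite e' eqxx in ne.
Qed.
End Normal.

Lemma syzygy_morph (T T' : comNzRingType) (ev : {rmorphism T -> T'})
    (D : 'I_3 -> T -> T) (D' : 'I_3 -> T' -> T') (f0 f2 : T) (g0 g2 : T') :
  (forall j P, ev (D j P) = D' j (ev P)) -> ev f0 = g0 -> ev f2 = g2 ->
  (forall r, syzygy D' g0 g2 r -> r = 0) ->
  forall P, syzygy D f0 f2 P -> ev P = 0.
Proof.
move=> evD <- <- h P hP; apply: h.
have ev2 n : ev n%:R = n%:R by apply: rmorph_nat.
case: hP => [|f|f|f|||].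
- by rewrite /R1 evD; apply: Syz1.
- by rewrite /R2 /commutator rmorphB !evD; apply: (Syz2 _ _ _ (ev f)).
- have := Syz3 D' (ev f0) (ev f2) (ev f); rewrite /R3 /commutator.
  by congr (syzygy _ _ _ _); rewrite ?(rmorphD, rmorphN, rmorphM, evD).
- have := Syz4 D' (ev f0) (ev f2) (ev f); rewrite /R4 /commutator.
  by congr (syzygy _ _ _ _); rewrite ?(ev2, evD, rmorphD, rmorphN, rmorphM).
- have := Syz5 D' (ev f0) (ev f2); rewrite /R5.
  by congr (syzygy _ _ _ _); rewrite ?(ev2, evD, rmorphD, rmorphN, rmorphM).
- have := Syz6 D' (ev f0) (ev f2); rewrite /R6.
  by congr (syzygy _ _ _ _); rewrite ?(ev2, evD, rmorphXn, rmorphD, rmorphN, rmorphM).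
- have := Syz7 D' (ev f0) (ev f2); rewrite /R7.
  by congr (syzygy _ _ _ _); rewrite ?(ev2, evD, rmorphXn, rmorphD, rmorphN, rmorphM).
Qed.

Lemma nrm_morph (T T' : comNzRingType) (ev : T -> T')
    (D : 'I_3 -> T -> T) (D' : 'I_3 -> T' -> T') (f0 f2 : T) (g0 g2 : T') :
  (forall j P, ev (D j P) = D' j (ev P)) -> ev f0 = g0 -> ev f2 = g2 ->
  forall a, ev (nrm D f0 f2 a) = nrm D' g0 g2 a.
Proof.
move=> evD <- <- [[i j] l].
have it n r f : ev (iter n (D r) f) = iter n (D' r) (ev f).
  by elim: n => //= n IH; rewrite evD IH.
by rewrite /nrm; case: l => [|[|l]] /=; rewrite ?evD !it.
Qed.

Lemma kernel_reduced (T : comNzRingType) (F : fieldType) (ev : {rmorphism T -> F})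
    (S P Y : T) m k : ev S != 0 -> ev P = 0 ->
  ev (S ^+ m * (S ^+ k * P - Y)) = 0 -> ev Y = 0.
Proof.
move=> S0 P0; rewrite rmorphM rmorphXn rmorphB rmorphM P0 mulr0 sub0r => /eqP.
by rewrite mulf_eq0 expf_eq0 (negPf S0) andbF oppr_eq0 => /eqP.
Qed.

Lemma morph_exp_neq0 (T : comNzRingType) (F : fieldType) (ev : {rmorphism T -> F})
    (S : T) m : ev S != 0 -> ev (S ^+ m) != 0.
Proof. by move=> S0; rewrite rmorphXn expf_neq0. Qed.

Lemma pow_mul_reduced (T : comNzRingType) (S P Y : T) m k : Y = 0 ->
  S ^+ m * (S ^+ k * P - Y) = S ^+ (m + k) * P.
Proof. by move=> ->; rewrite subr0 mulrA exprD. Qed.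

Lemma morph_add0 (T T' : comNzRingType) (ev : {rmorphism T -> T'}) P Q :
  ev P = 0 -> ev Q = 0 -> ev (P + Q) = 0.
Proof. by move=> h h'; rewrite rmorphD h h' addr0. Qed.

Lemma morph_mul0 (T T' : comNzRingType) (ev : {rmorphism T -> T'}) Q P :
  ev P = 0 -> ev (Q * P) = 0.
Proof. by move=> h; rewrite rmorphM h mulr0. Qed.

Section Kernel.
Context (R : numFieldType) (J : jet_field R).
Local Notation F := (jf J).
Local Notation c := (jc J).
Local Notation u := (jX J (inr (0, 0, 0)%N)).
Local Notation N := (@jN R J).
Local Notation T := (formal R bool 3).
Local Notation fN := (@fnabla R bool 3).
Local Notation f0 := (fgen R 3 false).
Local Notation f2 := (fgen R 3 true).
Local Notation Rel := (syzygy fN f0 f2).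
Let S : T := fN d1 f0 + fN d2 f0.

Definition sat_ideal : T -> Prop := saturated S (diff_ideal Rel).

Lemma jev_f0 : jev J f0 = u. Proof. exact: jev_var. Qed.
Lemma jev_f2 : jev J f2 = jI2f J. Proof. exact: jev_var. Qed.

Lemma jev_Rel P : Rel P -> jev J P = 0.
Proof.
exact: (syzygy_morph (ev := jev J) (D' := N) (@jev_nabla R J) jev_f0 jev_f2
  (@jsyz R J)).
Qed.

Lemma jev_ideal P : diff_ideal Rel P -> jev J P = 0.
Proof.
elim=> [|Q /jev_Rel //|Q Q' _ h _ h'|Q Q' _ h|j Q _ h].
- exact: rmorph0.
- exact: (morph_add0 h h').
- exact: (morph_mul0 Q h).
- by rewrite jev_nabla h (der0 (jN_deriv J j)).
Qed.

Lemma jev_S : jev J S = jS J.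
Proof.
rewrite jS_N -jev_f0 -!jev_nabla; exact: (rmorphD (jev J)).
Qed.

Definition const_formal (P : T) : Prop := exists a : R, P = malgC a.

Lemma const_formal_nat n : const_formal n%:R.
Proof. by exists n%:R; rewrite rmorph_nat. Qed.
Lemma const_formal_N1 : const_formal (-1).
Proof. by exists (-1); rewrite rmorphN1. Qed.
Lemma const_formal_der j P : const_formal P -> fN j P = 0.
Proof. by move=> [a ->]; apply: fnabla_const. Qed.

Let red_formal := red fN f0 sat_ideal const_formal (normal fN f0 f2).

Let Zs0 : sat_ideal 0. Proof. exact: (sat_gen S (DIzero Rel)). Qed.
Let Zs_add P Q : sat_ideal P -> sat_ideal Q -> sat_ideal (P + Q).
Proof. exact: (sat_add (@DIadd _ _ _ Rel) (@DImul _ _ _ Rel)). Qed.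
Let Zs_mul Q P : sat_ideal P -> sat_ideal (Q * P).
Proof. exact: (sat_mul (@DImul _ _ _ Rel)). Qed.
Let Zs_der j P : sat_ideal P -> sat_ideal (fN j P).
Proof.
exact: (sat_der (@fnabla_deriv R) (@DIadd _ _ _ Rel) (@DImul _ _ _ Rel) (@DIder _ _ _ Rel)).
Qed.
Let Zs_syz P : Rel P -> sat_ideal P.
Proof. by move=> h; apply: sat_gen; apply: DIgen. Qed.

Lemma red_formal_all P : red_formal P.
Proof.
elim/vpoly_ind: P => [a|[b s]|P Q|P Q]; last first.
- exact: rd_mul.
- exact: rd_add.
- elim: s => [|j s IH].
    case: b; first exact: red_normal_I2f.
    exact: red_normal_I0.
  have h := red_normal_D (@fnabla_deriv R) Zs0 Zs_add Zs_mul Zs_der Zs_syz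
    const_formal_nat const_formal_N1 const_formal_der j IH.
  exact: (eq_ind _ red_formal h _ (@fnabla_var R j (b, s))).
- by apply: rd_const; exists a.
Qed.

Definition nrm_formal (v : normal_idx) : T := nrm fN f0 f2 (val v).
Definition nsubst : {rmorphism {vpoly R[normal_idx]} -> T} :=
  peval_morph (@malgC (cmonom (bool * seq 'I_3)%type) R) nrm_formal.

Lemma jev_nrm a : jev J (nrm fN f0 f2 a) = nrm N u (jI2f J) a.
Proof. exact: (nrm_morph (@jev_nabla R J) jev_f0 jev_f2). Qed.

Lemma jev_nsubst q : jev J (nsubst q) = peval c (nrm_val J) q.
Proof.
apply/esym; apply: (peval_uniq (g := jev J \o nsubst)) => [a|v].
- have e : nsubst (malgC a) = malgC a by apply: peval_const.
  exact: (etrans (congr1 (jev J) e) (jev_const J a)).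
- have e : nsubst (pvar R v) = nrm_formal v by apply: peval_var.
  exact: (etrans (congr1 (jev J) e) (jev_nrm (val v))).
Qed.

(** Reduce P to a polynomial q in the normal derivatives. The value of q on jets
    is zero since that of P is, and q = 0 by normal_indep. So a power of S times
    P lies in the ideal. *)
Theorem kernel_diff_ideal P : jev J P = 0 ->
  exists Q, jev J Q != 0 /\ diff_ideal Rel (Q * P).
Proof.
move=> P0.
have psiC a : const_formal a -> exists q, a = nsubst q.
  by move=> [r ->]; exists (malgC r); apply/esym; apply: peval_const.
have psiN Q : normal fN f0 f2 Q -> exists q, Q = nsubst q.
  move=> [a [ha ->]]; exists (pvar R (exist _ a ha : normal_idx)).
  by apply/esym; apply: peval_var.
have [k [q [m h]]] := red_image Zs0 Zs_add Zs_mul psiC psiN (red_formal_all P).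
have S0 : jev J S != 0 by rewrite jev_S jS_neq0.
have q0 := kernel_reduced S0 P0 (jev_ideal h).
have {}q0 : q = 0.
  by apply: (@normal_indep R J); rewrite -jev_nsubst.
exists (S ^+ (m + k)); split; first exact: morph_exp_neq0.
have e : nsubst q = 0 by rewrite q0 rmorph0.
exact: (eq_ind _ (diff_ideal Rel) h _ (pow_mul_reduced S P m k e)).
Qed.
End Kernel.

(** * The formulas in coordinates and the theorem *)

Section Coordinates.
Context (R : numFieldType) (J : jet_field R).
Local Notation Dt := (@jD R J).
Local Notation N := (@jN R J).
Local Notation jet i j k := (jX J (inr (i%N, j%N, k%N))).
Local Notation x := (jX J (inl d1)).
Local Notation y := (jX J (inl d2)).
Local Notation z := (jX J (inl d3)).
Local Notation w := (x * y - 2 * z).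
Local Notation u := (jet 0 0 0).
Local Notation u1 := (jet 1 0 0).
Local Notation u2 := (jet 0 1 0).
Local Notation u3 := (jet 0 0 1).
Local Notation u11 := (jet 2 0 0).
Local Notation u12 := (jet 1 1 0).
Local Notation u13 := (jet 1 0 1).
Local Notation u22 := (jet 0 2 0).
Local Notation u23 := (jet 0 1 1).
Local Notation u33 := (jet 0 0 2).

Let e1 : u1 = Dt d1 u. Proof. by rewrite jD_jet. Qed.
Let e2 : u2 = Dt d2 u. Proof. by rewrite jD_jet. Qed.
Let e3 : u3 = Dt d3 u. Proof. by rewrite jD_jet. Qed.
Let e11 : u11 = Dt d1 (Dt d1 u). Proof. by rewrite !jD_jet. Qed.
Let e12 : u12 = Dt d1 (Dt d2 u). Proof. by rewrite !jD_jet. Qed.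
Let e13 : u13 = Dt d1 (Dt d3 u). Proof. by rewrite !jD_jet. Qed.
Let e22 : u22 = Dt d2 (Dt d2 u). Proof. by rewrite !jD_jet. Qed.
Let e23 : u23 = Dt d2 (Dt d3 u). Proof. by rewrite !jD_jet. Qed.
Let e33 : u33 = Dt d3 (Dt d3 u). Proof. by rewrite !jD_jet. Qed.
Let ej := (e11, e12, e13, e22, e23, e33, e1, e2, e3).

Let h1 := jD_deriv J d1.
Let h2 := jD_deriv J d2.
Let h3 := jD_deriv J d3.
Let h4 := @jD_comm _ J d2 d1.
Let h5 := @jD_comm _ J d3 d1.
Let h6 := @jD_comm _ J d3 d2.

Lemma nabla1_jet f : x * Dt d1 f + y * Dt d2 f + 2 * z * Dt d3 f = N d1 f.
Proof. by []. Qed.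

Lemma nabla2_jet f : 0 * Dt d1 f + 0 * Dt d2 f + w * Dt d3 f = N d2 f.
Proof. by rewrite !mul0r !add0r. Qed.

Lemma nabla3_jet f : (x * u3 + u2) * w * Dt d1 f + (- u1 * w) * Dt d2 f
  + (- x * u1 * w) * Dt d3 f = N d3 f.
Proof. by rewrite jN3 !ej. Qed.

Lemma I1a_jet : w * u3 = N d2 u.
Proof. by rewrite jN2 e3. Qed.

Lemma I1b_jet : x * u1 + y * (u2 + x * u3) = N d1 u + N d2 u.
Proof. by rewrite jN1 jN2 e1 e2 e3; ring. Qed.

Lemma I2a_jet :
  y ^+ 2 * u22 + y * (4 * z * u23 + 2 * x * u12 + u2) + 4 * z ^+ 2 * u33
  + z * (4 * x * u13 + 4 * u3) + x * (x * u11 + u1) = N d1 (N d1 u).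
Proof. by rewrite !ej; apply/esym/N1N1u => //; apply: jDxb || apply: jDyb || apply: jDzb. Qed.

Lemma I2b_jet : w * (y * u23 + 2 * z * u33 + x * u13 + 2 * u3) = N d1 (N d2 u).
Proof. by rewrite !ej; apply/esym/N1N2u => //; apply: jDxb || apply: jDyb || apply: jDzb. Qed.

Lemma I2c_jet :
  - w * (x ^+ 2 * (u1 * u13 - u3 * u11)
   + x * (u1 * (y * u23 + 2 * z * u33 + u3 + u12)
          - y * u3 * u12 - 2 * z * u3 * u13 - u2 * u11)
   + u1 * (y * u22 + 2 * z * u23) - u2 * (y * u12 + 2 * z * u13)) = N d3 (N d1 u).
Proof. by rewrite !ej; apply/esym/N3N1u => //; apply: jDxb || apply: jDyb || apply: jDzb. Qed.

Lemma I2d_jet : w * (- 2 * u3 + w * u33) = N d2 (N d2 u).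
Proof. by rewrite !ej; apply/esym/N2N2u => //; apply: jDxb || apply: jDyb || apply: jDzb. Qed.

Lemma I2e_jet :
  - w * (x ^+ 2 * y * (u1 * u33 - u3 * u13)
   + x * (y * (u1 * u23 - u3 ^+ 2 - u2 * u13)
          + u1 * (- 2 * z * u33 - u3) + 2 * z * u3 * u13)
   - y * u2 * u3 - 2 * z * (u1 * u23 - u2 * u13)) = N d3 (N d2 u).
Proof. by rewrite !ej; apply/esym/N3N2u => //; apply: jDxb || apply: jDyb || apply: jDzb. Qed.

Lemma I2f_jet :
  w ^+ 2 *
  (x ^+ 2 * (u1 ^+ 2 * u33 - 2 * u1 * u3 * u13 + u3 ^+ 2 * u11)
   + x * (2 * u1 ^+ 2 * u23 - u1 * u3 ^+ 2 - 2 * u1 * u3 * u12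
          - 2 * u1 * u2 * u13 + 2 * u2 * u3 * u11)
   + u1 ^+ 2 * u22 - u1 * u2 * u3 - 2 * u1 * u2 * u12 + u2 ^+ 2 * u11) = jI2f J.
Proof. by rewrite !ej. Qed.
End Coordinates.

Section Instance.
Context (R : realType).
Local Notation F := (jetfun R).

Definition jet_model : jet_field R :=
  JetField (jc := @jconst R : {rmorphism R -> F}) (jX := @jvar R)
    (@total_deriv R) (@total_const R) (@total_base R) (@total_jet R)
    (@jder_deriv R) (@jder_const R) (@jder_var R) (@gfield_all R).
Local Notation J := jet_model.

Lemma total_combE (p q r f : F) :
  total_comb (tnth [tuple p; q; r]) f = p * total d1 f + q * total d2 f + r * total d3 f.
Proof. by rewrite /total_comb sumI3 !(tnth_nth 0). Qed.

Lemma nablaE : @nabla R = @jN R J.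
Proof.
apply/funext => j; apply/funext => f; elim/ord3_ind: j.
- exact: (etrans (total_combE _ _ _ _) (@nabla1_jet R J f)).
- exact: (etrans (total_combE _ _ _ _) (@nabla2_jet R J f)).
- exact: (etrans (total_combE _ _ _ _) (@nabla3_jet R J f)).
Qed.

Lemma I_2fE : I_2f R = jI2f J. Proof. exact: (@I2f_jet R J). Qed.

Lemma generatorE : @generator R = @jgenerator R J.
Proof. by apply/funext => -[]; [exact: I_2fE|]. Qed.

Lemma fevalE P : feval (@jconst R) (@generator R) (@nabla R) P = jev J P.
Proof. by rewrite nablaE generatorE. Qed.

Section OneA.
Context (A : 'M[R]_2).
Hypothesis A_unit : A \in unitmx.

Lemma PhiE : Phi A = jPhi J A. Proof. by []. Qed.

Lemma JacE : Jac A = jacobian (jPhi J A).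
Proof. by apply/matrixP => s t; rewrite !mxE. Qed.

Lemma prolDE t : prolD A t = frame_der (pulled_frame (jPhi J A)) t.
Proof. by apply/funext => f; rewrite /prolD JacE. Qed.

Lemma prol_var_pulled v : prol_var A v = pulled_var (jPhi J A) v.
Proof.
case: v => [i|[[i j] k]]; first exact: (congr1 (fun p => p i) PhiE).
by rewrite /prol_var !prolDE.
Qed.

Lemma prol_var_inj (p : jetpoly R) : peval (@jconst R) (prol_var A) p = 0 -> p = 0.
Proof.
rewrite (funext prol_var_pulled); exact: (prol_var_indep A_unit (J := J)).
Qed.

Definition prol_unit : {rmorphism F -> F} :=
  frac_morph (g := peval_morph (@jconst R) (prol_var A)) prol_var_inj.
End OneA.

(** The identity is a default value for singular matrices. *)
Definition prol_morph (A : 'M[R]_2) : {rmorphism F -> F} :=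
  match boolP (A \in unitmx) with
  | AltTrue h => prol_unit h
  | AltFalse _ => idfun
  end.

Lemma prol_morphE (A : 'M[R]_2) f : A \in unitmx -> prol A f = prol_morph A f.
Proof.
by rewrite /prol_morph => uA; case: {-}_ / boolP => // ; rewrite uA.
Qed.

Lemma prol_morph_poly (A : 'M[R]_2) (p : jetpoly R) : A \in unitmx ->
  prol_morph A (FracField.tofrac p) = peval (@jconst R) (prol_var A) p.
Proof.
move=> uA; rewrite -prol_morphE //.
exact: (frac_ext_tofrac (g := peval_morph (@jconst R) (prol_var A)) (prol_var_inj uA) p).
Qed.

Lemma prol_morph_const (A : 'M[R]_2) r : A \in unitmx ->
  prol_morph A (jc J r) = jc J r.
Proof.
move=> uA; exact: (etrans (prol_morph_poly (malgC r) uA) (peval_const _ _ r)).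
Qed.

Lemma prol_morph_var (A : 'M[R]_2) v : A \in unitmx ->
  prol_morph A (jX J v) = pulled_var (jPhi J A) v.
Proof.
move=> uA; rewrite -prol_var_pulled.
exact: (etrans (prol_morph_poly (pvar R v) uA) (peval_var (@jconst R) _ v)).
Qed.

Lemma nabla_invariant j : invariant_derivation (@nabla R j).
Proof.
split=> [|A uA f].
  by elim/ord3_ind: j; [exists (tnth [tuple base R d1; base R d2; 2 * base R d3])|
    exists (tnth [tuple 0; 0; base R d1 * base R d2 - 2 * base R d3])|eexists].
rewrite nablaE !prol_morphE //.
exact: (@pull_jN R J A uA (prol_morph A) (fun r => prol_morph_const r uA)
  (fun v => prol_morph_var v uA) j f).
Qed.

Lemma nabla_presentation : presented_by (@jconst R) (@generator R) (@nabla R)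
  (@diff_invariant R) (@formal_syzygy R).
Proof.
have sc A r := @prol_morph_const A r; have sv A v := @prol_morph_var A v.
split.
- move=> P A uA; rewrite fevalE prol_morphE //.
  exact: (@pull_ev R J prol_morph sc sv A uA P).
- move=> f inv.
  have [P [Q [Q0 ->]]] : ratio_inv (J := J) f.
    apply: (@invariant_ratio R J prol_morph sc sv f) => A uA.
    by rewrite -prol_morphE // inv.
  by exists P, Q; rewrite !fevalE.
- by move=> P hP; rewrite fevalE; exact: (@jev_Rel R J P hP).
- move=> P; rewrite fevalE => P0; have [Q [Q0 hQ]] := @kernel_diff_ideal R J P P0.
  by exists Q; rewrite fevalE.
Qed.
End Instance.

Theorem theorem8p3 (R : realType) :
  [/\ (* the listed invariants through I_0 and the derivations *)
      [/\ I_1a R = nabla2 (I_0 R),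
          I_1b R = nabla1 (I_0 R) + nabla2 (I_0 R),
          I_2a R = nabla1 (nabla1 (I_0 R)),
          I_2b R = nabla1 (nabla2 (I_0 R)) &
          [/\ I_2c R = nabla3 (nabla1 (I_0 R)),
              I_2d R = nabla2 (nabla2 (I_0 R)) &
              I_2e R = nabla3 (nabla2 (I_0 R))]],
      (* nabla_1, nabla_2, nabla_3 are invariant derivations *)
      forall j, invariant_derivation (@nabla R j),
      (* R_1, ..., R_7 vanish on the jet space, R_2, R_3, R_4 as operators *)
      forall r : jetfun R, syzygy (@nabla R) (I_0 R) (I_2f R) r -> r = 0
    & (* generation of the algebra and of the syzygies *)
      presented_by (@jconst R) (@generator R) (@nabla R)
        (@diff_invariant R) (@formal_syzygy R)].
Proof.
split; last exact: nabla_presentation.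
- have e1 : @nabla1 R = jN (J := jet_model R) d1 by rewrite -nablaE.
  have e2 : @nabla2 R = jN (J := jet_model R) d2 by rewrite -nablaE.
  have e3 : @nabla3 R = jN (J := jet_model R) d3 by rewrite -nablaE.
  rewrite e1 e2 e3; split; [exact: (@I1a_jet R (jet_model R))|exact: (@I1b_jet R (jet_model R))|
    exact: (@I2a_jet R (jet_model R))|exact: (@I2b_jet R (jet_model R))|].
  split; [exact: (@I2c_jet R (jet_model R))|exact: (@I2d_jet R (jet_model R))|
    exact: (@I2e_jet R (jet_model R))].
- exact: nabla_invariant.
- by move=> r; rewrite nablaE I_2fE; exact: (@jsyz R (jet_model R) r).
Qed.
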